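(* Let $m\ge1$, let $n_1,\dots,n_m$ be positive integers, $|\mathbf n|=n_1+\dots+n_m$, and let $\omega_1,\dots,\omega_m\in\mathbb C$ satisfy $|\mathrm{Im}\,\omega_i|<\pi$ for all $i$ and $$\mathrm{Re}\,\omega_1<\mathrm{Re}\,\omega_2<\dots<\mathrm{Re}\,\omega_m<0.$$ Then $$\mathrm I^{(\gamma)}_{n_1,\dots,n_m}(0;e^{-\omega_1},\dots,e^{-\omega_m};-1)=\mathrm{Li}_{n_1,\dots,n_m}(e^{\omega_1-\omega_2},e^{\omega_2-\omega_3},\dots,e^{\omega_{m-1}-\omega_m},-e^{\omega_m})$$ $$=i^{|\mathbf n|-m}\int_{(\mathbb R+i0)^m}\ \prod_{k=1}^m\frac{e^{-ip_k\omega_k}}{\mathfrak{sh}(\pi p_k)}\,\frac{dp_k}{(p_1+\dots+p_k)^{n_k}}.$$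
   Context: $\mathfrak{sh}(x)=e^{x}-e^{-x}$. The multiple polylogarithm is the power series, convergent for $|z_i|<1$, $$\mathrm{Li}_{n_1,\dots,n_m}(z_1,\dots,z_m)=\sum_{0<k_1<\dots<k_m}\frac{z_1^{k_1}\cdots z_m^{k_m}}{k_1^{n_1}\cdots k_m^{n_m}}.$$ For a path $\gamma:[0,1]\to\mathbb C$ and 1-forms $\eta_1,\dots,\eta_N$, the iterated integral is $\int_\gamma\eta_1\circ\dots\circ\eta_N=\int_{0\le t_1\le\dots\le t_N\le1}\gamma^*\eta_1(t_1)\wedge\dots\wedge\gamma^*\eta_N(t_N)$. The function $\mathrm I^{(\gamma)}_{n_1,\dots,n_m}(0;z_1,\dots,z_m;z_{m+1})$ is the iterated integral, along the straight path $\gamma$ from $0$ to $z_{m+1}$, of the sequence of $n_1+\dots+n_m$ one-forms made of $m$ consecutive blocks, the $j$-th block being $\frac{dt}{z_j-t}$ followed by $n_j-1$ copies of $\frac{dt}{t}$. The notation $(\mathbb R+i0)^m$ means integration over $(\mathbb R+i\varepsilon)^m$ with $\varepsilon>0$ sufficiently small (the limit $\varepsilon\to0^+$), each line oriented from left to right. *)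

(* Defs.v *)
From HB Require Import structures.
From mathcomp Require Import all_boot all_order all_algebra.
From mathcomp Require Import all_classical all_reals all_analysis.
From mathcomp Require Import complex.

Set Implicit Arguments.
Unset Strict Implicit.
Unset Printing Implicit Defensive.

Import Order.TTheory GRing.Theory Num.Theory.
Import numFieldNormedType.Exports.

Local Open Scope classical_set_scope.
Local Open Scope ring_scope.
Local Open Scope complex_scope.

Definition tcons d (T : measurableType d) n (p : T * n.-tuple T) :
  n.+1.-tuple T := [tuple of p.1 :: p.2].

Lemma measurable_tcons d (T : measurableType d) n :
  measurable_fun [set: T * n.-tuple T] (@tcons d T n).
Proof. exact: measurable_cons. Qed.

Section TupleMeasureStep.
Local Open Scope ereal_scope.
Context d (T : measurableType d) (R : realType) (n : nat).
Variable m : {sigma_finite_measure set T -> \bar R}.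
Variable mu : {sigma_finite_measure set (n.-tuple T) -> \bar R}.

(* Product measure m (x) mu, transported along (x, t) |-> x :: t. *)
Definition tuple_measureS : set (n.+1.-tuple T) -> \bar R :=
  pushforward (m \x mu) (@tcons d T n).

Let pf : {measure set (n.+1.-tuple T) -> \bar R} :=
  measure_function_pushforward__canonical__measure_function_Measure
    (m \x mu) (@measurable_tcons d T n).

HB.instance Definition _ := isMeasure.Build _ _ _ tuple_measureS
  (measure0 pf) (measure_ge0 pf) (@measure_semi_sigma_additive _ _ _ pf).

Let tuple_measureS_sigma_finite : sigma_finite setT tuple_measureS.
Proof.
have /sigma_finiteP[F [FT ndF Foo]] := sigma_finiteT m.
have /sigma_finiteP[G [GT ndG Goo]] := sigma_finiteT mu.
pose g (t : n.+1.-tuple T) : T * n.-tuple T := (thead t, [tuple of behead t]).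
have gK : cancel (@tcons d T n) g.
  by case=> x t; congr pair; apply: val_inj.
have tK : cancel g (@tcons d T n) by move=> t; rewrite [RHS]tuple_eta.
have mg : measurable_fun setT g.
  apply/measurable_fun_pairP; split.
    exact: (measurable_tnth ord0).
  exact: measurable_behead.
exists (fun k => g @^-1` (F k `*` G k)).
  rewrite -preimage_bigcup (_ : \bigcup_k _ = setT) ?preimage_setT//.
  apply/seteqP; split=> // -[x t] _.
  have [i _ Fx] : (\bigcup_k F k) x by rewrite -FT.
  have [j _ Gt] : (\bigcup_k G k) t by rewrite -GT.
  exists (maxn i j) => //; split => /=.
    by move: x Fx; exact/subsetPset/ndF/leq_maxl.
  by move: t Gt; exact/subsetPset/ndG/leq_maxr.
move=> k; have [mF Fk] := Foo k; have [mG Gk] := Goo k; split.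
  by rewrite -[X in measurable X]setTI; apply: mg => //; exact: measurableX.
rewrite /tuple_measureS /pushforward -comp_preimage.
rewrite (_ : g \o _ = id); last exact/funext.
by rewrite preimage_id product_measure1E// lte_mul_pinfty// ge0_fin_numE.
Qed.

HB.instance Definition _ := Measure_isSigmaFinite.Build _ _ _ tuple_measureS
  tuple_measureS_sigma_finite.

End TupleMeasureStep.

(* Lebesgue measure on R^n, realised on n-tuples. *)
Fixpoint lebesgue_tuple (R : realType) (n : nat) :
    {sigma_finite_measure set (n.-tuple (measurableTypeR R)) -> \bar R} :=
  match n with
  | 0 => \d_ ([tuple] : 0.-tuple (measurableTypeR R))
  | n'.+1 => tuple_measureS (@lebesgue_measure R) (lebesgue_tuple R n')
  end.

Lemma lebesgue_tuple_box (R : realType) (n : nat)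
    (A : 'I_n -> set (measurableTypeR R)) :
  (forall i, measurable (A i)) ->
  lebesgue_tuple R n [set t | forall i, A i (tnth t i)] =
  (\prod_(i < n) lebesgue_measure (A i))%E.
Proof.
elim: n A => [|n IHn] A mA.
  by rewrite big_ord0 /= diracE mem_set// => i; have := ltn_ord i.
rewrite big_ord_recl -IHn//= /tuple_measureS /pushforward.
have mB : measurable
    [set t : n.-tuple (measurableTypeR R) |
      forall i, A (lift ord0 i) (tnth t i)].
  rewrite (_ : mkset _ = \bigcap_(i in [set: 'I_n])
      ((fun t => tnth t i) @^-1` A (lift ord0 i))); last first.
    by apply/seteqP; split=> t /= At i => [_|]; exact: At.
  apply: fin_bigcap_measurable => // i _.
  by rewrite -[X in measurable X]setTI; exact: measurable_tnth.
rewrite -product_measure1E//; congr product_measure1.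
apply/seteqP; split=> -[x t] /= => [At|[Ax At] i].
  split; first by have := At ord0.
  by move=> i; have := At (lift ord0 i); rewrite tnthS.
by case: (unliftP ord0 i) => [j|] ->//; rewrite tnthS.
Qed.

Section ComplexIntegral.
Context (R : realType).

Definition cexp (z : R[i]) : R[i] :=
  (expR (complex.Re z))%:C * (cos (complex.Im z) +i* sin (complex.Im z)).

(* This is twice the usual hyperbolic sine. *)
Definition csh (z : R[i]) : R[i] := cexp z - cexp (- z).

(* Real and imaginary parts Lebesgue integrable, i.e. absolute convergence. *)
Definition cintegrable d (T : measurableType d) (mu : {measure set T -> \bar R})
    (D : set T) (f : T -> R[i]) : Prop :=
  mu.-integrable D (fun x => (complex.Re (f x))%:E) /\
  mu.-integrable D (fun x => (complex.Im (f x))%:E).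

(* Junk-valued unless cintegrable holds. *)
Definition cintegral d (T : measurableType d) (mu : {measure set T -> \bar R})
    (D : set T) (f : T -> R[i]) : R[i] :=
  (\int[mu]_(x in D) complex.Re (f x)) +i*
  (\int[mu]_(x in D) complex.Im (f x)).

End ComplexIntegral.

Section IteratedIntegral.
Context (R : realType).

Definition path_deriv (gamma : R -> R[i]) (s : R) : R[i] :=
  derive1 (fun u => complex.Re (gamma u)) s +i*
  derive1 (fun u => complex.Im (gamma u)) s.

(* The simplex 0 <= t_1 <= ... <= t_N <= 1. *)
Definition simplex (N : nat) : set (N.-tuple (measurableTypeR R)) :=
  [set t | path <=%R (0 : R) (rcons t (1 : R))].

(* A 1-form f(z) dz on a subset of C is represented by its coefficient f, and
   eta_1, ..., eta_N by the list eta; the pullback of f(z) dz by gamma is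
   f(gamma(s)) gamma'(s) ds. *)
Definition iterated_integrand (gamma : R -> R[i]) (eta : seq (R[i] -> R[i]))
    (t : (size eta).-tuple (measurableTypeR R)) : R[i] :=
  \prod_(i < size eta)
    (nth (fun=> 0) eta i (gamma (tnth t i)) * path_deriv gamma (tnth t i)).

Definition iterated_integral_converges (gamma : R -> R[i])
    (eta : seq (R[i] -> R[i])) : Prop :=
  cintegrable (lebesgue_tuple R (size eta)) (@simplex (size eta))
    (iterated_integrand gamma (eta := eta)).

Definition iterated_integral (gamma : R -> R[i])
    (eta : seq (R[i] -> R[i])) : R[i] :=
  cintegral (lebesgue_tuple R (size eta)) (@simplex (size eta))
    (iterated_integrand gamma (eta := eta)).

Definition straight_path (a b : R[i]) (s : R) : R[i] := a + s%:C * (b - a).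

(* m consecutive blocks; block j is dt/(z_j - t) followed by n_j - 1 copies of
   dt/t. The length is n_1 + ... + n_m when all n_j > 0. *)
Definition I_forms (m : nat) (n : 'I_m -> nat) (z : 'I_m -> R[i]) :
    seq (R[i] -> R[i]) :=
  flatten [seq (fun t => (z j - t)^-1) :: nseq (n j).-1 (fun t => t^-1)
          | j <- enum 'I_m].

Definition I_converges (m : nat) (n : 'I_m -> nat) (z : 'I_m -> R[i])
    (b : R[i]) : Prop :=
  iterated_integral_converges (straight_path 0 b) (I_forms n z).

Definition I_integral (m : nat) (n : 'I_m -> nat) (z : 'I_m -> R[i])
    (b : R[i]) : R[i] :=
  iterated_integral (straight_path 0 b) (I_forms n z).

End IteratedIntegral.

Section MultiplePolylogarithm.
Context (R : realType) (m : nat) (n : 'I_m -> nat) (z : 'I_m -> R[i]).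

Definition Li_term (k : m.-tuple nat) : R[i] :=
  \prod_(j < m) (z j ^+ tnth k j / (tnth k j)%:R ^+ n j).

(* Absolute convergence over the index set 0 < k_1 < ... < k_m. *)
Definition Li_converges : Prop :=
  summable [set k : m.-tuple nat | path ltn 0%N k]
    (fun k => (complex.Re (Li_term k))%:E) /\
  summable [set k : m.-tuple nat | path ltn 0%N k]
    (fun k => (complex.Im (Li_term k))%:E).

(* Sum over 0 < k_1 < ... < k_m < K. *)
Definition Li_partial (K : nat) : R[i] :=
  \sum_(k : m.-tuple 'I_K | path ltn 0%N (map val k))
    Li_term (map_tuple val k).

Definition Li : R[i] :=
  lim ((fun K => complex.Re (Li_partial K)) @ \oo) +i*
  lim ((fun K => complex.Im (Li_partial K)) @ \oo).

End MultiplePolylogarithm.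

Section FourierSide.
Context (R : realType) (m : nat) (n : 'I_m -> nat) (omega : 'I_m -> R[i]).

(* (e^(omega_1 - omega_2), ..., e^(omega_(m-1) - omega_m), - e^(omega_m)):
   insub j.+1 is None exactly when j is the last index. *)
Definition Li_args (j : 'I_m) : R[i] :=
  if insub j.+1 is Some j' then cexp (omega j - omega j')
  else - cexp (omega j).

Definition fourier_integrand (p : 'I_m -> R[i]) : R[i] :=
  \prod_(k < m) (cexp (- ('i%C * p k * omega k)) / csh (pi%:C * p k) /
                 (\sum_(j < m | (j <= k)%N) p j) ^+ n k).

(* The integrand on (R + i eps)^m, parametrised by p_k = x_k + i eps, so that
   dp_k = dx_k. *)
Definition shifted_integrand (eps : R)
    (x : m.-tuple (measurableTypeR R)) : R[i] :=
  fourier_integrand (fun k => tnth x k +i* eps).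

Definition fourier_converges (eps : R) : Prop :=
  cintegrable (lebesgue_tuple R m) [set: m.-tuple (measurableTypeR R)]
    (shifted_integrand eps).

Definition fourier_integral (eps : R) : R[i] :=
  cintegral (lebesgue_tuple R m) [set: m.-tuple (measurableTypeR R)]
    (shifted_integrand eps).

End FourierSide.

(* Main.v *)
Require Import Defs.
From HB Require Import structures.
From mathcomp Require Import all_boot all_order all_algebra.
From mathcomp Require Import all_classical all_reals all_analysis.
From mathcomp Require Import measurable_realfun complex ring lra.

Set Implicit Arguments.
Unset Strict Implicit.
Unset Printing Implicit Defensive.

Import Order.TTheory GRing.Theory Num.Theory.
Import numFieldNormedType.Exports.
Import ComplexField.Normc.

Local Open Scope classical_set_scope.
Local Open Scope ring_scope.
Local Open Scope complex_scope.

(** Put w_k = - exp(omega_k), so that |w_k| < 1. Written with the gaps l_k between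
consecutive summation indices, the polylogarithm is the sum over l_1, ..., l_m >= 1
of the product over k of w_k^(l_k) / (l_1 + ... + l_k)^(n_k). Summing over l_1 last
leads to the recursion
  S_m(a) = sum over l >= 1 of w_1^l (a + l)^(- n_1) S_(m-1)(a + l)
in an offset a, where S_(m-1) belongs to the remaining indices and the polylogarithm
is S_m(0). The proof shows that the series, the iterated integral and the Fourier
integral all satisfy this recursion when the sums stop at l = K ([trunc_sum]), up to
an error that is geometric in K; hence they are equal. No infinite sum is ever
exchanged with an integral.

For the series this is a comparison of two ways of truncating it
([gap_sum_trunc]).

For the iterated integral, the path is s |-> - s, which turns the forms into ds/s
and - ds/(z + s) = w ds/(1 - w s) with w = - 1/z. Give the first variable a weight s^a
and integrate it out: ds/s divides by a and keeps the weight for the next variable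
([weighted_inv]), while the geometric expansion of w/(1 - w s) produces the sum over l
and the weights s^(a + l) ([weighted_pole]). Blocks of forms thus reproduce the
recursion ([weighted_I_forms]).

For the Fourier integral, put z = - i p, so that Re z = eps > 0. By Fubini the first
variable can be integrated last, against a function of the offset a + z, and one needs
the one-variable formula ([kernel_iter])
  int k H = sum over l <= K of w^l H(l) + w^K int k H(K + .),
where k is the kernel - i exp(- i p omega) / sh(pi p) and H is a rational function with
poles in Re z <= 0. Moving the line of integration from height eps to 1 + eps
multiplies k by w and crosses the pole p = i, that is z = 1 ([kernel_step]).

The residue theorem behind this ([residue_at_i]) is obtained from real integrals
only. Suppose that f(p + h) = f(p) + h f'(p) + O(|h|^2) with an integrable bound. Then
f(p + i h) - f(p) - i (f(p + h) - f(p)) = O(h^2), and f(p + h) - f(p) has integral zero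
along a horizontal line, by translation invariance. So the integral of f along the line
at height y changes by O(h^2) when y changes by h: it is constant
([line_integral_shift]). Across the pole, the lines at distance d above and below it
are compared with the Poisson kernel 2 i d / (x^2 + d^2), whose integral is 2 pi i; the
difference is O(sqrt d) ([pole_jump]). *)

Local Notation Re := complex.Re.
Local Notation Im := complex.Im.

(** * Norm and exponential of complex numbers *)

Section ComplexNorm.
Context (R : realType).
Implicit Types (z w : R[i]) (x : R).

Lemma normc_ge0 z : 0 <= normc z.
Proof. by case: z => a b; exact: sqrtr_ge0. Qed.

Lemma normcD z w : normc (z + w) <= normc z + normc w.
Proof. by have := ler_normD z w; rewrite -lecR rmorphD. Qed.

Lemma normcN z : normc (- z) = normc z.
Proof. by case: z => a b /=; rewrite !sqrrN. Qed.

Lemma normcB z w : normc (z - w) <= normc z + normc w.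
Proof. by rewrite (le_trans (normcD _ _))// normcN. Qed.

Lemma normc_distC z w : normc (z - w) = normc (w - z).
Proof. by rewrite -normcN opprB. Qed.

Lemma normc_real x : normc x%:C = `|x|.
Proof. by rewrite /= expr0n /= addr0 sqrtr_sqr. Qed.

Lemma normc_nat n : normc (n%:R : R[i]) = n%:R.
Proof. by rewrite -(rmorph_nat (real_complex R)) normc_real ger0_norm. Qed.

Lemma normc_i : normc ('i : R[i]) = 1.
Proof. by rewrite /= expr0n expr1n add0r sqrtr1. Qed.

Lemma normcX z n : normc (z ^+ n) = normc z ^+ n.
Proof.
by elim: n => [|n IHn]; rewrite ?expr0 ?normc1// !exprS normcM IHn.
Qed.

Lemma normc_sum (I : Type) (r : seq I) (P : pred I) (F : I -> R[i]) :
  normc (\sum_(i <- r | P i) F i) <= \sum_(i <- r | P i) normc (F i).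
Proof.
elim/big_ind2 : _ => [|x1 x2 y1 y2 h1 h2|//]; first by rewrite normc0.
by rewrite (le_trans (normcD _ _))// lerD.
Qed.

Lemma normRe_le z : `|Re z| <= normc z.
Proof.
case: z => a b /=; rewrite -sqrtr_sqr ler_wsqrtr// lerDl sqr_ge0//.
Qed.

Lemma normIm_le z : `|Im z| <= normc z.
Proof.
case: z => a b /=; rewrite -sqrtr_sqr ler_wsqrtr// lerDr sqr_ge0//.
Qed.

Lemma normc_le z : normc z <= `|Re z| + `|Im z|.
Proof.
rewrite [z in normc z]complexE (le_trans (normcD _ _))// normcM normc_i mul1r.
by rewrite !normc_real.
Qed.

Lemma normc_eq0 z : (normc z == 0) = (z == 0).
Proof. by apply/eqP/eqP => [/eq0_normc//|->]; rewrite normc0. Qed.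

Lemma normc_gt0 z : (0 < normc z) = (z != 0).
Proof. by rewrite lt_def normc_ge0 andbT normc_eq0. Qed.

Lemma normc_sqr z : normc z ^+ 2 = Re z ^+ 2 + Im z ^+ 2.
Proof. by case: z => a b /=; rewrite sqr_sqrtr// addr_ge0 ?sqr_ge0. Qed.

Lemma cReD z w : Re (z + w) = Re z + Re w. Proof. by case: z; case: w. Qed.
Lemma cImD z w : Im (z + w) = Im z + Im w. Proof. by case: z; case: w. Qed.
Lemma cReN z : Re (- z) = - Re z. Proof. by case: z. Qed.
Lemma cImN z : Im (- z) = - Im z. Proof. by case: z. Qed.
Lemma cReM z w : Re (z * w) = Re z * Re w - Im z * Im w.
Proof. by case: z; case: w. Qed.
Lemma cImM z w : Im (z * w) = Re z * Im w + Im z * Re w.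
Proof. by case: z; case: w. Qed.
Lemma cRe_nat n : Re (n%:R : R[i]) = n%:R.
Proof. by rewrite -(rmorph_nat (real_complex R)). Qed.
Lemma cIm_nat n : Im (n%:R : R[i]) = 0.
Proof. by rewrite -(rmorph_nat (real_complex R)). Qed.
Lemma cReV z : Re z^-1 = Re z / (Re z ^+ 2 + Im z ^+ 2). Proof. by case: z. Qed.
Lemma cImV z : Im z^-1 = - (Im z / (Re z ^+ 2 + Im z ^+ 2)). Proof. by case: z. Qed.

Lemma eqc z w : Re z = Re w -> Im z = Im w -> z = w.
Proof. by case: z w => [? ?] [? ?] /= -> ->. Qed.

End ComplexNorm.

Section ComplexExponential.
Context (R : realType).
Implicit Types (z w : R[i]) (x y : R).

Lemma cexpD z w : cexp (z + w) = cexp z * cexp w.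
Proof.
case: z w => [a b] [c d]; rewrite /cexp /= expRD cosD sinD.
by apply: eqc; rewrite !(cReM, cImM) /=; ring.
Qed.

Lemma cexp0 : cexp (0 : R[i]) = 1.
Proof.
by rewrite /cexp /= expR0 cos0 sin0; apply: eqc; rewrite /= ?mulr0 ?mulr1 ?subr0 ?mul0r ?addr0.
Qed.

Lemma normc_cexp z : normc (cexp z) = expR (Re z).
Proof.
rewrite /cexp normcM normc_real ger0_norm ?expR_ge0//=.
by rewrite cos2Dsin2 sqrtr1 mulr1.
Qed.

Lemma cexp_neq0 z : cexp z != 0.
Proof. by rewrite -normc_gt0 normc_cexp expR_gt0. Qed.

Lemma cexpN z : cexp (- z) = (cexp z)^-1.
Proof.
by apply: (mulfI (cexp_neq0 z)); rewrite -cexpD subrr cexp0 mulfV// cexp_neq0.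
Qed.

(** The upper bound comes from exp(-x) >= 1 - x, that is exp(x) <= 1/(1 - x). *)
Lemma expR_quad x : `|x| <= 2^-1 -> 0 <= expR x - 1 - x <= 2 * x ^+ 2.
Proof.
rewrite ler_norml => /andP[xl xu]; have e1 := expR_ge1Dx x.
have e2 := expR_ge1Dx (- x); rewrite expRN in e2.
have e0 := expR_gt0 x.
have e3 : (1 - x) * expR x <= 1.
  by rewrite -ler_pdivlMr// div1r.
apply/andP; split; first lra.
nra.
Qed.

Lemma mean_value (f df : R -> R) y :
  (forall x, is_derive x 1 f (df x)) ->
  exists2 c, `|c| <= `|y| & f y - f 0 = df c * y.
Proof.
move=> fdf.
have cf a b : {within `[a, b], continuous f}.
  apply: continuous_subspaceT => x; apply: differentiable_continuous.
  by apply/derivable1_diffP; exact: ex_derive.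
have [y0|y0] := leP 0 y.
  have [c] := MVT_segment y0 (fun x _ => fdf x) (cf _ _).
  rewrite in_itv/= subr0 => /andP[c0 cy] ->; exists c => //.
  by rewrite !ger0_norm.
have [c] := MVT_segment (ltW y0) (fun x _ => fdf x) (cf _ _).
rewrite in_itv/= sub0r => /andP[c0 cy] e; exists c.
  by rewrite !ler0_norm ?lerN2// ltW.
by rewrite -opprB e mulrN opprK.
Qed.

Lemma sin_lin y : `|sin y| <= `|y|.
Proof.
have [c _] := mean_value y (fun x => is_derive_sin x).
rewrite sin0 subr0 => ->; rewrite normrM ler_piMl//; exact: cos_max.
Qed.

Lemma cos_quad y : `|cos y - 1| <= y ^+ 2.
Proof.
(* cos c - cos 0 = - sin c * y with |c| <= |y|, and |sin c| <= |c| *)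
have [c cy] := mean_value y (fun x => is_derive_cos x).
rewrite cos0 => ->; rewrite normrM normrN expr2 -normrM -[leRHS]ger0_norm ?sqr_ge0//.
by rewrite -expr2 normrX expr2 normrM ler_wpM2r// (le_trans (sin_lin _)).
Qed.

Lemma sin_quad y : `|y| <= 2^-1 -> `|sin y - y| <= y ^+ 2.
Proof.
move=> y1.
have d x : is_derive x 1 (fun t => sin t - t) (cos x - 1) by exact: is_deriveB.
have [c cy] := mean_value y d.
rewrite sin0 !subr0 => ->; rewrite normrM -real_normK ?num_real// expr2.
rewrite ler_wpM2r// (le_trans (cos_quad _))// -real_normK ?num_real//.
by have := normr_ge0 c; nra.
Qed.

(** The only analytic input on the exponential: all the second-order expansions
below are deduced from this one by algebra. *)
Lemma cexp_quad z : normc z <= 2^-1 ->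
  normc (cexp z - 1 - z) <= 6 * normc z ^+ 2.
Proof.
move=> z1; have x1 := le_trans (normRe_le z) z1.
have y1 := le_trans (normIm_le z) z1.
rewrite normc_sqr; case: z z1 x1 y1 => x y z1 x1 y1.
rewrite (le_trans (normc_le _))// /cexp !(cReM, cImM, cReD, cImD, cReN, cImN) /=.
rewrite /= in x1 y1.
rewrite !mul0r subr0 addr0 oppr0 addr0.
have -> : expR x * cos y - 1 - x = (expR x - 1 - x) * cos y + (1 + x) * (cos y - 1).
  by ring.
have -> : expR x * sin y - y = (expR x - 1) * sin y + (sin y - y) by ring.
have /andP[ex0 ex1] := expR_quad x1.
have cy := cos_quad y; have sy := sin_quad y1; have sl := sin_lin y.
have h1 : `|(expR x - 1 - x) * cos y| <= 2 * x ^+ 2.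
  by rewrite normrM (le_trans (ler_piMr _ (cos_max _)))// ger0_norm.
have h2 : `|(1 + x) * (cos y - 1)| <= 2 * y ^+ 2.
  rewrite normrM ler_pM// (le_trans (ler_normD _ _))// normr1; lra.
have h3 : `|(expR x - 1) * sin y| <= 2 * (x ^+ 2 + y ^+ 2).
  rewrite normrM.
  have e1 : `|expR x - 1| <= 2 * `|x|.
    rewrite (_ : expR x - 1 = (expR x - 1 - x) + x); last by ring.
    rewrite (le_trans (ler_normD _ _))// ger0_norm//.
    have := normr_ge0 x; have := real_normK (num_real x); nra.
  rewrite (le_trans (ler_pM _ _ e1 sl))//.
  have := real_normK (num_real x); have := real_normK (num_real y).
  have := sqr_ge0 (`|x| - `|y|); rewrite sqrrB; nra.
have t1 := ler_normD ((expR x - 1 - x) * cos y) ((1 + x) * (cos y - 1)).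
have t2 := ler_normD ((expR x - 1) * sin y) (sin y - y).
have := sqr_ge0 x; have := sqr_ge0 y; lra.
Qed.

Lemma csh_sqr z :
  normc (csh z) ^+ 2 = expR (Re z *+ 2) + expR (- (Re z *+ 2)) - cos (Im z *+ 2) *+ 2.
Proof.
case: z => x y; rewrite normc_sqr /csh /cexp.
rewrite !(cReM, cImM, cReD, cImD, cReN, cImN) /= cosN sinN cos_mulr2n.
have e : expR x * expR (- x) = 1 by rewrite -expRD subrr expR0.
have cs := cos2Dsin2 y.
rewrite !mulr2n (opprD x x) !expRD.
set E := expR x in e *; set F := expR (- x) in e *.
set c := cos y in cs *; set s := sin y in cs *.
apply/eqP; rewrite -subr_eq0; apply/eqP.
transitivity ((E ^+ 2 + F ^+ 2 + 2) * (c ^+ 2 + s ^+ 2 - 1)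
  - 2 * (E * F - 1) * (c ^+ 2 - s ^+ 2)); first by ring.
by rewrite cs e; ring.
Qed.

(** Exponential growth with a constant that vanishes only on the horizontal lines
through the zeros of sh, so that it is uniform on every strip that avoids them. *)
Lemma normc_csh_ge z : `|sin (Im z)| * expR `|Re z| <= normc (csh z).
Proof.
rewrite -(@ler_pXn2r _ 2) ?nnegrE ?normc_ge0 ?mulr_ge0 ?expR_ge0//.
rewrite csh_sqr exprMn real_normK ?num_real// cos_mulr2n.
have -> : expR (Re z *+ 2) + expR (- (Re z *+ 2)) =
  expR `|Re z| ^+ 2 + expR (- `|Re z|) ^+ 2.
  rewrite -!expRM_natl !mulr_natl.
  case: (ger0P (Re z)) => _; rewrite ?opprK ?mulNrn//.
  by rewrite addrC.
set E := expR `|Re z|.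
have E1 : 1 <= E by rewrite -expR0 ler_expR.
rewrite expRN -/E.
have e : E * E^-1 = 1 by rewrite mulfV// gt_eqF// (lt_le_trans _ E1).
set F := E^-1 in e *.
have := cos2Dsin2 (Im z); set c := cos _ ^+ 2; set s := sin _ ^+ 2 => cs.
have s0 : 0 <= s by exact: sqr_ge0.
have s1 : s <= 1 by rewrite -cs lerDr sqr_ge0.
have -> : c = 1 - s by rewrite -cs; ring.
have h := sqr_ge0 (E - F).
have F0 : 0 <= F by rewrite invr_ge0; lra.
nra.
Qed.

(** Unlike the previous bound, this one survives on lines that pass arbitrarily
close to a zero, as long as the real part stays away from it. *)
Lemma normc_csh_ge_real z : expR `|Re z| - expR (- `|Re z|) <= normc (csh z).
Proof.
rewrite /csh; have := normc_cexp z; have := normc_cexp (- z); rewrite cReN => e1 e2.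
have h1 : normc (cexp z) - normc (cexp (- z)) <= normc (cexp z - cexp (- z)).
  by rewrite lerBlDr (le_trans _ (normcD _ _))// subrK.
have h2 : normc (cexp (- z)) - normc (cexp z) <= normc (cexp z - cexp (- z)).
  by rewrite lerBlDr normc_distC (le_trans _ (normcD _ _))// subrK.
by rewrite e1 e2 in h1 h2; case: (ger0P (Re z)) => _; rewrite ?opprK.
Qed.

Lemma cexp_pii : cexp (pi%:C * 'i) = -1 :> R[i].
Proof.
by rewrite /cexp !(cReM, cImM) /= !mulr0 !mul0r !mulr1 subrr addr0 expR0 cospi sinpi;
  apply: eqc; rewrite !(cReM, cImM)/= ?cReN ?cImN /=; ring.
Qed.

(** The antiperiodicity that turns the line at height 1 + eps into a multiple of
the line at height eps. *)
Lemma csh_shift (p : R[i]) : csh (pi%:C * (p + 'i)) = - csh (pi%:C * p).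
Proof.
by rewrite /csh mulrDr opprD !cexpD ![cexp (- (pi%:C * 'i))]cexpN cexp_pii invrN1; ring.
Qed.

Lemma cexp_i_shift (p w : R[i]) :
  cexp (- ('i * (p + 'i) * w)) = cexp w * cexp (- ('i * p * w)).
Proof.
rewrite -cexpD; congr cexp; have := sqr_i R; rewrite expr2 => ii.
by rewrite mulrDr ii; ring.
Qed.

End ComplexExponential.

(** * Integrals of complex functions and Fubini on tuples *)

Lemma measurable_inv (R : realType) : measurable_fun [set: R] (@GRing.inv R).
Proof.
have -> : [set: R] = [set x | x != 0] `|` [set 0].
  by rewrite eqEsubset; split=> // x _ /=; case: (eqVneq x 0); [right|left].
have o0 : open [set x : R | x != 0].
  rewrite (_ : mkset _ = ~` [set 0]); last first.
    by rewrite eqEsubset; split=> x /= /eqP.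
  exact/closed_openC/closed_eq.
apply/measurable_funU => //; first exact: open_measurable.
split; last exact: measurable_fun_set1.
by apply: open_continuous_measurable_fun => // x; rewrite inE => x0; exact: inv_continuous.
Qed.

Section ComplexMeasurable.
Context (R : realType) d (T : measurableType d).
Implicit Types (f g : T -> R[i]) (D : set T).

(** Componentwise measurability: it is all that the componentwise integral sees,
and it avoids putting a sigma-algebra on R[i]. *)
Definition cmeasurable D f :=
  measurable_fun D (fun x => Re (f x)) /\ measurable_fun D (fun x => Im (f x)).

Lemma cmeasurable_cst D c : cmeasurable D (fun=> c).
Proof. by split; exact: measurable_cst. Qed.

Lemma cmeasurableD D f g : cmeasurable D f -> cmeasurable D g ->
  cmeasurable D (fun x => f x + g x).
Proof.
move=> [f1 f2] [g1 g2]; split; [under eq_fun do rewrite cReD|under eq_fun do rewrite cImD];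
  exact: measurable_funD.
Qed.

Lemma cmeasurableN D f : cmeasurable D f -> cmeasurable D (fun x => - f x).
Proof.
move=> [f1 f2]; split; [under eq_fun do rewrite cReN|under eq_fun do rewrite cImN];
  exact: measurable_funN.
Qed.

Lemma cmeasurableM D f g : cmeasurable D f -> cmeasurable D g ->
  cmeasurable D (fun x => f x * g x).
Proof.
move=> [f1 f2] [g1 g2]; split.
  by under eq_fun do rewrite cReM; apply: measurable_funB; exact: measurable_funM.
by under eq_fun do rewrite cImM; apply: measurable_funD; exact: measurable_funM.
Qed.

Lemma cmeasurableV D f : cmeasurable D f -> cmeasurable D (fun x => (f x)^-1).
Proof.
move=> [f1 f2].
have mv : measurable_fun D (fun x => (Re (f x) ^+ 2 + Im (f x) ^+ 2)^-1).
  apply: (measurableT_comp (@measurable_inv R)).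
  by apply: measurable_funD; exact: measurable_funX.
split; [under eq_fun do rewrite cReV|under eq_fun do rewrite cImV].
  exact: measurable_funM.
by apply: measurable_funN; exact: measurable_funM.
Qed.

Lemma cmeasurableX D f n : cmeasurable D f -> cmeasurable D (fun x => f x ^+ n).
Proof.
move=> mf; elim: n => [|n IHn]; first exact: cmeasurable_cst.
by under eq_fun do rewrite exprS; exact: cmeasurableM.
Qed.

Lemma cmeasurable_sum D (I : Type) (r : seq I) (P : pred I) (F : I -> T -> R[i]) :
  (forall i, cmeasurable D (F i)) -> cmeasurable D (fun x => \sum_(i <- r | P i) F i x).
Proof.
move=> mF; elim: r => [|i r IHr]; first by under eq_fun do rewrite big_nil; exact: cmeasurable_cst.
by under eq_fun do rewrite big_cons; case: (P i) => //; exact: cmeasurableD.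
Qed.

Lemma cmeasurable_prod D (I : Type) (r : seq I) (P : pred I) (F : I -> T -> R[i]) :
  (forall i, cmeasurable D (F i)) -> cmeasurable D (fun x => \prod_(i <- r | P i) F i x).
Proof.
move=> mF; elim: r => [|i r IHr]; first by under eq_fun do rewrite big_nil; exact: cmeasurable_cst.
by under eq_fun do rewrite big_cons; case: (P i) => //; exact: cmeasurableM.
Qed.

Lemma cmeasurable_cexp D f : cmeasurable D f -> cmeasurable D (fun x => cexp (f x)).
Proof.
move=> [f1 f2]; apply: cmeasurableM; first split=> /=.
- exact: measurableT_comp.
- exact: measurable_cst.
- split=> /=; apply: measurableT_comp => //; apply: continuous_measurable_fun.
    exact: continuous_cos.
  exact: continuous_sin.
Qed.

Lemma cmeasurable_csh D f : cmeasurable D f -> cmeasurable D (fun x => csh (f x)).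
Proof.
move=> mf; apply: cmeasurableD; first exact: cmeasurable_cexp.
by apply/cmeasurableN/cmeasurable_cexp/cmeasurableN.
Qed.

Lemma measurable_normc D f : cmeasurable D f -> measurable_fun D (fun x => normc (f x)).
Proof.
move=> [f1 f2].
have -> : (fun x => normc (f x)) = (fun x => Num.sqrt (Re (f x) ^+ 2 + Im (f x) ^+ 2)).
  by apply/funext => x; case: (f x).
apply: (@measurableT_comp _ _ _ _ _ _ (@Num.sqrt R)).
  by apply: continuous_measurable_fun; exact: sqrt_continuous.
by apply: measurable_funD; exact: measurable_funX.
Qed.

Lemma cmeasurable_if D (P : pred T) f : measurable_fun setT P ->
  cmeasurable setT f -> cmeasurable D (fun x => if P x then f x else 0).
Proof.
move=> mP [f1 f2]; split.
  rewrite (_ : (fun _ => _) = fun x => if P x then Re (f x) else 0); last first.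
    by apply/funext => x; case: ifP.
  by apply: measurable_funTS; exact: measurable_fun_ifT.
rewrite (_ : (fun _ => _) = fun x => if P x then Im (f x) else 0); last first.
  by apply/funext => x; case: ifP.
by apply: measurable_funTS; exact: measurable_fun_ifT.
Qed.

End ComplexMeasurable.

Lemma cmeasurable_comp (R : realType) d d' (T : measurableType d)
    (T' : measurableType d') (h : T' -> T) (f : T -> R[i]) :
  measurable_fun setT h -> cmeasurable setT f -> cmeasurable setT (fun x => f (h x)).
Proof. by move=> mh [f1 f2]; split; [exact: (measurableT_comp f1 mh)|exact: (measurableT_comp f2 mh)]. Qed.

Section ComplexIntegralTheory.
Context (R : realType) d (T : measurableType d) (mu : {measure set T -> \bar R}).
Context (D : set T) (mD : measurable D).
Implicit Types (f g : T -> R[i]) (b : T -> R).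

Lemma cintegrable_measurable f : cintegrable mu D f -> cmeasurable D f.
Proof. by move=> [/measurable_int/measurable_EFinP ? /measurable_int/measurable_EFinP ?]. Qed.

Lemma cintegrable_le f b : cmeasurable D f -> mu.-integrable D (EFin \o b) ->
  (forall x, D x -> normc (f x) <= b x) -> cintegrable mu D f.
Proof.
move=> [f1 f2] ib fb; split; apply: le_integrable ib => //.
- exact/measurable_EFinP.
- move=> x Dx /=; rewrite lee_fin (le_trans (normRe_le _))//.
  by rewrite (le_trans (fb _ Dx))// ler_norm.
- exact/measurable_EFinP.
- move=> x Dx /=; rewrite lee_fin (le_trans (normIm_le _))//.
  by rewrite (le_trans (fb _ Dx))// ler_norm.
Qed.

Lemma cintegrable_normc f : cintegrable mu D f ->
  mu.-integrable D (EFin \o (fun x => normc (f x))).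
Proof.
move=> cf; have mf := cintegrable_measurable cf; case: cf => f1 f2.
have := integrableD mD (integrable_norm f1) (integrable_norm f2).
apply: le_integrable => //.
  by apply/measurable_EFinP; exact: measurable_normc.
move=> x _ /=; rewrite lee_fin ger0_norm ?normc_ge0// ger0_norm ?addr_ge0//.
exact: normc_le.
Qed.

Lemma cintegrableD f g : cintegrable mu D f -> cintegrable mu D g ->
  cintegrable mu D (fun x => f x + g x).
Proof.
move=> [f1 f2] [g1 g2]; split.
  by under eq_fun do rewrite cReD EFinD; exact: integrableD.
by under eq_fun do rewrite cImD EFinD; exact: integrableD.
Qed.

Lemma cintegrableZ c f : cintegrable mu D f -> cintegrable mu D (fun x => c * f x).
Proof.
move=> [f1 f2]; split.
  under eq_fun do rewrite cReM EFinB !EFinM.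
  by apply: integrableB => //; exact: integrableZl.
under eq_fun do rewrite cImM EFinD !EFinM.
by apply: integrableD => //; exact: integrableZl.
Qed.

Lemma cintegrableN f : cintegrable mu D f -> cintegrable mu D (fun x => - f x).
Proof. by move/(cintegrableZ (-1)); under eq_fun do rewrite mulN1r. Qed.

Lemma cintegrableB f g : cintegrable mu D f -> cintegrable mu D g ->
  cintegrable mu D (fun x => f x - g x).
Proof. by move=> cf /cintegrableN cg; exact: cintegrableD. Qed.

Lemma cintegralD f g : cintegrable mu D f -> cintegrable mu D g ->
  cintegral mu D (fun x => f x + g x) = cintegral mu D f + cintegral mu D g.
Proof.
move=> [f1 f2] [g1 g2]; rewrite /cintegral; apply: eqc => /=.
  by under eq_Rintegral do rewrite cReD; exact: RintegralD.
by under eq_Rintegral do rewrite cImD; exact: RintegralD.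
Qed.

Lemma cintegralZ c f : cintegrable mu D f ->
  cintegral mu D (fun x => c * f x) = c * cintegral mu D f.
Proof.
move=> [f1 f2]; rewrite /cintegral.
have hz r (g : T -> R) : mu.-integrable D (EFin \o g) ->
    mu.-integrable D (EFin \o (fun x => r * g x)) by move=> ig; exact: (integrableZl mD r ig).
apply: eqc.
  rewrite cReM /=; under eq_Rintegral do rewrite cReM.
  by rewrite RintegralB ?RintegralZl//; exact: hz.
rewrite cImM /=; under eq_Rintegral do rewrite cImM.
by rewrite RintegralD ?RintegralZl//; exact: hz.
Qed.

Lemma cintegralN f : cintegrable mu D f ->
  cintegral mu D (fun x => - f x) = - cintegral mu D f.
Proof. by move/(cintegralZ (-1)); rewrite mulN1r => <-; under eq_fun do rewrite -mulN1r. Qed.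

Lemma cintegralB f g : cintegrable mu D f -> cintegrable mu D g ->
  cintegral mu D (fun x => f x - g x) = cintegral mu D f - cintegral mu D g.
Proof. by move=> cf cg; rewrite cintegralD ?cintegralN//; exact: cintegrableN. Qed.

Lemma cintegral0 : cintegral mu D (fun=> 0 : R[i]) = 0.
Proof. by rewrite /cintegral /Rintegral /= integral0. Qed.

(** The factor 2 is the price of bounding the two components separately; only the
order of magnitude is used. *)
Lemma normc_cintegral_le f b : cmeasurable D f -> mu.-integrable D (EFin \o b) ->
  (forall x, D x -> normc (f x) <= b x) ->
  normc (cintegral mu D f) <= 2 * Rintegral mu D b.
Proof.
move=> mf ib fb; have [f1 f2] := cintegrable_le mf ib fb.
rewrite (le_trans (normc_le _))//= mulr2n mulrDl mul1r lerD//.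
- rewrite (le_trans (le_normr_Rintegral _ _))// le_Rintegral//.
    exact: integrable_norm.
  by move=> x Dx; rewrite (le_trans (normRe_le _)) ?fb.
- rewrite (le_trans (le_normr_Rintegral _ _))// le_Rintegral//.
    exact: integrable_norm.
  by move=> x Dx; rewrite (le_trans (normIm_le _)) ?fb.
Qed.

Lemma eq_cintegral f g : (forall x, D x -> f x = g x) ->
  cintegral mu D f = cintegral mu D g.
Proof.
by move=> fg; rewrite /cintegral; congr (_ +i* _); apply: eq_Rintegral => x /[!inE] /fg ->.
Qed.

Lemma eq_cintegrable f g : (forall x, D x -> f x = g x) ->
  cintegrable mu D f -> cintegrable mu D g.
Proof.
by move=> fg [f1 f2]; split; [apply: eq_integrable f1|apply: eq_integrable f2] => // x /[!inE] /fg ->.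
Qed.

Lemma cintegral_mkcond f :
  cintegral mu D f = cintegral mu setT (fun x => if x \in D then f x else 0).
Proof.
rewrite /cintegral; congr (_ +i* _); rewrite Rintegral_mkcond; apply: eq_Rintegral => x _;
  by rewrite patchE; case: ifP.
Qed.

Lemma cintegrable_mkcond f :
  cintegrable mu D f <-> cintegrable mu setT (fun x => if x \in D then f x else 0).
Proof.
rewrite /cintegrable; split=> [[/integrable_mkcond f1 /integrable_mkcond f2]|[f1 f2]].
  split; [have := f1 mD|have := f2 mD]; apply: eq_integrable => // x _;
  by rewrite patchE /=; case: ifP.
by split; apply/integrable_mkcond => //; [move: f1|move: f2]; apply: eq_integrable => // x _;
  rewrite patchE /=; case: ifP.
Qed.

End ComplexIntegralTheory.

Section TupleFubini.
Context (R : realType) d (T : measurableType d) (n : nat).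
Variable m : {sigma_finite_measure set T -> \bar R}.
Variable mu : {sigma_finite_measure set (n.-tuple T) -> \bar R}.
Variable f : n.+1.-tuple T -> R[i].
Hypothesis mf : cmeasurable setT f.

Variable H : n.-tuple T -> R.
Hypothesis iH : mu.-integrable setT (EFin \o H).
Hypothesis fH : forall t,
  (\int[m]_x (normc (f (tcons (x, t))))%:E <= (H t)%:E)%E.

Let mfc := cmeasurable_comp (@measurable_tcons d T n) mf.

(** Tonelli with the first coordinate integrated first: the bound H on the inner
integral may use the relation between the first coordinate and the others,
which a product bound could not (dt/t is not integrable near 0 by itself). *)
Lemma cintegrable_tuple_prod : cintegrable (m \x mu)%E setT (fun z => f (tcons z)).
Proof.
have mN := measurable_normc mfc.
have inorm : (m \x mu)%E.-integrable setT (fun z => (normc (f (tcons z)))%:E).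
  apply/integrable21ltyP; first exact/measurable_EFinP.
  apply: (@le_lt_trans _ _ (\int[mu]_t `|(H t)%:E|)%E); last first.
    by case/integrableP: iH.
  apply: ge0_le_integral => //.
  - by move=> t _; exact: integral_ge0.
  - apply: (@measurable_fun_fubini_tonelli_G _ _ _ _ _ m (fun z => `|(normc (f (tcons z)))%:E|%E)) => //.
    by apply: measurableT_comp => //; exact/measurable_EFinP.
  - by apply: measurableT_comp => //; case/integrableP: iH.
  - move=> t _; apply: le_trans (lee_abs _).
    apply: le_trans (fH t); rewrite le_eqVlt; apply/orP; left; apply/eqP.
    by apply: eq_integral => x _ /=; rewrite ger0_norm ?normc_ge0.
by apply: (cintegrable_le measurableT mfc inorm) => z _; exact: lexx.
Qed.

Lemma cintegrable_tuple_measureS : cintegrable (tuple_measureS m mu) setT f.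
Proof.
have [f1 f2] := cintegrable_tuple_prod; case: mf => mf1 mf2.
have mt := @measurable_tcons d T n.
split; apply: (integrable_pushforward mt) => //; exact/measurable_EFinP.
Qed.

Let cintegral_tuple_prod :
  cintegral (tuple_measureS m mu) setT f = cintegral (m \x mu)%E setT (fun z => f (tcons z)).
Proof.
have [f1 f2] := cintegrable_tuple_prod; case: mf => mf1 mf2.
have mt := @measurable_tcons d T n.
rewrite /cintegral /Rintegral; congr (fine _ +i* fine _).
  by rewrite /tuple_measureS (integral_pushforward mt)//; exact/measurable_EFinP.
by rewrite /tuple_measureS (integral_pushforward mt)//; exact/measurable_EFinP.
Qed.

Lemma cintegral_tuple12 :
  cintegral (tuple_measureS m mu) setT f =
  cintegral m setT (fun x => cintegral mu setT (fun t => f (tcons (x, t)))).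
Proof.
rewrite cintegral_tuple_prod; have [f1 f2] := cintegrable_tuple_prod.
rewrite /cintegral /Rintegral; congr (fine _ +i* fine _) => /=.
  rewrite -(integral12_prod_meas1 f1); apply: ae_eq_integral => //.
  - exact: (measurable_fubini_F f1).
  - apply/measurable_EFinP; apply: (measurableT_comp (@fine_measurable R _ measurableT)) => //.
    exact: (measurable_fubini_F f1).
  - have := ae_integrable1 f1; apply: filterS => x ix _.
    by rewrite fineK//; exact: integrable_fin_num.
rewrite -(integral12_prod_meas1 f2); apply: ae_eq_integral => //.
- exact: (measurable_fubini_F f2).
- apply/measurable_EFinP; apply: (measurableT_comp (@fine_measurable R _ measurableT)) => //.
  exact: (measurable_fubini_F f2).
- have := ae_integrable1 f2; apply: filterS => x ix _.
  by rewrite fineK//; exact: integrable_fin_num.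
Qed.

Lemma cintegral_tuple21 :
  cintegral (tuple_measureS m mu) setT f =
  cintegral mu setT (fun t => cintegral m setT (fun x => f (tcons (x, t)))).
Proof.
rewrite cintegral_tuple_prod; have [f1 f2] := cintegrable_tuple_prod.
rewrite /cintegral /Rintegral; congr (fine _ +i* fine _) => /=.
  rewrite -(integral21_prod_meas1 f1); apply: ae_eq_integral => //.
  - exact: (measurable_fubini_G f1).
  - apply/measurable_EFinP; apply: (measurableT_comp (@fine_measurable R _ measurableT)) => //.
    exact: (measurable_fubini_G f1).
  - have := ae_integrable2 f1; apply: filterS => x ix _.
    by rewrite fineK//; exact: integrable_fin_num.
rewrite -(integral21_prod_meas1 f2); apply: ae_eq_integral => //.
- exact: (measurable_fubini_G f2).
- apply/measurable_EFinP; apply: (measurableT_comp (@fine_measurable R _ measurableT)) => //.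
  exact: (measurable_fubini_G f2).
- have := ae_integrable2 f2; apply: filterS => x ix _.
  by rewrite fineK//; exact: integrable_fin_num.
Qed.

Lemma cmeasurable_tuple_fubini :
  cmeasurable setT (fun x => cintegral mu setT (fun t => f (tcons (x, t)))).
Proof.
have [f1 f2] := cintegrable_tuple_prod.
split=> /=; apply: (measurableT_comp (@fine_measurable R _ measurableT)) => //.
  exact: (measurable_fubini_F f1).
exact: (measurable_fubini_F f2).
Qed.

End TupleFubini.

(** * Translation invariance and the Poisson kernel *)

Section RealIntegrals.
Context (R : realType).
Local Notation mu := (@lebesgue_measure R).

(** Both measures agree on half-open intervals. *)
Lemma lebesgue_measure_shift (h : R) (A : set R) : measurable A ->
  pushforward mu ((fun x => x + h) : _ -> measurableTypeR R) A = mu A.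
Proof.
have ms : measurable_fun setT ((fun x : R => x + h) : _ -> measurableTypeR R).
  by apply: measurable_funD => //; exact: measurable_cst.
move=> mA; apply/esym; pose pf : {measure set (measurableTypeR R) -> \bar R} :=
  measure_function_pushforward__canonical__measure_function_Measure mu ms.
apply: (@lebesgue_measure_unique R pf) => //= _ [[a b]] _ <-.
rewrite /pushforward.
rewrite (_ : _ @^-1` _ = [set` `]a - h, b - h]]); last first.
  by apply/seteqP; split=> x /=; rewrite !in_itv/= ltrBlDr lerBrDr.
rewrite !lebesgue_measure_itv/= !lte_fin ltrD2r.
by case: ifP => // _; rewrite -!EFinB; congr EFin; ring.
Qed.

Lemma integral_shift (f : measurableTypeR R -> R) (h : R) : measurable_fun setT f ->
  mu.-integrable setT (EFin \o (fun x => f (x + h))) ->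
  Rintegral mu setT (fun x => f (x + h)) = Rintegral mu setT f.
Proof.
move=> mf ifh; rewrite /Rintegral; congr fine.
pose sh (x : measurableTypeR R) : measurableTypeR R := x + h.
have ms : measurable_fun setT sh.
  by apply: measurable_funD => //; exact: measurable_cst.
have mfE : measurable_fun setT (EFin \o f) by exact/measurable_EFinP.
have e := @integral_pushforward _ _ _ _ R sh ms mu setT (EFin \o f) mfE ifh measurableT.
rewrite -[LHS]/(\int[mu]_(x in sh @^-1` setT) ((EFin \o f) \o sh) x)%E.
rewrite -[LHS]e; apply: eq_measure_integral => A mA _; exact: lebesgue_measure_shift.
Qed.

(** Unnormalized: its integral is pi for every a > 0. *)
Definition poisson_kernel (a x : R) := a / (x ^+ 2 + a ^+ 2).

Lemma poisson_kernel_ge0 (a x : R) : 0 < a -> 0 <= poisson_kernel a x.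
Proof. by move=> a0; rewrite divr_ge0 ?addr_ge0 ?sqr_ge0// ltW. Qed.

Lemma continuous_poisson_kernel (a : R) : 0 < a -> continuous (poisson_kernel a).
Proof.
move=> a0 x; rewrite /poisson_kernel.
apply: (@continuousM _ R^o (cst a) (fun x => (x ^+ 2 + a ^+ 2)^-1)); first exact: cvg_cst.
apply: (@continuousV _ R^o (fun x => x ^+ 2 + a ^+ 2)).
  by rewrite gt_eqF// ltr_wpDl ?sqr_ge0// exprn_gt0.
by apply: (@continuousD _ _ R^o); [exact: exprn_continuous|exact: cvg_cst].
Qed.

Lemma integral0y_poisson_kernel (a : R) : 0 < a ->
  (\int[mu]_(x in `[0%R, +oo[) (poisson_kernel a x)%:E = (pi / 2)%:E)%E.
Proof.
move=> a0; pose F (x : R) := atan (x / a).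
have dF (x : R) : is_derive x 1 F (poisson_kernel a x).
  have d1 : is_derive x 1 (fun t : R => t / a) (1 / a).
    have -> : (fun t : R => t / a) = (a^-1 *: (id : R -> R^o)).
      by apply/funext => t; rewrite /= mulrC.
    by rewrite div1r -[X in is_derive _ _ _ X]mulr1; exact: is_deriveZ.
  have d2 := @is_derive1_atan R (x / a).
  have d3 := @is_derive1_comp R atan (fun t => t / a) x _ _ d2 d1.
  suff <- : (1 + (x / a) ^+ 2)^-1 * (1 / a) = poisson_kernel a x by exact: d3.
  rewrite /poisson_kernel expr_div_n; field.
  have := sqr_ge0 x; have : 0 < a ^+ 2 by exact: exprn_gt0.
  by move=> *; rewrite !gt_eqF//; lra.
have cF : continuous F.
  by move=> x; apply/differentiable_continuous/derivable1_diffP; exact: ex_derive.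
have limF : F x @[x --> +oo] --> pi / 2.
  apply: (@cvg_comp _ _ _ (fun x => x / a) atan _ (pinfty_nbhs R)); last exact: cvgy_atan.
  by apply: gt0_cvgMly; [rewrite invr_gt0|exact: cvg_id].
rewrite (ge0_continuous_FTC2y _ _ limF)/=.
- by rewrite /F mul0r atan0 oppr0 addr0.
- by move=> x _; exact: poisson_kernel_ge0.
- by apply: continuous_subspaceT => x; exact: continuous_poisson_kernel.
- by move=> x _; exact: ex_derive.
- by apply: cvg_at_right_filter; exact: cF.
- by move=> x _; rewrite derive1E; exact: derive_val.
Qed.

Lemma integral_poisson_kernel_ereal (a : R) : 0 < a ->
  (\int[mu]_x (poisson_kernel a x)%:E = pi%:E)%E.
Proof.
move=> a0.
have mp : measurable_fun setT (fun x => (poisson_kernel a x)%:E).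
  by apply/measurable_EFinP; apply: continuous_measurable_fun; exact: continuous_poisson_kernel.
have p0 x : (0 <= (poisson_kernel a x)%:E)%E by rewrite lee_fin poisson_kernel_ge0.
have h := integral0y_poisson_kernel a0.
have := ge0_integration_by_substitution0 mp p0; rewrite h.
have pN x : poisson_kernel a (- x) = poisson_kernel a x by rewrite /poisson_kernel sqrrN.
under eq_integral do rewrite pN; move=> h'.
rewrite -(setUv `[0%R, +oo[%classic) ge0_integral_setU//=; last 2 first.
- exact: measurable_funTS.
- by apply/disj_setPCl.
rewrite h setCitvr/= integral_itv_bndo_bndc; last exact: measurable_funTS.
  by rewrite -h' -EFinD -splitr.
by apply: measurableC; exact: measurable_itv.
Qed.

Lemma integrable_poisson_kernel (a : R) : 0 < a ->
  mu.-integrable setT (EFin \o poisson_kernel a).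
Proof.
move=> a0; apply/integrableP; split.
  by apply/measurable_EFinP; apply: continuous_measurable_fun; exact: continuous_poisson_kernel.
under eq_integral do rewrite /= ger0_norm ?poisson_kernel_ge0//.
by rewrite integral_poisson_kernel_ereal// ltry.
Qed.

Lemma integral_poisson_kernel (a : R) : 0 < a -> Rintegral mu setT (poisson_kernel a) = pi.
Proof. by move=> a0; rewrite /Rintegral integral_poisson_kernel_ereal. Qed.

(** Squaring exp(y) >= 1 + y already gives enough decay for integrability. *)
Lemma expR_decay_sqr (c x : R) : 0 < c -> (1 + c / 2 * `|x|) ^+ 2 <= expR (c * `|x|).
Proof.
move=> c0; rewrite (_ : c * `|x| = 2%:R * (c / 2 * `|x|)); last by field.
rewrite expRM_natl.
by rewrite lerXn2r ?nnegrE ?expR_ge0 ?expR_ge1Dx// addr_ge0// !mulr_ge0// ltW.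
Qed.

Lemma integrable_exp_decay (c : R) : c < 0 ->
  mu.-integrable setT (EFin \o (fun x => expR (c * `|x|))).
Proof.
move=> c0; have nc0 : 0 < - c by rewrite oppr_gt0.
have := integrableZl measurableT (1 + 4 / c ^+ 2) (integrable_poisson_kernel ltr01).
apply: le_integrable => //.
  apply/measurable_EFinP; apply: measurableT_comp => //.
  by apply: measurable_funM => //; exact: measurable_cst.
move=> x _ /=; rewrite lee_fin ger0_norm ?expR_ge0// -[in leLHS](opprK c) mulNr expRN.
apply: le_trans (ler_norm _).
have := expR_decay_sqr x nc0.
have c2 : 0 < c ^+ 2 by rewrite -sqrrN exprn_gt0.
have h1 : 0 < 1 + - c / 2 * `|x| by rewrite ltr_pwDl// mulr_ge0// divr_ge0// ltW.
move=> h; have h2 : 0 < (1 + - c / 2 * `|x|) ^+ 2 by rewrite exprn_gt0.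
apply: (@le_trans _ _ ((1 + - c / 2 * `|x|) ^+ 2)^-1).
  by rewrite lef_pV2// posrE expR_gt0.
have x2 : 0 < x ^+ 2 + 1 ^+ 2 by rewrite ltr_wpDl ?sqr_ge0// expr1n.
rewrite /poisson_kernel mulrA mulr1 ler_pdivlMr// mulrC ler_pdivrMr//.
rewrite expr1n mulrDl mul1r -(real_normK (num_real x)).
have cx : 0 <= - c * `|x| by rewrite mulr_ge0// ltW.
have e : 4 / c ^+ 2 * (- c / 2 * `|x|) ^+ 2 = `|x| ^+ 2 by field; rewrite lt_eqF.
have u0 : 0 <= - c / 2 * `|x| by rewrite mulrAC divr_ge0.
have k0 : 0 <= 4 / c ^+ 2 by rewrite divr_ge0// ltW.
move: e u0 k0; set u := - c / 2 * `|x|; set k := 4 / _ => e u0 k0.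
rewrite (_ : k * (1 + u) ^+ 2 = k + 2 * (k * u) + k * u ^+ 2); last by ring.
rewrite e; have := mulr_ge0 k0 u0; have := sqr_ge0 u; nra.
Qed.

End RealIntegrals.

(** * Second-order expansions on horizontal strips *)

Section SecondOrder.
Context (R : realType).
Implicit Types (f g : R[i] -> R[i]) (p h : R[i]) (r y : R).

(** A substitute for holomorphy with a bounded second derivative: f1 is the complex
derivative, and all bounds carry the same exponential weight in Re p, which
makes the rates additive under products. *)
Definition smooth2 (y0 y1 r : R) f := exists f1 (C : R), 0 <= C /\
  forall p h, y0 <= Im p <= y1 -> y0 <= Im (p + h) <= y1 -> normc h <= 1 ->
  [/\ normc (f p) <= C * expR (r * `|Re p|),
      normc (f1 p) <= C * expR (r * `|Re p|) &
      normc (f (p + h) - f p - h * f1 p) <= C * normc h ^+ 2 * expR (r * `|Re p|)].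

Lemma smooth2_sub y0 y1 z0 z1 r f : y0 <= z0 -> z1 <= y1 ->
  smooth2 y0 y1 r f -> smooth2 z0 z1 r f.
Proof.
move=> yz zy [f1 [C [C0 H]]]; exists f1, C; split=> // p h /andP[p0 p1] /andP[h0 h1].
by apply: H; apply/andP; split; lra.
Qed.

Lemma smooth2_translate y0 y1 r f (c : R) : smooth2 (y0 + c) (y1 + c) r f ->
  smooth2 y0 y1 r (fun p => f (p + 0 +i* c)).
Proof.
move=> [f1 [C [C0 H]]]; exists (fun p => f1 (p + 0 +i* c)), C; split=> // p h.
move=> /andP[p0 p1] /andP[h0 h1] hn.
have := H (p + 0 +i* c) h; rewrite addrAC !cReD !cImD /= addr0; apply=> //.
  by rewrite !lerD2r p0 p1.
by rewrite -cImD !lerD2r h0 h1.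
Qed.

Lemma smooth2_cst y0 y1 (c : R[i]) : smooth2 y0 y1 0 (fun=> c).
Proof.
exists (fun=> 0), (normc c); split=> [|p h _ _ _]; first exact: normc_ge0.
by rewrite !mul0r expR0 !mulr1 mulr0 subrr subr0 normc0 mulr_ge0 ?normc_ge0 ?sqr_ge0.
Qed.

Lemma smooth2D y0 y1 r f g : smooth2 y0 y1 r f -> smooth2 y0 y1 r g ->
  smooth2 y0 y1 r (fun p => f p + g p).
Proof.
move=> [f1 [C [C0 H]]] [g1 [C' [C0' H']]].
exists (fun p => f1 p + g1 p), (C + C'); split=> [|p h ps hs hn]; first exact: addr_ge0.
have [a1 a2 a3] := H p h ps hs hn; have [b1 b2 b3] := H' p h ps hs hn.
rewrite !mulrDl; split; try by rewrite (le_trans (normcD _ _))// lerD.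
rewrite (_ : _ - _ = (f (p + h) - f p - h * f1 p) + (g (p + h) - g p - h * g1 p));
  last by ring.
by rewrite (le_trans (normcD _ _))// lerD.
Qed.

(** Expanding both factors, every term beyond the first order contains h^2. *)
Lemma smooth2M y0 y1 r r' f g : smooth2 y0 y1 r f -> smooth2 y0 y1 r' g ->
  smooth2 y0 y1 (r + r') (fun p => f p * g p).
Proof.
move=> [f1 [C [C0 H]]] [g1 [C' [C0' H']]].
exists (fun p => f1 p * g p + f p * g1 p), (6 * (C * C')); split.
  by rewrite !mulr_ge0.
move=> p h ps hs hn.
have [a1 a2 a3] := H p h ps hs hn; have [b1 b2 b3] := H' p h ps hs hn.
rewrite (mulrDl r r') expRD; set w := expR (r * _) in a1 a2 a3 *.
set w' := expR (r' * _) in b1 b2 b3 *.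
have w0 : 0 <= w by exact: expR_ge0.
have w0' : 0 <= w' by exact: expR_ge0.
have CC : 0 <= C * w * (C' * w') by rewrite !mulr_ge0.
have n0 := normc_ge0.
have m1 : normc (f p * g p) <= C * w * (C' * w') by rewrite normcM ler_pM.
have m2 : normc (f1 p * g p) <= C * w * (C' * w') by rewrite normcM ler_pM.
have m3 : normc (f p * g1 p) <= C * w * (C' * w') by rewrite normcM ler_pM.
rewrite (_ : 6 * (C * C') * (w * w') = 6 * (C * w * (C' * w'))); last by ring.
split; [lra|by have := normcD (f1 p * g p) (f p * g1 p); lra|].
rewrite (_ : 6 * (C * C') * _ * (w * w') = normc h ^+ 2 * (6 * (C * w * (C' * w'))));
  last by ring.
set ef := f (p + h) - f p - h * f1 p in a3.
set eg := g (p + h) - g p - h * g1 p in b3.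
(* the product of the two expansions, sorted by order in h *)
have -> : f (p + h) * g (p + h) - f p * g p - h * (f1 p * g p + f p * g1 p) =
  h ^+ 2 * (f1 p * g1 p) + (f p + h * f1 p) * eg + ef * (g p + h * g1 p + eg).
  by rewrite /ef /eg; ring.
have h2 : normc h ^+ 2 <= 1 by rewrite exprn_ile1.
have s0 := sqr_ge0 (normc h).
have t1 : normc (h ^+ 2 * (f1 p * g1 p)) <= normc h ^+ 2 * (C * w * (C' * w')).
  by rewrite normcM normcX ler_wpM2l// normcM ler_pM.
have u1 : normc (f p + h * f1 p) <= 2 * (C * w).
  rewrite (le_trans (normcD _ _))// normcM.
  have : normc h * normc (f1 p) <= 1 * (C * w) by rewrite ler_pM.
  lra.
have u2 : normc (g p + h * g1 p + eg) <= 3 * (C' * w').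
  rewrite (le_trans (normcD _ _))//.
  have := normcD (g p) (h * g1 p); rewrite normcM.
  have : normc h * normc (g1 p) <= 1 * (C' * w') by rewrite ler_pM.
  have : C' * normc h ^+ 2 * w' <= C' * w' by rewrite mulrAC ler_piMr// mulr_ge0.
  lra.
have t2 : normc ((f p + h * f1 p) * eg) <= normc h ^+ 2 * (2 * (C * w * (C' * w'))).
  rewrite normcM (le_trans (ler_pM (n0 _ _) (n0 _ _) u1 b3))// le_eqVlt; apply/orP; left.
  by apply/eqP; ring.
have t3 : normc (ef * (g p + h * g1 p + eg)) <= normc h ^+ 2 * (3 * (C * w * (C' * w'))).
  rewrite normcM (le_trans (ler_pM (n0 _ _) (n0 _ _) a3 u2))// le_eqVlt; apply/orP; left.
  by apply/eqP; ring.
rewrite (le_trans (normcD _ _))// (le_trans (lerD (normcD _ _) (lexx _)))//.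
by move: t1 t2 t3; rewrite !(mulrCA (normc h ^+ 2)); lra.
Qed.

Lemma weight_shift r p h : normc h <= 1 ->
  expR (r * `|Re (p + h)|) <= expR `|r| * expR (r * `|Re p|).
Proof.
move=> h1; rewrite -expRD ler_expR cReD.
have h2 := le_trans (normRe_le h) h1.
have d1 := ler_normD (Re p) (Re h).
have d2 : `|Re p| <= `|Re p + Re h| + `|Re h|.
  by rewrite -{1}(addrK (Re h) (Re p)) (le_trans (ler_normB _ _)).
by case: (ger0P r) => r0; nra.
Qed.

(** The lower bound on f keeps the rate: 1/f grows at rate -r. *)
Lemma smooth2V y0 y1 r f (c : R) : 0 < c ->
  (forall p, y0 <= Im p <= y1 -> c * expR (r * `|Re p|) <= normc (f p)) ->
  smooth2 y0 y1 r f -> smooth2 y0 y1 (- r) (fun p => (f p)^-1).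
Proof.
move=> c0 fc [f1 [C [C0 H]]].
pose A := expR `|r|.
have A1 : 1 <= A by rewrite -expR0 ler_expR.
exists (fun p => - (f1 p / f p ^+ 2)), (c^-1 + C / c ^+ 2 + 3 * C ^+ 2 * A / c ^+ 3).
have Cc2 : 0 <= C / c ^+ 2 by rewrite divr_ge0// exprn_ge0// ltW.
have Cc3 : 0 <= 3 * C ^+ 2 * A / c ^+ 3.
  by rewrite divr_ge0 ?exprn_ge0 ?mulr_ge0 ?sqr_ge0 ?expR_ge0// ltW.
have ci : 0 <= c^-1 by rewrite invr_ge0 ltW.
split; first by rewrite !addr_ge0.
move=> p h ps hs hn.
have [a1 a2 a3] := H p h ps hs hn; have b1 := fc _ ps; have b2 := fc _ hs.
set w := expR (r * `|Re p|) in a1 a2 a3 b1.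
have w0 : 0 < w by exact: expR_gt0.
rewrite mulNr expRN -/w.
have fp0 : 0 < normc (f p) by rewrite (lt_le_trans _ b1) ?mulr_gt0.
have fh0 : 0 < normc (f (p + h)) by rewrite (lt_le_trans _ b2) ?mulr_gt0 ?expR_gt0.
have i1 : (normc (f p))^-1 <= c^-1 * w^-1.
  by rewrite -invfM lef_pV2// posrE mulr_gt0.
have i2 : (normc (f (p + h)))^-1 <= c^-1 * (A * w^-1).
  apply: (@le_trans _ _ (c * expR (r * `|Re (p + h)|))^-1).
    by rewrite lef_pV2// posrE mulr_gt0 ?expR_gt0.
  rewrite invfM ler_wpM2l// -!expRN -expRD ler_expR.
  have := @weight_shift r (p + h) (- h); rewrite normcN => /(_ hn).
  by rewrite addrK -expRD ler_expR; lra.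
have wi0 : 0 <= w^-1 by rewrite invr_ge0 ltW.
have n0 := normc_ge0.
split.
- by rewrite normcV (le_trans i1)// ler_wpM2r//; lra.
- rewrite normcN normcM normcV normcX (@le_trans _ _ (C * w * (c^-1 * w^-1) ^+ 2))//.
    have j : (normc (f p) ^+ 2)^-1 <= (c^-1 * w^-1) ^+ 2.
      by rewrite -exprVn lerXn2r// nnegrE ?invr_ge0// mulr_ge0.
    by apply: (ler_pM (n0 _ _) _ a2 j); rewrite invr_ge0 exprn_ge0.
  rewrite (_ : C * w * _ = (C / c ^+ 2) * w^-1); last by field; rewrite !gt_eqF.
  by rewrite ler_wpM2r//; lra.
- set e := f (p + h) - f p - h * f1 p in a3.
  have fpn : f p != 0 by rewrite -normc_gt0.
  have fhn : f (p + h) != 0 by rewrite -normc_gt0.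
  have -> : (f (p + h))^-1 - (f p)^-1 - h * - (f1 p / f p ^+ 2) =
    (h * f1 p * (h * f1 p + e) - f p * e) * ((f p)^-1 ^+ 2 * (f (p + h))^-1).
    by rewrite /e; field; rewrite fpn fhn.
  have h2 : normc h ^+ 2 <= 1 by rewrite exprn_ile1.
  have s0 := sqr_ge0 (normc h).
  have t1 : normc (h * f1 p) <= normc h * (C * w) by rewrite normcM ler_wpM2l.
  have t2 : normc e <= normc h * (C * w).
    rewrite (le_trans a3)// (_ : C * _ * w = normc h * (normc h * (C * w))); last by ring.
    by rewrite ler_wpM2l// ler_piMl// mulr_ge0// ltW.
  have t3 : normc (h * f1 p * (h * f1 p + e) - f p * e) <= 3 * C ^+ 2 * normc h ^+ 2 * w ^+ 2.
    rewrite (le_trans (normcB _ _))// !normcM -normcM.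
    have u : normc (h * f1 p + e) <= 2 * (normc h * (C * w)).
      by rewrite (le_trans (normcD _ _))//; lra.
    have v1 := ler_pM (n0 _ _) (n0 _ _) t1 u.
    have v2 := ler_pM (n0 _ _) (n0 _ _) a1 a3.
    rewrite (le_trans (lerD v1 v2))// le_eqVlt; apply/orP; left; apply/eqP; ring.
  rewrite normcM normcM normcX !normcV.
  apply: (@le_trans _ _ ((3 * C ^+ 2 * normc h ^+ 2 * w ^+ 2) *
     ((c^-1 * w^-1) ^+ 2 * (c^-1 * (A * w^-1))))).
    have i0 : 0 <= (normc (f p))^-1 by rewrite invr_ge0.
    have j : (normc (f p))^-1 ^+ 2 <= (c^-1 * w^-1) ^+ 2.
      by rewrite lerXn2r// nnegrE mulr_ge0.
    have i3 : 0 <= (normc (f (p + h)))^-1 by rewrite invr_ge0.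
    apply: (ler_pM (n0 _ _) _ t3); first by rewrite mulr_ge0 ?exprn_ge0.
    by apply: (ler_pM (exprn_ge0 _ i0) i3 j i2).
  rewrite (_ : _ * _ = (3 * C ^+ 2 * A / c ^+ 3) * normc h ^+ 2 * w^-1); last first.
    by field; rewrite !gt_eqF.
  by rewrite ler_wpM2r// ler_wpM2r//; lra.
Qed.

End SecondOrder.

Section SecondOrderExamples.
Context (R : realType).
Implicit Types (f g : R[i] -> R[i]) (p h : R[i]) (r y : R).

(** For |c h| <= 1/2 this is the expansion of exp; for larger h, with |h| <= 1, the
remainder is bounded and |h|^2 is not small. *)
Lemma smooth2_cexp y0 y1 (c : R[i]) : y0 <= y1 ->
  smooth2 y0 y1 `|Re c| (fun p => cexp (c * p)).
Proof.
move=> yy; pose Y := `|y0| + `|y1|.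
pose B := expR (`|Im c| * Y); pose k := normc c.
have k0 : 0 <= k by exact: normc_ge0.
pose K := 6 * k ^+ 2 + 4 * k ^+ 2 * (expR k + 1 + k).
have ek := expR_ge0 k.
have s0 : 0 <= k ^+ 2 by exact: sqr_ge0.
have K0 : 0 <= K by rewrite /K addr_ge0// !mulr_ge0 ?addr_ge0.
have B0 : 0 <= B by exact: expR_ge0.
exists (fun p => c * cexp (c * p)), ((1 + k + K) * B).
split; first by apply: mulr_ge0 => //; apply: addr_ge0 => //; exact: addr_ge0.
move=> p h /andP[p0 p1] hs hn.
have y2 : `|Im p| <= Y.
  rewrite /Y ler_norml; apply/andP; split.
    by have := ler_norm (- y0); rewrite normrN; have := normr_ge0 y1; lra.
  by have := ler_norm y1; have := normr_ge0 y0; lra.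
have b1 : normc (cexp (c * p)) <= B * expR (`|Re c| * `|Re p|).
  rewrite normc_cexp cReM /B -expRD ler_expR -!normrM.
  have := ler_norm (Re c * Re p); have := ler_norm (- (Im c * Im p)).
  have : `|Im c * Im p| <= `|Im c| * Y by rewrite normrM ler_wpM2l.
  by rewrite normrN; lra.
set W := B * _ in b1.
have W0 : 0 <= W by rewrite mulr_ge0 ?expR_ge0.
have n0 := normc_ge0.
split.
- by rewrite -mulrA -/W (le_trans b1)// ler_peMl//; lra.
- by rewrite -mulrA -/W normcM (@le_trans _ _ (k * W)) ?ler_wpM2l ?ler_wpM2r//; lra.
rewrite mulrDr cexpD.
have -> : cexp (c * p) * cexp (c * h) - cexp (c * p) - h * (c * cexp (c * p)) =
  cexp (c * p) * (cexp (c * h) - 1 - c * h) by ring.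
rewrite normcM mulrC; have kh : normc (c * h) = k * normc h by rewrite normcM.
rewrite (_ : _ * B * _ * _ = (1 + k + K) * normc h ^+ 2 * W); last by rewrite /W; ring.
apply: ler_pM => //.
apply: (@le_trans _ _ (K * normc h ^+ 2)); last by rewrite ler_wpM2r ?sqr_ge0//; lra.
have h0 := n0 _ h.
have h20 := sqr_ge0 (normc h).
(* for |c h| > 1/2 use 1 <= 4 |c h|^2 *)
have [kh1|kh1] := leP (normc (c * h)) 2^-1.
  rewrite (le_trans (cexp_quad kh1))// kh exprMn mulrA ler_wpM2r//.
  by rewrite /K lerDl !mulr_ge0 ?addr_ge0.
have e1 : normc (cexp (c * h) - 1 - c * h) <= expR k + 1 + k.
  have := normcB (cexp (c * h) - 1) (c * h); have := normcB (cexp (c * h)) 1.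
  rewrite normc1 normc_cexp kh.
  have : expR (Re (c * h)) <= expR k.
    rewrite ler_expR (le_trans (ler_norm _))// (le_trans (normRe_le _))// kh.
    by rewrite ler_piMr.
  have : k * normc h <= k by rewrite ler_piMr.
  lra.
rewrite (le_trans e1)//.
have kk : 1 <= 4 * (k ^+ 2 * normc h ^+ 2) by rewrite -exprMn -kh; nra.
rewrite /K mulrDl.
apply: (@le_trans _ _ (4 * k ^+ 2 * (expR k + 1 + k) * normc h ^+ 2)).
  rewrite (_ : 4 * _ * _ * _ = 4 * (k ^+ 2 * normc h ^+ 2) * (expR k + 1 + k)); last by ring.
  by rewrite ler_peMl// !addr_ge0.
by rewrite lerDr !mulr_ge0.
Qed.

(** In the variable z = - i p this is 1/(b + z), whose pole lies in Re z <= 0. *)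
Lemma smooth2_linV y0 y1 (b : R[i]) : 0 < y0 -> 0 <= Re b ->
  smooth2 y0 y1 0 (fun p => (b - 'i * p)^-1).
Proof.
move=> y00 b0.
have ge (p : R[i]) : y0 <= Im p -> y0 <= normc (b - 'i * p).
  move=> yp; apply: le_trans (normRe_le _); apply: le_trans (ler_norm _).
  by rewrite cReD cReN cReM /= mul0r mul1r sub0r opprK; lra.
exists (fun p => 'i / (b - 'i * p) ^+ 2), (y0^-1 + y0^-1 ^+ 2 + y0^-1 ^+ 3).
have i0 : 0 <= y0^-1 by rewrite invr_ge0 ltW.
have i20 := exprn_ge0 2 i0; have i30 := exprn_ge0 3 i0.
split; first by rewrite !addr_ge0.
move=> p h /andP[p0 _] /andP[h0 _] hn.
have g1 := ge _ p0; have g2 := ge _ h0.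
set g := b - 'i * p in g1 *.
have gh : b - 'i * (p + h) = g - 'i * h by rewrite /g; ring.
rewrite gh in g2 *.
have j1 : normc g^-1 <= y0^-1 by rewrite normcV lef_pV2// posrE (lt_le_trans _ g1).
have j2 : normc (g - 'i * h)^-1 <= y0^-1 by rewrite normcV lef_pV2// posrE (lt_le_trans _ g2).
have gn : g != 0 by rewrite -normc_gt0 (lt_le_trans _ g1).
have ghn : g - 'i * h != 0 by rewrite -normc_gt0 (lt_le_trans _ g2).
rewrite !mul0r expR0 !mulr1.
have n0 := normc_ge0.
have j3 : normc (g^-1 ^+ 2) <= y0^-1 ^+ 2 by rewrite normcX lerXn2r ?nnegrE.
split; first lra.
- by rewrite normcM normc_i mul1r -exprVn; lra.
have -> : (g - 'i * h)^-1 - g^-1 - h * ('i / g ^+ 2) = - (h ^+ 2 * (g^-1 ^+ 2 * (g - 'i * h)^-1)).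
  have := sqr_i R => ii.
  transitivity ('i ^+ 2 * (h ^+ 2 * (g^-1 ^+ 2 * (g - 'i * h)^-1))); last by rewrite ii mulN1r.
  by field; rewrite gn ghn.
rewrite normcN normcM normcX mulrC ler_wpM2r ?sqr_ge0//.
rewrite normcM (le_trans (ler_pM (n0 _ _) (n0 _ _) j3 j2))//.
by rewrite -exprSr; lra.
Qed.

Lemma smooth2_csh y0 y1 : y0 <= y1 -> smooth2 y0 y1 pi (fun p : R[i] => csh (pi%:C * p)).
Proof.
move=> yy; rewrite /csh.
have h1 := smooth2_cexp (pi%:C : R[i]) yy.
have h2 := smooth2_cexp (- pi%:C : R[i]) yy.
have := smooth2M (smooth2_cst y0 y1 (-1)) h2.
rewrite /= ger0_norm ?pi_ge0// in h1 *; rewrite normrN ger0_norm ?pi_ge0// add0r => h3.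
have := smooth2D h1 h3; congr smooth2; apply/funext => p.
by rewrite mulN1r mulNr.
Qed.

(** The decay rate -pi of 1/sh is what makes |Im omega| < pi the right hypothesis. *)
Lemma smooth2_cshV y0 y1 c : y0 <= y1 -> 0 < c ->
  (forall y, y0 <= y <= y1 -> c <= `|sin (pi * y)|) ->
  smooth2 y0 y1 (- pi) (fun p : R[i] => (csh (pi%:C * p))^-1).
Proof.
move=> yy c0 sc; apply: (smooth2V c0); last exact: smooth2_csh.
move=> p ps; apply: le_trans (normc_csh_ge _).
rewrite cReM cImM /= !mul0r subr0 addr0 normrM (ger0_norm (pi_ge0 R)).
by rewrite ler_wpM2r ?expR_ge0 ?sc.
Qed.

End SecondOrderExamples.

(** * Moving a horizontal line of integration *)

Section HorizontalLines.
Context (R : realType).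
Local Notation mu := (@lebesgue_measure R).
Implicit Types (f g : R[i] -> R[i]) (p : R[i]) (r y h : R).

Definition line_integral f y := cintegral mu setT (fun x => f (x +i* y)).

Definition line_measurable f :=
  forall y, cmeasurable setT (fun x : measurableTypeR R => f (x +i* y)).

Lemma line_measurableM f g : line_measurable f -> line_measurable g ->
  line_measurable (fun p => f p * g p).
Proof. by move=> mf mg y; exact: cmeasurableM. Qed.

Lemma line_measurable_id : line_measurable (fun p => p).
Proof. by move=> y; split=> /=; [exact: measurable_id|exact: measurable_cst]. Qed.

Lemma line_measurable_cshV : line_measurable (fun p => (csh (pi%:C * p))^-1).
Proof.
move=> y; apply/cmeasurableV/cmeasurable_csh/cmeasurableM; first exact: cmeasurable_cst.
exact: line_measurable_id.
Qed.

Lemma cintegral_shift (F : measurableTypeR R -> R[i]) (h : R) : cmeasurable setT F ->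
  cintegrable mu setT (fun x => F (x + h)) ->
  cintegral mu setT (fun x => F (x + h)) = cintegral mu setT F.
Proof.
move=> [f1 f2] [g1 g2]; rewrite /cintegral; congr (_ +i* _).
  exact: (@integral_shift R (fun x => Re (F x)) h f1 g1).
exact: (@integral_shift R (fun x => Im (F x)) h f2 g2).
Qed.

Lemma cintegral_real (b : measurableTypeR R -> R) (c : R[i]) :
  mu.-integrable setT (EFin \o b) ->
  cintegral mu setT (fun x => c * (b x)%:C) = c * (Rintegral mu setT b)%:C.
Proof.
move=> ib; rewrite cintegralZ//; last first.
  by split=> //=; exact: integrable0.
congr (_ * _); rewrite /cintegral /=; congr (_ +i* _).
by rewrite /Rintegral integral0.
Qed.

(** A negative rate is an exponential decay. *)
Lemma smooth2_integrable y0 y1 r f y : r < 0 -> line_measurable f ->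
  smooth2 y0 y1 r f -> y0 <= y <= y1 -> cintegrable mu setT (fun x => f (x +i* y)).
Proof.
move=> r0 mf [f1 [C [C0 H]]] ys.
apply: (@cintegrable_le R _ (measurableTypeR R) mu setT measurableT _ (fun x => C * expR (r * `|x|)) (mf y)).
  exact: (integrableZl measurableT C (integrable_exp_decay r0)).
move=> x _; have := H (x +i* y) 0; rewrite addr0 normc0.
by case/(_ ys ys ler01).
Qed.

(** Cutting [y0, y1] into N pieces bounds the total increment by A L^2 / N. *)
Lemma quadratic_increments_constant (F : R -> R[i]) (y0 y1 A : R) : y0 <= y1 ->
  (forall y h, y0 <= y -> 0 <= h <= 1 -> y + h <= y1 ->
     normc (F (y + h) - F y) <= A * h ^+ 2) -> F y0 = F y1.
Proof.
move=> yy H; apply/eqP; rewrite eq_sym -subr_eq0 -normc_eq0; apply/eqP.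
set d := normc _; have d0 : 0 <= d by exact: normc_ge0.
pose L := y1 - y0; have L0 : 0 <= L by rewrite subr_ge0.
(* N + 1 steps of length h = L / (N + 1) *)
have step (N : nat) : L <= N.+1%:R -> d <= A * L ^+ 2 / N.+1%:R.
  move=> LN; pose h := L / N.+1%:R.
  have N0 : 0 < N.+1%:R :> R by [].
  have h0 : 0 <= h by rewrite divr_ge0// ltW.
  have h1 : h <= 1 by rewrite ler_pdivrMr// mul1r.
  have Nh : N.+1%:R * h = L by rewrite /h mulrCA mulfV ?gt_eqF// mulr1.
  have ind k : (k <= N.+1)%N -> normc (F (y0 + k%:R * h) - F y0) <= k%:R * (A * h ^+ 2).
    elim: k => [|k IHk] kN; first by rewrite !mul0r addr0 subrr normc0.
    have -> : F (y0 + k.+1%:R * h) - F y0 =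
      (F (y0 + k%:R * h + h) - F (y0 + k%:R * h)) + (F (y0 + k%:R * h) - F y0).
      rewrite -natr1 mulrDl mul1r addrA; ring.
    rewrite (le_trans (normcD _ _))// -natr1 mulrDl mul1r addrC lerD ?IHk 1?ltnW//.
    apply: H; rewrite ?h0 ?h1// ?lerDl ?mulr_ge0//.
    have : (k.+1%:R * h <= N.+1%:R * h) by rewrite ler_wpM2r// ler_nat.
    rewrite Nh -natr1 mulrDl mul1r /L; lra.
  have := ind N.+1 (leqnn _); rewrite Nh.
  rewrite (_ : y0 + L = y1) -/d; last by rewrite /L addrC subrK.
  by rewrite expr2 mulrCA [_ * (h * h)]mulrA Nh /h expr2 !mulrA.
apply/eqP; rewrite eq_le d0 andbT leNgt; apply/negP => dp.
pose N := Num.bound (L + `|A * L ^+ 2 / d|).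
have b0 : 0 <= L + `|A * L ^+ 2 / d| by rewrite addr_ge0.
have hN := archi_boundP b0; rewrite -/N in hN.
have hN1 : L + `|A * L ^+ 2 / d| < N.+1%:R by rewrite (lt_trans hN)// ltr_nat.
have := step N; rewrite ler_pdivlMr//.
have := normr_ge0 (A * L ^+ 2 / d) => a0 /(_ ltac:(lra)).
have : A * L ^+ 2 / d < N.+1%:R by have := ler_norm (A * L ^+ 2 / d); lra.
rewrite ltr_pdivrMr// => a1; rewrite leNgt mulrC.
by rewrite mulrC [d * _]mulrC a1.
Qed.

(** Cauchy's theorem for a strip, without derivatives. The combination
f(p + ih) - f(p) - i (f(p + h) - f(p)) is O(h^2) since the first-order terms
cancel, and the integral of f(p + h) - f(p) along the line vanishes by translation
invariance. So the line integral has quadratic increments in the height. *)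
Lemma line_integral_shift y0 y1 r f : r < 0 -> y0 <= y1 -> line_measurable f ->
  smooth2 y0 y1 r f -> line_integral f y0 = line_integral f y1.
Proof.
move=> r0 yy mf sf; have [f1 [C [C0 H]]] := sf.
pose I0 := Rintegral mu setT (fun x => expR (r * `|x|)).
apply: (@quadratic_increments_constant _ _ _ (4 * C * I0)) => // y h y0y /andP[h0 h1] hy.
have ys : y0 <= y <= y1 by apply/andP; split; lra.
have yhs : y0 <= y + h <= y1 by apply/andP; split; lra.
have i1 := smooth2_integrable r0 mf sf ys.
have i2 := smooth2_integrable r0 mf sf yhs.
pose hh := h%:C : R[i].
have nh : normc hh = h by rewrite /hh normc_real ger0_norm.
have i3 : cintegrable mu setT (fun x => f ((x + h) +i* y)).
  have m3 : cmeasurable setT (fun x : measurableTypeR R => f ((x + h) +i* y)).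
    apply: (@cmeasurable_comp R _ _ (measurableTypeR R) (measurableTypeR R) (fun x => x + h) _ _ (mf y)).
    by apply: measurable_funD => //; exact: measurable_cst.
  apply: (@cintegrable_le R _ (measurableTypeR R) mu setT measurableT _ (fun x => (C * expR `|r|) * expR (r * `|x|)) m3).
    exact: (integrableZl measurableT (C * expR `|r|) (integrable_exp_decay r0)).
  move=> x _; have := H ((x + h) +i* y) 0; rewrite addr0 normc0.
  case/(_ ys ys ler01) => + _ _; move=> /le_trans; apply; rewrite -mulrA ler_wpM2l//.
  by have := @weight_shift _ r (x +i* y) hh; rewrite nh cReD /=; exact.
(* the horizontal difference added here has integral zero *)
have e : line_integral f (y + h) - line_integral f y =
  cintegral mu setT (fun x => f (x +i* (y + h)) - f (x +i* y) -
    'i * (f ((x + h) +i* y) - f (x +i* y))).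
  have e3 := cintegral_shift (mf y) i3.
  rewrite cintegralB ?cintegralB ?cintegralZ ?cintegralB// ?e3 ?subrr ?mulr0 ?subr0//.
  - exact: cintegrableB.
  - exact: cintegrableB.
  - by apply: cintegrableZ => //; exact: cintegrableB.
rewrite e (_ : 4 * C * I0 * h ^+ 2 = 2 * (2 * C * h ^+ 2 * I0)); last by ring.
have iE := integrable_exp_decay r0.
rewrite -(RintegralZl (2 * C * h ^+ 2) measurableT iE).
apply: (@normc_cintegral_le R _ (measurableTypeR R) mu setT measurableT) => //.
- apply: cmeasurableD; first by apply: cmeasurableD => //; apply: cmeasurableN; exact: mf.
  apply/cmeasurableN/cmeasurableM; first exact: cmeasurable_cst.
  by apply: cmeasurableD; [case: i3 => /measurable_int/measurable_EFinP ? /measurable_int/measurable_EFinP ?|apply: cmeasurableN; exact: mf].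
- exact: (integrableZl measurableT (2 * C * h ^+ 2) iE).
move=> x _; set p := x +i* y.
have p1 : x +i* (y + h) = p + 'i * hh by apply: eqc; rewrite /p /hh !(cReD, cImD, cReM, cImM)/=; ring.
have p2 : (x + h) +i* y = p + hh by apply: eqc; rewrite /p /hh !(cReD, cImD, cReM, cImM)/=; ring.
have nih : normc ('i * hh) = h by rewrite -nh normcM normc_i mul1r.
have ph : y0 <= Im (p + hh) <= y1 by rewrite cImD /= addr0.
have pih : y0 <= Im (p + 'i * hh) <= y1 by rewrite -p1.
have := H p hh ys ph; rewrite nh => /(_ h1)[_ _ a3].
have := H p ('i * hh) ys pih; rewrite nih => /(_ h1)[_ _ b3].
rewrite p1 p2.
(* the first-order terms i h f1 and i (h f1) cancel *)
have -> : f (p + 'i * hh) - f p - 'i * (f (p + hh) - f p) =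
  (f (p + 'i * hh) - f p - 'i * hh * f1 p) - 'i * (f (p + hh) - f p - hh * f1 p) by ring.
rewrite (le_trans (normcB _ _))// normcM normc_i mul1r.
by rewrite (le_trans (lerD b3 a3))// /p /=; lra.
Qed.

End HorizontalLines.

(** * Crossing the pole at i *)

Section PoleCrossing.
Context (R : realType).
Local Notation mu := (@lebesgue_measure R).
Implicit Types (p : R[i]) (x d : R).

(** The quotient stands for 1 - exp(-2 pi |Re p|): it vanishes linearly at 0 and
tends to 1. *)
Lemma csh_pi_ge p : Re p != 0 ->
  expR (pi * `|Re p|) * (2 * pi * `|Re p| / (1 + 2 * pi * `|Re p|))
    <= normc (csh (pi%:C * p)).
Proof.
move=> x0; apply: le_trans (normc_csh_ge_real _).
rewrite cReM /= mul0r subr0 normrM ger0_norm ?pi_ge0//.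
set X := pi * `|Re p|; have X0 : 0 <= X by rewrite mulr_ge0 ?pi_ge0.
rewrite -(mulrA 2 pi) -/X.
have e1 := expR_ge1Dx (2 * X).
have -> : expR (- X) = expR X * (expR (2 * X))^-1.
  by rewrite -expRN -expRD; congr expR; ring.
rewrite -[X in _ <= X - _]mulr1 -mulrBr ler_wpM2l ?expR_ge0//.
have u0 : 0 < 1 + 2 * X by lra.
have : (expR (2 * X))^-1 <= (1 + 2 * X)^-1 by rewrite lef_pV2// posrE expR_gt0.
have -> : 2 * X / (1 + 2 * X) = 1 - (1 + 2 * X)^-1 by field; rewrite gt_eqF.
lra.
Qed.

(** Near 0 the quotient is k|x|, far from 0 the exponential wins. *)
Lemma exp_decay_inverse_square (c k : R) : 0 < c -> 0 < k ->
  exists2 K, 0 <= K & forall x, x != 0 ->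
    expR (- c * `|x|) / (k * `|x| / (1 + k * `|x|)) ^+ 2 <= K / x ^+ 2.
Proof.
move=> c0 k0; pose a := 1 + 2 * k / c.
have a0 : 0 <= a by rewrite addr_ge0// divr_ge0 ?mulr_ge0// ltW.
exists ((a / k) ^+ 2); first exact: sqr_ge0.
move=> x x0; have X0 : 0 < `|x| by rewrite normr_gt0.
rewrite -(real_normK (num_real x)); set X := `|x| in X0 *.
have kX : 0 < k * X by rewrite mulr_gt0.
have cX : 0 < c / 2 * X by rewrite mulr_gt0// divr_gt0.
have := expR_decay_sqr x c0; rewrite -/X => h1.
have u0 : 0 < 1 + c / 2 * X by lra.
rewrite mulNr expRN.
have h2 : 1 + k * X <= a * (1 + c / 2 * X).
  have -> : a * (1 + c / 2 * X) = 1 + c / 2 * X + 2 * k / c + k * X.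
    by rewrite /a; field; rewrite gt_eqF.
  have : 0 <= 2 * k / c by rewrite divr_ge0 ?mulr_ge0// ltW.
  lra.
have h3 : (expR (c * X))^-1 <= ((1 + c / 2 * X) ^+ 2)^-1.
  by rewrite lef_pV2 ?posrE ?expR_gt0 ?exprn_gt0.
have h4 : (1 + k * X) ^+ 2 <= (a * (1 + c / 2 * X)) ^+ 2.
  by rewrite lerXn2r ?nnegrE//; [lra|rewrite mulr_ge0// ltW].
apply: (@le_trans _ _ (((1 + c / 2 * X) ^+ 2)^-1 * ((a * (1 + c / 2 * X)) ^+ 2 / (k * X) ^+ 2))).
  apply: ler_pM => //; rewrite ?invr_ge0 ?expR_ge0 ?sqr_ge0//.
  by rewrite expr_div_n invf_div ler_wpM2r// invr_ge0 sqr_ge0.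
rewrite le_eqVlt; apply/orP; left; apply/eqP.
move: {h1 h2 h3 h4} u0; set u := 1 + _ => u0; clearbody a u.
by field; rewrite !gt_eqF.
Qed.

Variables (M : R[i] -> R[i]) (v : R).
Hypotheses (vpi : v < pi) (sM : smooth2 (- 2^-1) 2^-1 v M) (mM : line_measurable M).

Let g p := M p / csh (pi%:C * p).

(** Away from x = 0 the two points x - i d and x + i d are at distance 2 d, while the
derivative of g is of order 1/x^2 there. *)
Lemma pole_far : exists2 C, 0 <= C & forall d x, 0 < d <= 2^-1 -> x != 0 ->
  normc (g (x +i* - d) - g (x +i* d)) <= C * (d / x ^+ 2).
Proof.
have [M1 [CM [CM0 HM]]] := sM.
have [S1 [CS [CS0 HS]]] := @smooth2_csh R (- 2^-1) 2^-1 ltac:(lra).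
have c0 : 0 < pi - v by rewrite subr_gt0.
have k0 : 0 < 2 * pi :> R by rewrite mulr_gt0 ?pi_gt0.
have [K K0 HK] := exp_decay_inverse_square c0 k0.
exists (4 * CM * (1 + CS) * K); first by rewrite !mulr_ge0 ?addr_ge0.
move=> d x /andP[d0 d1] x0.
pose p : R[i] := x +i* d; pose h : R[i] := 0 +i* (- (2 * d)).
have ph : x +i* - d = p + h by apply: eqc; rewrite /p /h !(cReD, cImD)/=; ring.
have nh : normc h = 2 * d.
  by rewrite /h /= expr0n add0r sqrrN sqrtr_sqr ger0_norm// mulr_ge0// ltW.
have ps : - 2^-1 <= Im p <= 2^-1 by rewrite /p /=; apply/andP; split; lra.
have hs : - 2^-1 <= Im (p + h) <= 2^-1 by rewrite -ph /=; apply/andP; split; lra.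
have h1 : normc h <= 1 by rewrite nh; lra.
have n0 := normc_ge0.
have [a1 a2 a3] := HM p h ps hs h1; have [b1 b2 b3] := HS p h ps hs h1.
rewrite nh in a3 b3; rewrite ph /g.
have s1 := @csh_pi_ge p x0; have s2 := @csh_pi_ge (p + h).
have rp : Re p = x by [].
have rph : Re (p + h) = x by rewrite cReD /= addr0.
rewrite rph in s2; rewrite rp in s1 a1 a2 a3 b1 b2 b3.
move/(_ x0) : s2 => s2.
set S := csh (pi%:C * p) in b1 b3 s1 *; set S' := csh _ in b3 s2 *.
set t := _ / _ in s1 s2; set E := expR (pi * _) in s1 s2 b1 b2 b3.
set W := expR (v * _) in a1 a2 a3.
have X0 : 0 < `|x| by rewrite normr_gt0.
have kX : 0 < 2 * pi * `|x| by rewrite mulr_gt0.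
have t0 : 0 < t by rewrite divr_gt0//; lra.
have t1 : t <= 1 by rewrite ler_pdivrMr; lra.
have E0 : 0 < E by exact: expR_gt0.
have W0 : 0 < W by exact: expR_gt0.
have dM : normc (M (p + h) - M p) <= 4 * CM * d * W.
  have -> : M (p + h) - M p = (M (p + h) - M p - h * M1 p) + h * M1 p by ring.
  rewrite (le_trans (normcD _ _))// normcM nh.
  have q1 : 2 * d * normc (M1 p) <= 2 * d * (CM * W) by rewrite ler_wpM2l//; lra.
  have q2 : CM * (2 * d) ^+ 2 * W <= CM * (2 * d) * W.
    by apply: ler_wpM2r; [exact: ltW|apply: ler_wpM2l => //; nra].
  lra.
have dS : normc (S' - S) <= 4 * CS * d * E.
  have -> : S' - S = (S' - S - h * S1 p) + h * S1 p by ring.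
  rewrite (le_trans (normcD _ _))// normcM nh.
  have q1 : 2 * d * normc (S1 p) <= 2 * d * (CS * E) by rewrite ler_wpM2l//; lra.
  have q2 : CS * (2 * d) ^+ 2 * E <= CS * (2 * d) * E.
    by apply: ler_wpM2r; [exact: ltW|apply: ler_wpM2l => //; nra].
  lra.
have Et : 0 < E * t by rewrite mulr_gt0.
have Sn : S != 0 by rewrite -normc_gt0 (lt_le_trans Et).
have Sn' : S' != 0 by rewrite -normc_gt0 (lt_le_trans Et).
have i1 : (normc S)^-1 <= (E * t)^-1 by rewrite lef_pV2// posrE normc_gt0.
have i2 : (normc S')^-1 <= (E * t)^-1 by rewrite lef_pV2// posrE normc_gt0.
have iEt : 0 <= (E * t)^-1 by rewrite invr_ge0 ltW.
have -> : M (p + h) / S' - M p / S = (M (p + h) - M p) * S'^-1 - M p * (S' - S) * (S^-1 * S'^-1).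
  by field; rewrite Sn Sn'.
apply: (@le_trans _ _ (4 * CM * d * W * (E * t)^-1 + CM * W * (4 * CS * d * E) * ((E * t)^-1 * (E * t)^-1))).
  rewrite (le_trans (normcB _ _))// !normcM !normcV lerD//.
    by apply: ler_pM => //; rewrite invr_ge0.
  have j1 : normc (M p) * normc (S' - S) <= CM * W * (4 * CS * d * E) by apply: ler_pM.
  have j2 : (normc S)^-1 * (normc S')^-1 <= (E * t)^-1 * (E * t)^-1.
    by apply: ler_pM => //; rewrite invr_ge0.
  by apply: (ler_pM _ _ j1 j2); rewrite mulr_ge0// invr_ge0.
have := HK x x0; rewrite -/t.
have -> : expR (- (pi - v) * `|x|) = W / E.
  by rewrite /W /E -expRN -expRD; congr expR; ring.
move=> HKx.
apply: (@le_trans _ _ (4 * CM * (1 + CS) * d * (W / E / t ^+ 2))).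
  have -> : 4 * CM * d * W * (E * t)^-1 = 4 * CM * d * (W / E / t ^+ 2) * t.
    by field; rewrite !gt_eqF.
  have -> : CM * W * (4 * CS * d * E) * ((E * t)^-1 * (E * t)^-1) =
     4 * CM * CS * d * (W / E / t ^+ 2) by field; rewrite !gt_eqF.
  have z0 : 0 <= 4 * CM * d * (W / E / t ^+ 2).
    by rewrite !mulr_ge0 ?invr_ge0 ?sqr_ge0// ltW.
  have : 4 * CM * d * (W / E / t ^+ 2) * t <= 4 * CM * d * (W / E / t ^+ 2) by rewrite ler_piMr.
  lra.
rewrite (_ : _ * K * _ = 4 * CM * (1 + CS) * d * (K / x ^+ 2)); last by ring.
by rewrite ler_wpM2l// !mulr_ge0 ?addr_ge0// ltW.
Qed.

Lemma pi_le4 : pi <= 4 :> R.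
Proof. by have := pihalf_lt2 R; lra. Qed.

(** Near 0 the function g is M(0) / (2 pi p) up to a bounded error, because
sh(pi p) = 2 pi p + O(p^2). *)
Lemma pole_near : exists2 C, 0 <= C & forall p, p != 0 -> normc p <= 100^-1 ->
  normc (g p - M 0 / (2 * pi%:C * p)) <= C.
Proof.
have [M1 [CM [CM0 HM]]] := sM.
have pi2 := pi_ge2 R; have pi4 := pi_le4.
exists ((4 * pi * CM + 12 * pi ^+ 2 * CM) / (2 * pi ^+ 2)).
  by rewrite divr_ge0// ?addr_ge0 ?mulr_ge0 ?sqr_ge0// pi_ge0.
move=> p p0 p1.
have ip := normIm_le p; have n0 := normc_ge0.
have np : 0 < normc p by rewrite normc_gt0.
have ps : - 2^-1 <= Im p <= 2^-1 by rewrite -ler_norml; lra.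
have s0 : - 2^-1 <= Im (0 : R[i]) <= 2^-1 by rewrite /=; apply/andP; split; lra.
have := HM 0 p s0; rewrite add0r => /(_ ps) [|a1 a2 a3]; first lra.
rewrite /= normr0 mulr0 expR0 !mulr1 in a1 a2 a3.
have dM : normc (M p - M 0) <= 2 * CM * normc p.
  have -> : M p - M 0 = (M p - M 0 - p * M1 0) + p * M1 0 by ring.
  rewrite (le_trans (normcD _ _))// normcM.
  have : normc p * normc (M1 0) <= normc p * CM by rewrite ler_wpM2l.
  have : CM * normc p ^+ 2 <= CM * normc p by rewrite ler_wpM2l//; nra.
  lra.
pose w := pi%:C * p.
have nw : normc w = pi * normc p by rewrite /w normcM normc_real ger0_norm ?pi_ge0.
have w1 : normc w <= 2^-1 by rewrite nw; nra.
have dS : normc (csh w - 2 * w) <= 12 * normc w ^+ 2.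
  have -> : csh w - 2 * w = (cexp w - 1 - w) - (cexp (- w) - 1 - - w) by rewrite /csh; ring.
  rewrite (le_trans (normcB _ _))//.
  have := cexp_quad w1; have := @cexp_quad _ (- w); rewrite normcN => /(_ w1); lra.
have Sge : normc w <= normc (csh w).
  have : normc (2 * w) <= normc (csh w) + normc (csh w - 2 * w).
    rewrite -{1}(subKr (csh w) (2 * w)) (le_trans (normcB _ _))//.
  rewrite normcM normc_nat.
  have : 12 * normc w ^+ 2 <= normc w by rewrite expr2 mulrA ler_piMl// nw; nra.
  lra.
have w0 : 0 < normc w by rewrite nw mulr_gt0 ?pi_gt0.
have wn : w != 0 by rewrite -normc_gt0.
have Sn : csh w != 0 by rewrite -normc_gt0 (lt_le_trans w0).
rewrite /g -/w -mulrA -/w.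
have -> : M p / csh w - M 0 / (2 * w) =
   (2 * w * (M p - M 0) - M 0 * (csh w - 2 * w)) / (2 * w * csh w).
  by field; rewrite wn Sn.
have two : (2 : R[i]) != 0 by rewrite pnatr_eq0.
rewrite normcM normcV ler_pdivrMr; last first.
  by rewrite normc_gt0; apply: mulf_neq0 => //; exact: mulf_neq0.
clearbody w.
rewrite (le_trans (normcB _ _))// !normcM normc_nat.
have j1 : 2 * normc w * normc (M p - M 0) <= 2 * normc w * (2 * CM * normc p).
  by rewrite ler_wpM2l// mulr_ge0.
have j2 : normc (M 0) * normc (csh w - 2 * w) <= CM * (12 * normc w ^+ 2) by apply: ler_pM.
rewrite (le_trans (lerD j1 j2))//.
apply: (@le_trans _ _ ((4 * pi * CM + 12 * pi ^+ 2 * CM) / (2 * pi ^+ 2) * (2 * normc w * normc w))).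
  have fld (P A N : R) : P != 0 -> 2 * (P * N) * (2 * A * N) + A * (12 * (P * N) ^+ 2) =
      (4 * P * A + 12 * P ^+ 2 * A) / (2 * P ^+ 2) * (2 * (P * N) * (P * N)).
    by move=> P0; field.
  by rewrite nw fld// gt_eqF ?pi_gt0.
have w20 : 0 <= 2 * normc w by lra.
apply: ler_wpM2l; last exact: ler_wpM2l.
by rewrite divr_ge0// ?addr_ge0 ?mulr_ge0 ?sqr_ge0// pi_ge0.
Qed.

End PoleCrossing.

Section Residue.
Context (R : realType).
Local Notation mu := (@lebesgue_measure R).
Implicit Types (p : R[i]) (x d y : R) (N M : R[i] -> R[i]).

(** A positive continuous function on a segment has a positive minimum. *)
Lemma sin_pi_lower_bound (y0 y1 : R) : y0 <= y1 ->
  (forall y, y0 <= y <= y1 -> sin (pi * y) != 0) ->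
  exists2 c, 0 < c & forall y, y0 <= y <= y1 -> c <= `|sin (pi * y)|.
Proof.
move=> yy s0; pose F (y : R) := `|sin (pi * y)|.
have cF : continuous F.
  move=> y; apply: (@continuous_comp R R R (fun y => sin (pi * y)) Num.norm).
    apply: (@continuous_comp R R R (fun y => pi * y) sin); last exact: continuous_sin.
    exact: mulrl_continuous.
  exact: norm_continuous.
have [c] := EVT_min yy (continuous_subspaceT (A := `[y0, y1]%classic) cF).
rewrite in_itv/= => cs cm; exists (F c); first by rewrite normr_gt0 s0.
by move=> y ys; apply: cm; rewrite in_itv.
Qed.

Lemma sin_pi_neq0 y : 0 < y < 1 -> sin (pi * y) != 0.
Proof.
move=> /andP[y0 y1]; rewrite gt_eqF// sin_gt0_pi// mulr_gt0 ?pi_gt0//=.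
by rewrite -[ltRHS]mulr1 ltr_pM2l ?pi_gt0.
Qed.

Lemma sin_piN_neq0 y : -1 < y < 0 -> sin (pi * y) != 0.
Proof.
by move=> /andP[y0 y1]; rewrite -oppr_eq0 -sinN -mulrN sin_pi_neq0//; apply/andP; split; lra.
Qed.

Lemma sin_piD1_neq0 y : 1 < y < 2 -> sin (pi * y) != 0.
Proof.
move=> /andP[y0 y1]; rewrite (_ : pi * y = pi * (y - 1) + pi); last by ring.
by rewrite sinDpi oppr_eq0 sin_pi_neq0//; apply/andP; split; lra.
Qed.

Lemma smooth2_div_csh (y0 y1 v : R) N : y0 <= y1 ->
  (forall y, y0 <= y <= y1 -> sin (pi * y) != 0) -> smooth2 y0 y1 v N ->
  smooth2 y0 y1 (v - pi) (fun p => N p / csh (pi%:C * p)).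
Proof.
move=> yy s0 sN; have [c c0 sc] := sin_pi_lower_bound yy s0.
exact: smooth2M sN (smooth2_cshV yy c0 sc).
Qed.

Lemma line_measurable_div_csh N : line_measurable N ->
  line_measurable (fun p => N p / csh (pi%:C * p)).
Proof. by move=> mN; apply: line_measurableM => //; exact: line_measurable_cshV. Qed.

(** The jump of the line integral across the simple pole at 0. The polar part
M(0) / (2 pi p) contributes exactly i M(0), by the integral of the Poisson kernel.
The rest of the integrand is bounded near 0 and O(d / x^2) elsewhere, hence
O(d / (x^2 + d)), which is sqrt d times a Poisson kernel of parameter sqrt d. *)
Lemma pole_jump (v : R) M : v < pi -> smooth2 (- 2^-1) 2^-1 v M -> line_measurable M ->
  exists C rho : R, 0 < rho /\ forall d, 0 < d <= rho ->
  normc (line_integral (fun p => M p / csh (pi%:C * p)) (- d)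
    - line_integral (fun p => M p / csh (pi%:C * p)) d - 'i * M 0) <= C * Num.sqrt d.
Proof.
move=> vpi sM mM.
have [C1 C10 H1] := pole_far vpi sM; have [C2 C20 H2] := pole_near sM.
pose g p := M p / csh (pi%:C * p).
have vp : v - pi < 0 by rewrite subr_lt0.
(* C1 from the far estimate, C2 from the near one, and M 0 from the Poisson kernel;
   the factors 2 and 4 come from d / x^2 <= 2 d / (x^2 + d) when d <= x^2, and from
   1 <= 2 d / (x^2 + d) when x^2 <= d, for two applications of C2 *)
pose K := 2 * C1 + 4 * C2 + 2 * normc (M 0).
exists (2 * (K * pi)), (200^-1 ^+ 2); split; first by rewrite exprn_gt0.
move=> d /andP[d0 d1].
have d2 : d <= 200^-1 by nra.
have iline y : -1 < y < 0 \/ 0 < y < 1 -> - 2^-1 <= y <= 2^-1 ->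
    cintegrable mu setT (fun x => g (x +i* y)).
  move=> yn /andP[ya yb].
  apply: (@smooth2_integrable R y y (v - pi)) => //; last by rewrite lexx.
    exact: line_measurable_div_csh.
  apply: smooth2_div_csh => //; last exact: smooth2_sub sM.
  move=> z; rewrite andbC => /le_anti ->.
  by case: yn; [exact: sin_piN_neq0|exact: sin_pi_neq0].
have i1 : cintegrable mu setT (fun x => g (x +i* - d)).
  by apply: iline; [left|]; apply/andP; split; lra.
have i2 : cintegrable mu setT (fun x => g (x +i* d)).
  by apply: iline; [right|]; apply/andP; split; lra.
pose e := Num.sqrt d; have e0 : 0 < e by rewrite sqrtr_gt0.
have e2 : e ^+ 2 = d by rewrite sqr_sqrtr// ltW.
pose c := M 0 * 'i / pi%:C.
have nc : normc c <= normc (M 0).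
  rewrite /c normcM normcV normc_real normcM normc_i mulr1 ger0_norm ?pi_ge0//.
  by rewrite ler_piMr ?normc_ge0// invf_le1 ?pi_gt0//; have := pi_ge2 R; lra.
have ip := integrable_poisson_kernel d0.
have ie := integrable_poisson_kernel e0.
have i3 : cintegrable mu setT (fun x => c * (poisson_kernel d x)%:C).
  by apply: cintegrableZ => //; split=> //=; exact: integrable0.
have -> : line_integral g (- d) - line_integral g d - 'i * M 0 =
  cintegral mu setT (fun x => g (x +i* - d) - g (x +i* d) - c * (poisson_kernel d x)%:C).
  rewrite cintegralB//; last exact: cintegrableB.
  rewrite cintegralB// cintegral_real// integral_poisson_kernel// /c.
  by rewrite divfK ?[M 0 * _]mulrC// -normc_gt0 normc_real normr_gt0 gt_eqF ?pi_gt0.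
rewrite -/e (_ : 2 * (K * pi) * e = 2 * (K * e * pi)); last by ring.
rewrite -(integral_poisson_kernel e0) -(RintegralZl (K * e) measurableT ie).
apply: (@normc_cintegral_le R _ (measurableTypeR R) mu setT measurableT).
- by apply: cmeasurableD; [apply: cmeasurableD|]; [|apply: cmeasurableN|apply: cmeasurableN];
    apply: cintegrable_measurable; [exact: i1|exact: i2|exact: i3].
- exact: (integrableZl measurableT (K * e) ie).
move=> x _.
have -> : K * e * poisson_kernel e x = K * (d / (x ^+ 2 + d)).
  by rewrite /poisson_kernel e2 -e2 expr2; field; rewrite -expr2 e2 gt_eqF// ltr_wpDl ?sqr_ge0.
have x20 := sqr_ge0 x.
have n0 := normc_ge0 (M 0).
have D0 : 0 < x ^+ 2 + d by rewrite ltr_wpDl.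
(* near the pole both points have norm at most 1/100; otherwise d < x^2 *)
have [xd|xd] := leP (x ^+ 2) d.
  pose p : R[i] := x +i* d; pose q : R[i] := x +i* - d.
  have np : normc p ^+ 2 = x ^+ 2 + d ^+ 2 by rewrite normc_sqr.
  have nq : normc q ^+ 2 = x ^+ 2 + d ^+ 2 by rewrite normc_sqr /= sqrrN.
  have small (z : R[i]) : normc z ^+ 2 = x ^+ 2 + d ^+ 2 -> normc z <= 100^-1.
    move=> zE; rewrite -(@ler_pXn2r _ 2) ?nnegrE ?normc_ge0 ?invr_ge0// zE.
    have : d ^+ 2 <= 200^-1 ^+ 2 by rewrite lerXn2r ?nnegrE ?invr_ge0// ltW.
    nra.
  have nz (z : R[i]) : normc z ^+ 2 = x ^+ 2 + d ^+ 2 -> z != 0.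
    move=> zE; rewrite -normc_eq0 -sqrf_eq0 zE gt_eqF// ltr_wpDl// exprn_gt0//.
  have := H2 p (nz _ np) (small _ np); have := H2 q (nz _ nq) (small _ nq).
  have pin : pi%:C != 0 :> R[i].
    by rewrite -normc_gt0 normc_real normr_gt0 gt_eqF ?pi_gt0.
  have -> : c * (poisson_kernel d x)%:C = M 0 / (2 * pi%:C * q) - M 0 / (2 * pi%:C * p).
    have -> : (poisson_kernel d x)%:C = d%:C / (p * q).
      rewrite /poisson_kernel rmorphM fmorphV; congr (_ / _).
      by apply: eqc; rewrite !(cReM, cImM) /= ; ring.
    have -> : d%:C = (p - q) / (2 * 'i).
      apply: (@mulIf _ (2 * 'i)); first by rewrite mulf_neq0 ?pnatr_eq0// -normc_gt0 normc_i.
      rewrite divfK ?mulf_neq0 ?pnatr_eq0// -?normc_gt0 ?normc_i//.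
      by apply: eqc; rewrite !(cReM, cImM, cReD, cImD, cReN, cImN, cRe_nat, cIm_nat) /=; ring.
    have fld (A I P u w : R[i]) : I != 0 -> P != 0 -> u != 0 -> w != 0 ->
        A * I / P * ((u - w) / (2 * I) / (u * w)) = A / (2 * P * w) - A / (2 * P * u).
      by move=> I0 P0 u0 w0; field; rewrite I0 P0 u0 w0.
    by rewrite /c fld ?pin ?(nz _ np) ?(nz _ nq)// -normc_gt0 normc_i.
  move=> h1 h2.
  rewrite (_ : _ - _ - _ = (g q - M 0 / (2 * pi%:C * q)) - (g p - M 0 / (2 * pi%:C * p)));
    last by rewrite /p /q; ring.
  rewrite (le_trans (normcB _ _))// (le_trans (lerD h1 h2))//.
  have : 2^-1 <= d / (x ^+ 2 + d) by rewrite ler_pdivlMr//; lra.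
  rewrite /K; nra.
have x2 : 0 < x ^+ 2 by lra.
have xn : x != 0 by rewrite -sqrf_eq0 gt_eqF.
have h1 : d / x ^+ 2 <= 2 * (d / (x ^+ 2 + d)).
  have r1 : 1 <= 2 * x ^+ 2 / (x ^+ 2 + d) by rewrite ler_pdivlMr//; lra.
  rewrite ler_pdivrMr// (_ : _ * x ^+ 2 = d * (2 * x ^+ 2 / (x ^+ 2 + d))); last by ring.
  by rewrite ler_peMr// ltW.
have h3 : normc (c * (poisson_kernel d x)%:C) <= normc (M 0) * (d / x ^+ 2).
  rewrite normcM normc_real ger0_norm ?poisson_kernel_ge0//.
  apply: (ler_pM (normc_ge0 _) (poisson_kernel_ge0 _ d0) nc).
  rewrite /poisson_kernel; apply: ler_wpM2l; first exact: ltW.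
  by rewrite lef_pV2 ?posrE ?lerDl ?sqr_ge0// ltr_wpDr// sqr_ge0.
have d12 : 0 < d <= 2^-1 by apply/andP; split; lra.
rewrite (le_trans (normcB _ _))// (le_trans (lerD (H1 d x d12 xn) h3))//.
rewrite -mulrDl /K.
have q0 : 0 <= d / (x ^+ 2 + d) by rewrite divr_ge0// ltW.
have : (C1 + normc (M 0)) * (d / x ^+ 2) <= (C1 + normc (M 0)) * (2 * (d / (x ^+ 2 + d))).
  by rewrite ler_wpM2l// addr_ge0.
nra.
Qed.

(** Between heights eps and 1 - d, and between 1 + d and 1 + eps, there is no pole, so
the lines can be moved; the jump at height 1 is the previous lemma moved by i. *)
Lemma residue_at_i (eps v : R) N : 0 < eps < 2^-1 -> v < pi ->
  smooth2 eps 2 v N -> line_measurable N ->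
  line_integral (fun p => N p / csh (pi%:C * p)) eps
    - line_integral (fun p => N p / csh (pi%:C * p)) (1 + eps) = - ('i * N 'i).
Proof.
move=> /andP[e0 e1] vpi sN mN.
have vp : v - pi < 0 by rewrite subr_lt0.
pose M p := N (p + 'i).
have sM : smooth2 (- 2^-1) 2^-1 v M.
  by apply: smooth2_translate; apply: smooth2_sub sN; lra.
have mM : line_measurable M.
  move=> y; rewrite (_ : (fun _ => _) = (fun x => N (x +i* (y + 1)))); first exact: mN.
  by apply/funext => x; congr N; apply: eqc; rewrite !(cReD, cImD)/= ?addr0.
have [C [rho [rho0 H]]] := pole_jump vpi sM mM.
set D := _ - _; apply/eqP; rewrite -subr_eq0 opprK -normc_eq0; apply/eqP.
set t := normc _; have t0 : 0 <= t by exact: normc_ge0.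
(* the defect t does not depend on d *)
have key d : 0 < d <= rho -> d <= eps -> t <= C * Num.sqrt d.
  move=> dr de; have := H d dr; rewrite /M add0r.
  have d0 : 0 < d by case/andP : dr.
  have il y : -1 < y < 0 \/ 0 < y < 1 -> - 2^-1 <= y <= 2^-1 ->
      cintegrable mu setT (fun x => M (x +i* y) / csh (pi%:C * (x +i* y))).
    move=> yn /andP[ya yb].
    apply: (@smooth2_integrable R y y (v - pi) (fun p => M p / csh (pi%:C * p))) => //; last by rewrite lexx.
      exact: line_measurable_div_csh.
    apply: smooth2_div_csh => //; last exact: smooth2_sub sM.
    move=> z; rewrite andbC => /le_anti ->.
    by case: yn; [exact: sin_piN_neq0|exact: sin_pi_neq0].
  have tr y : -1 < y < 0 \/ 0 < y < 1 -> - 2^-1 <= y <= 2^-1 ->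
     line_integral (fun p => M p / csh (pi%:C * p)) y =
     - line_integral (fun p => N p / csh (pi%:C * p)) (1 + y).
    move=> y1 y2; have iy := il _ y1 y2.
    rewrite -[LHS]opprK -cintegralN//; congr (- _); apply: eq_cintegral => x _.
    have -> : x +i* (1 + y) = (x +i* y) + 'i.
      by apply: eqc; rewrite !(cReD, cImD)/=; ring.
    by rewrite csh_shift invrN mulrN.
  rewrite !tr; [|by [right; apply/andP; split; lra]|by apply/andP; split; lra|
      by [left; apply/andP; split; lra]|by apply/andP; split; lra].
  have mf := line_measurable_div_csh mN.
  rewrite -(@line_integral_shift R eps (1 + - d) (v - pi)) //; [|lra|]; last first.
    apply: smooth2_div_csh; [lra| |by apply: smooth2_sub sN; lra].
    by move=> y /andP[ya yb]; apply: sin_pi_neq0; apply/andP; split; lra.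
  rewrite (@line_integral_shift R (1 + d) (1 + eps) (v - pi)) //; [|lra|]; last first.
    apply: smooth2_div_csh; [lra| |by apply: smooth2_sub sN; lra].
    by move=> y /andP[ya yb]; apply: sin_piD1_neq0; apply/andP; split; lra.
  rewrite (_ : _ - _ - _ = - (D + 'i * N 'i)) ?normcN//.
  by rewrite /D; ring.
have C0 : 0 <= C.
  pose d := Num.min rho eps.
  have d0 : 0 < d by rewrite lt_min rho0.
  have dr : d <= rho by rewrite ge_min lexx.
  have de : d <= eps by rewrite ge_min lexx orbT.
  have := key d; rewrite d0 dr => /(_ isT de) h.
  have sd0 : 0 < Num.sqrt d by rewrite sqrtr_gt0.
  by rewrite -(pmulr_lge0 _ sd0) (le_trans t0).
apply/eqP; rewrite eq_le t0 andbT leNgt; apply/negP => tp.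
(* with sqrt d <= s the bound C sqrt d is below t / 2 *)
pose s := t / (2 * (C + 1)).
have s0 : 0 < s by rewrite divr_gt0// mulr_gt0//; lra.
pose d := Num.min (Num.min rho eps) (s ^+ 2).
have d0 : 0 < d by rewrite !lt_min rho0 e0 exprn_gt0.
have dr : d <= rho by rewrite !ge_min lexx.
have de : d <= eps by rewrite !ge_min lexx !orbT.
have ds : d <= s ^+ 2 by rewrite !ge_min lexx !orbT.
have := key d; rewrite d0 dr => /(_ isT de) h.
have : Num.sqrt d <= s by rewrite -(ger0_norm (ltW s0)) -sqrtr_sqr ler_wsqrtr.
move=> /(ler_wpM2l C0)/(le_trans h).
have : C * s <= t / 2.
  have -> : C * s = t / 2 * (C / (C + 1)) by rewrite /s; field; rewrite gt_eqF//; lra.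
  by rewrite ler_piMr ?divr_ge0// ler_pdivrMr; lra.
lra.
Qed.

End Residue.

(** * Truncated sums and the one-variable kernel formula *)

Local Arguments normc : simpl never.
Local Arguments cexp : simpl never.
Local Arguments csh : simpl never.

Section TruncatedSums.
Context (R : realType) (K : nat).

(** The truncated nested sum in the gaps l between consecutive summation indices;
a is the offset left by the gaps already chosen, and w k stands for
- exp(omega k). *)
Fixpoint trunc_sum (m : nat) : ('I_m -> nat) -> ('I_m -> R[i]) -> R[i] -> R[i] :=
  match m with
  | 0 => fun _ _ _ => 1
  | m'.+1 => fun n w a =>
      \sum_(1 <= l < K.+1) w ord0 ^+ l / (a + l%:R) ^+ n ord0 *
        @trunc_sum m' (fun k => n (lift ord0 k)) (fun k => w (lift ord0 k)) (a + l%:R)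
  end.

Lemma geometric_sum_le (rho : R) (k : nat) : 0 <= rho < 1 ->
  \sum_(1 <= l < k.+1) rho ^+ l <= (1 - rho)^-1.
Proof.
move=> /andP[r0 r1]; have r1' : 0 < 1 - rho by lra.
suff : \sum_(1 <= l < k.+1) rho ^+ l <= (1 - rho ^+ k.+1) / (1 - rho).
  move=> /le_trans; apply; rewrite -[leRHS]mul1r; apply: ler_wpM2r.
    by rewrite invr_ge0 ltW.
  by rewrite gerBl exprn_ge0.
elim: k => [|k IHk]; first by rewrite big_geq// divr_ge0// ?subr_ge0 ?expr1// ltW.
rewrite big_nat_recr//= (le_trans (lerD IHk (lexx _)))// ler_pdivlMr//.
by rewrite mulrDl divfK ?gt_eqF// mulrBr mulr1 -exprSr addrA subrK.
Qed.

Lemma normc_add_nat_ge (a : R[i]) (l : nat) : 0 <= Re a -> (0 < l)%N ->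
  1 <= normc (a + l%:R).
Proof.
move=> a0 l0; apply: le_trans (normRe_le _); apply: le_trans (ler_norm _).
rewrite cReD cRe_nat; have : (1 : R) <= l%:R by rewrite ler1n.
lra.
Qed.

Lemma normc_pow_inv_le1 (a : R[i]) (l n : nat) : 0 <= Re a -> (0 < l)%N ->
  normc ((a + l%:R) ^+ n)^-1 <= 1.
Proof.
move=> a0 l0; have h := normc_add_nat_ge a0 l0.
rewrite normcV normcX invf_le1 ?exprn_ege1// exprn_gt0//; lra.
Qed.

Lemma trunc_sum_le (rho : R) m (n : 'I_m -> nat) (w : 'I_m -> R[i]) a :
  0 <= rho < 1 -> (forall k, normc (w k) <= rho) -> 0 <= Re a ->
  normc (trunc_sum n w a) <= (1 - rho)^-1 ^+ m.
Proof.
move=> r01; elim: m n w a => [|m IHm] n w a wr a0 /=; first by rewrite normc1.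
rewrite (le_trans (normc_sum _ _ _))// exprS.
have /andP[r0 r1] := r01.
have i0 : 0 <= (1 - rho)^-1 ^+ m by rewrite exprn_ge0// invr_ge0; lra.
apply: (@le_trans _ _ (\sum_(1 <= l < K.+1) rho ^+ l * (1 - rho)^-1 ^+ m)); last first.
  by rewrite -mulr_suml ler_wpM2r// geometric_sum_le.
rewrite !big_nat; apply: ler_sum => l /andP[l1 _].
rewrite !normcM normcX; apply: ler_pM; rewrite ?mulr_ge0 ?normc_ge0 ?exprn_ge0 ?normc_ge0//.
  rewrite -[leRHS]mulr1; apply: ler_pM; rewrite ?exprn_ge0 ?normc_ge0//.
    by rewrite lerXn2r// nnegrE// normc_ge0.
  exact: normc_pow_inv_le1.
by apply: IHm => //; rewrite cReD cRe_nat addr_ge0.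
Qed.

End TruncatedSums.

Section RationalClass.
Context (R : realType).
Implicit Types (H : R[i] -> R[i]) (b c z : R[i]).

(** Rational functions with all poles in Re z <= 0, generated so that estimates and
measurability follow by induction; the truncated sums belong to it. *)
Inductive ratl : (R[i] -> R[i]) -> Prop :=
| ratl_cst c : ratl (fun=> c)
| ratlD H1 H2 : ratl H1 -> ratl H2 -> ratl (fun z => H1 z + H2 z)
| ratl_div b H : 0 <= Re b -> ratl H -> ratl (fun z => H z / (b + z)).

Lemma ratl_translate H b : 0 <= Re b -> ratl H -> ratl (fun z => H (b + z)).
Proof.
move=> b0; elim=> [c|H1 H2 _ r1 _ r2|c H1 c0 _ r1]; [exact: ratl_cst|exact: ratlD|].
under eq_fun do rewrite addrA; apply: ratl_div => //.
by rewrite cReD addr_ge0.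
Qed.

Lemma ratlZ H c : ratl H -> ratl (fun z => c * H z).
Proof.
elim=> [d|H1 H2 _ r1 _ r2|d H1 d0 _ r1]; first exact: ratl_cst.
  by under eq_fun do rewrite mulrDr; exact: ratlD.
by under eq_fun do rewrite mulrA; exact: ratl_div.
Qed.

Lemma ratl_divX H b n : 0 <= Re b -> ratl H -> ratl (fun z => H z / (b + z) ^+ n).
Proof.
move=> b0 rH; elim: n => [|n IHn]; first by under eq_fun do rewrite expr0 divr1.
by under eq_fun do rewrite exprSr invfM mulrA; exact: ratl_div.
Qed.

Lemma ratl_sum (I : Type) (r : seq I) (F : I -> R[i] -> R[i]) :
  (forall i, ratl (F i)) -> ratl (fun z => \sum_(i <- r) F i z).
Proof.
move=> rF; elim: r => [|i r IHr]; first by under eq_fun do rewrite big_nil; exact: ratl_cst.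
by under eq_fun do rewrite big_cons; exact: ratlD.
Qed.

Lemma ratl_trunc_sum K m (n : 'I_m -> nat) (w : 'I_m -> R[i]) b : 0 <= Re b ->
  ratl (fun z => trunc_sum K n w (b + z)).
Proof.
elim: m n w b => [|m IHm] n w b b0 /=; first exact: ratl_cst.
apply: ratl_sum => l; have bl : 0 <= Re (b + l%:R) by rewrite cReD cRe_nat addr_ge0.
have := ratlZ (w ord0 ^+ l) (ratl_divX (n ord0) bl
  (IHm (fun k => n (lift ord0 k)) (fun k => w (lift ord0 k)) _ bl)).
congr ratl; apply/funext => z; rewrite (addrAC b z).
by rewrite mulrA mulrAC.
Qed.

Lemma ratl_smooth2 (eps : R) H : 0 < eps ->
  ratl H -> smooth2 eps 2 0 (fun p => H (- 'i * p)).
Proof.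
move=> e0; elim=> [c|H1 H2 _ r1 _ r2|b H1 b0 _ r1]; first exact: smooth2_cst.
  exact: smooth2D.
have := smooth2M r1 (smooth2_linV 2 e0 b0); rewrite addr0; congr smooth2.
by apply/funext => p; rewrite mulNr.
Qed.

Lemma ratl_line_measurable H : ratl H -> line_measurable (fun p => H (- 'i * p)).
Proof.
elim=> [c|H1 H2 _ r1 _ r2|b H1 b0 _ r1] y; first exact: cmeasurable_cst.
  exact: cmeasurableD.
apply: cmeasurableM => //; apply/cmeasurableV/cmeasurableD; first exact: cmeasurable_cst.
by apply: cmeasurableM; [exact: cmeasurable_cst|exact: line_measurable_id].
Qed.

End RationalClass.

Section Kernel.
Context (R : realType) (eps : R) (e01 : 0 < eps < 2^-1).
Local Notation mu := (@lebesgue_measure R).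
Implicit Types (w : R[i]) (x : R) (H : R[i] -> R[i]).

(** The kernel of one variable at p = x + i eps. The factor - i collects the powers of i:
the denominators are written in z = - i p, and (- i) (- i)^(-n) = i^(n - 1). *)
Definition kern w x : R[i] :=
  - 'i * (cexp (- ('i * (x +i* eps) * w)) / csh (pi%:C * (x +i* eps))).

(** The point z = - i p for p = x + i eps. *)
Definition zline x : R[i] := eps +i* - x.

Let e0 : 0 < eps. Proof. by case/andP : e01. Qed.

Lemma zlineE x : zline x = - 'i * (x +i* eps).
Proof. by apply: eqc; rewrite !(cReM, cImM) /=; ring. Qed.

Lemma cmeasurable_zline : cmeasurable setT (zline : measurableTypeR R -> R[i]).
Proof. by split=> /=; [exact: measurable_cst|exact: measurable_funN]. Qed.

Lemma line_measurable_phase w : line_measurable (fun p => cexp (- ('i * p * w))).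
Proof.
move=> y; apply/cmeasurable_cexp/cmeasurableN/cmeasurableM; last exact: cmeasurable_cst.
by apply: cmeasurableM; [exact: cmeasurable_cst|exact: line_measurable_id].
Qed.

Lemma cmeasurable_kern w : cmeasurable setT (kern w : measurableTypeR R -> R[i]).
Proof.
apply: cmeasurableM; first exact: cmeasurable_cst.
exact: (line_measurable_div_csh (@line_measurable_phase w)).
Qed.

Lemma phase_smooth2 w : smooth2 eps 2 `|Im w| (fun p => cexp (- ('i * p * w))).
Proof.
have e2 : eps <= 2 by case/andP : e01 => _; lra.
have := smooth2_cexp (- ('i * w)) e2.
rewrite cReN cReM /= mul0r mul1r sub0r opprK; congr smooth2.
by apply/funext => p; congr cexp; ring.
Qed.

Lemma kern_dominated w : `|Im w| < pi -> exists2 b : R -> R,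
  mu.-integrable setT (EFin \o b) & forall x, normc (kern w x) <= b x.
Proof.
move=> wpi; have rp : `|Im w| - pi < 0 by rewrite subr_lt0.
have e1 : eps < 1 by case/andP : e01 => _; lra.
have s : smooth2 eps eps (`|Im w| - pi) (fun p => cexp (- ('i * p * w)) / csh (pi%:C * p)).
  apply: smooth2_div_csh => //; last by apply: smooth2_sub (phase_smooth2 w) => //; lra.
  by move=> y; rewrite andbC => /le_anti ->; apply: sin_pi_neq0; rewrite e0.
have [f1 [C [C0 HC]]] := s.
exists (fun x => C * expR ((`|Im w| - pi) * `|x|)).
  exact: (integrableZl measurableT C (integrable_exp_decay rp)).
move=> x; rewrite /kern normcM normcN normc_i mul1r.
have := HC (x +i* eps) 0; rewrite addr0 normc0.
have ee : eps <= Im (x +i* eps) <= eps by rewrite /= lexx.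
by case/(_ ee ee ler01).
Qed.

Lemma zline_ge x b : 0 <= Re b -> eps <= normc (b + zline x).
Proof.
move=> b0; apply: le_trans (normRe_le _); apply: le_trans (ler_norm _).
by rewrite cReD /=; lra.
Qed.

Lemma zline_pow_inv_le x b n : 0 <= Re b ->
  normc ((b + zline x) ^+ n)^-1 <= eps^-1 ^+ n.
Proof.
move=> b0; have h := zline_ge x b0.
have j : (normc (b + zline x))^-1 <= eps^-1.
  by rewrite lef_pV2// posrE (lt_le_trans e0).
rewrite normcV normcX -exprVn; apply: lerXn2r => //.
  by rewrite nnegrE invr_ge0 normc_ge0.
by rewrite nnegrE invr_ge0 ltW.
Qed.

Lemma ratl_bounded H : ratl H -> exists2 C, 0 <= C &
  forall z, eps <= Re z -> normc (H z) <= C.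
Proof.
elim=> [c|H1 H2 _ [C1 C10 h1] _ [C2 C20 h2]|b H1 b0 _ [C C0 h]].
- by exists (normc c) => //; exact: normc_ge0.
- exists (C1 + C2) => [|z ez]; first exact: addr_ge0.
  by rewrite (le_trans (normcD _ _))// lerD ?h1 ?h2.
- exists (C * eps^-1) => [|z ez]; first by rewrite mulr_ge0// invr_ge0 ltW.
  rewrite normcM normcV; apply: ler_pM; rewrite ?invr_ge0 ?normc_ge0 ?h//.
  have h' : eps <= normc (b + z).
    by apply: le_trans (normRe_le _); apply: le_trans (ler_norm _); rewrite cReD; lra.
  by rewrite lef_pV2// posrE (lt_le_trans e0).
Qed.

Lemma cmeasurable_ratl H : ratl H ->
  cmeasurable setT (fun x : measurableTypeR R => H (zline x)).
Proof.
move=> /ratl_line_measurable/(_ eps); congr cmeasurable.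
by apply/funext => x; rewrite zlineE.
Qed.

Lemma cintegrable_kern_ratl w H : `|Im w| < pi -> ratl H ->
  cintegrable mu setT (fun x => kern w x * H (zline x)).
Proof.
move=> wpi rH; have [b ib hb] := kern_dominated wpi; have [C C0 hC] := ratl_bounded rH.
apply: (@cintegrable_le R _ (measurableTypeR R) mu setT measurableT _ (fun x => C * b x)).
- by apply: cmeasurableM; [exact: cmeasurable_kern|exact: cmeasurable_ratl].
- exact: (integrableZl measurableT C ib).
- move=> x _; rewrite normcM mulrC; apply: ler_pM; rewrite ?normc_ge0//.
  by apply: hC; rewrite /=.
Qed.

(** Since sh(pi (p + i)) = - sh(pi p) and the phase at p + i is exp(omega) times the
phase at p, the integral along the line at height 1 + eps is again a kernel
integral, of the translate H(1 + z); the two lines differ by the residue at p = i,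
that is z = 1. *)
Lemma kernel_step w H : `|Im w| < pi -> ratl H ->
  cintegral mu setT (fun x => kern w x * H (zline x)) =
  - cexp w * (H 1 + cintegral mu setT (fun x => kern w x * H (1 + zline x))).
Proof.
move=> wpi rH; pose N p := cexp (- ('i * p * w)) * H (- 'i * p).
have sN : smooth2 eps 2 `|Im w| N.
  by have := smooth2M (phase_smooth2 w) (ratl_smooth2 e0 rH); rewrite addr0.
have mN : line_measurable N.
  by apply: line_measurableM; [exact: line_measurable_phase|exact: ratl_line_measurable].
have := residue_at_i e01 wpi sN mN.
have rH1 : ratl (fun z => H (1 + z)) by apply: ratl_translate => //=.
have i1 := cintegrable_kern_ratl wpi rH; have i2 := cintegrable_kern_ratl wpi rH1.
have ii : 'i * 'i = -1 :> R[i] by rewrite -expr2 sqr_i.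
have -> : line_integral (fun p => N p / csh (pi%:C * p)) eps =
  'i * cintegral mu setT (fun x => kern w x * H (zline x)).
  rewrite -cintegralZ//; apply: eq_cintegral => x _; rewrite /N /kern -zlineE.
  rewrite mulrA mulrA mulrN ii opprK mul1r; ring.
have -> : line_integral (fun p => N p / csh (pi%:C * p)) (1 + eps) =
  - ('i * cexp w) * cintegral mu setT (fun x => kern w x * H (1 + zline x)).
  rewrite -cintegralZ//; apply: eq_cintegral => x _; rewrite /N /kern.
  have -> : x +i* (1 + eps) = (x +i* eps) + 'i by apply: eqc; rewrite !(cReD, cImD) /=; ring.
  have -> : - 'i * (x +i* eps + 'i) = 1 + zline x by rewrite mulrDr -zlineE mulNr ii opprK addrC.
  rewrite csh_shift cexp_i_shift invrN.
  transitivity (('i * 'i) * (cexp w * cexp (- ('i * (x +i* eps) * w)) *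
     H (1 + zline x) / csh (pi%:C * (x +i* eps)))); last by ring.
  by rewrite ii; ring.
have -> : N 'i = cexp w * H 1 by rewrite /N mulNr ii mulN1r !opprK.
set I1 := cintegral _ _ _; set I2 := cintegral _ _ _ => h.
have := congr1 (fun u => - 'i * u) h.
rewrite (_ : - 'i * ('i * I1 - - ('i * cexp w) * I2) = - ('i * 'i) * (I1 + cexp w * I2));
  last by ring.
rewrite (_ : - 'i * - ('i * (cexp w * H 1)) = ('i * 'i) * (cexp w * H 1)); last by ring.
rewrite ii opprK mul1r mulN1r mulrDr => /eqP.
by rewrite -subr_eq0 opprK => /eqP h'; apply/eqP; rewrite -subr_eq0 -h'; apply/eqP; ring.
Qed.

(** Iterating moves the line up by K: the residues at z = 1, ..., K appear, and the
remaining integral carries the factor (- exp w)^K. *)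
Lemma kernel_iter w H K : `|Im w| < pi -> ratl H ->
  cintegral mu setT (fun x => kern w x * H (zline x)) =
  \sum_(1 <= l < K.+1) (- cexp w) ^+ l * H l%:R +
  (- cexp w) ^+ K * cintegral mu setT (fun x => kern w x * H (K%:R + zline x)).
Proof.
move=> wpi rH; elim: K => [|K ->].
  by rewrite big_geq// add0r expr0 mul1r; apply: eq_cintegral => x _; rewrite add0r.
rewrite [in RHS]big_nat_recr//= -addrA; congr (_ + _).
rewrite (@kernel_step w (fun z => H (K%:R + z)))//; last first.
  by apply: ratl_translate => //; rewrite cRe_nat.
rewrite exprSr -natr1 !mulrA mulrDr; congr (_ + _ * _).
by apply: eq_cintegral => x _; rewrite addrA natr1.
Qed.

End Kernel.

(** * The Fourier integral *)

Section FourierSide.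
Context (R : realType) (eps : R) (e01 : 0 < eps < 2^-1).
Local Notation mu := (@lebesgue_measure R).

Let e0 : 0 < eps. Proof. by case/andP : e01. Qed.

(** The integrand in all variables, with an offset a added to every partial sum so
that the tail of the product is an integrand of the same shape. *)
Definition kern_product m (n : 'I_m -> nat) (omega : 'I_m -> R[i]) (a : R[i])
    (x : m.-tuple (measurableTypeR R)) : R[i] :=
  \prod_(k < m) (kern eps (omega k) (tnth x k) /
                 (a + \sum_(j < m | (j <= k)%N) zline eps (tnth x j)) ^+ n k).

Lemma kern_product_tcons m (n : 'I_m.+1 -> nat) (omega : 'I_m.+1 -> R[i]) a x t :
  kern_product n omega a (tcons (x, t)) =
  kern eps (omega ord0) x / (a + zline eps x) ^+ n ord0 *
  kern_product (fun k => n (lift ord0 k)) (fun k => omega (lift ord0 k))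
    (a + zline eps x) t.
Proof.
rewrite /kern_product big_ord_recl; congr (_ / (_ + _) ^+ _ * _).
  rewrite big_mkcond big_ord_recl /= big1 ?addr0// => i _.
apply: eq_bigr => k _; rewrite tnthS; congr (_ / _ ^+ _).
rewrite -addrA; congr (_ + _); rewrite big_mkcond big_ord_recl /=; congr (_ + _).
rewrite [RHS]big_mkcond; apply: eq_bigr => j _.
by rewrite tnthS.
Qed.

Lemma cmeasurable_kern_product m (n : 'I_m -> nat) (omega : 'I_m -> R[i]) a :
  cmeasurable setT (kern_product n omega a).
Proof.
apply: cmeasurable_prod => k; apply: cmeasurableM.
  apply: (@cmeasurable_comp R _ _ (measurableTypeR R) _ (fun t => tnth t k)).
    exact: measurable_tnth.
  exact: cmeasurable_kern.
apply/cmeasurableV/cmeasurableX/cmeasurableD; first exact: cmeasurable_cst.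
apply: cmeasurable_sum => j.
apply: (@cmeasurable_comp R _ _ (measurableTypeR R) _ (fun t => tnth t j)).
  exact: measurable_tnth.
exact: cmeasurable_zline.
Qed.

Lemma integrable_tuple_product m (b : R -> R) (h : m.-tuple (measurableTypeR R) -> R) :
  mu.-integrable setT (EFin \o b) -> (forall x, 0 <= b x) ->
  (lebesgue_tuple R m).-integrable setT (EFin \o h) -> (forall t, 0 <= h t) ->
  (lebesgue_tuple R m.+1).-integrable setT
    (EFin \o (fun t => b (thead t) * h [tuple of behead t])).
Proof.
move=> ib b0 ih h0.
have mb : measurable_fun setT (b : measurableTypeR R -> R).
  by apply/measurable_EFinP; exact: measurable_int ib.
have mh : measurable_fun setT h by apply/measurable_EFinP; exact: measurable_int ih.
pose f (t : m.+1.-tuple (measurableTypeR R)) : R[i] := (b (thead t) * h [tuple of behead t])%:C.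
have mf : cmeasurable setT f.
  split=> /=; last exact: measurable_cst.
  apply: measurable_funM.
    exact: (measurableT_comp mb (measurable_tnth ord0)).
  by apply: (measurableT_comp mh); exact: measurable_behead.
suff [] : cintegrable (lebesgue_tuple R m.+1) setT f by [].
have iH := integrableZl measurableT (Rintegral mu setT b) ih.
apply: (cintegrable_tuple_measureS mf iH) => t.
have hth x : thead (tcons (x, t)) = x by [].
have htt x : [tuple of behead (tcons (x, t))] = t by apply: val_inj.
under eq_integral => x _.
  rewrite /f hth htt normc_real ger0_norm ?mulr_ge0// mulrC EFinM; over.
rewrite integralZl// mulrC EFinM /Rintegral fineK//.
exact: integrable_fin_num.
Qed.

Lemma kern_product_dominated m (n : 'I_m -> nat) (omega : 'I_m -> R[i]) :
  (forall k, `|Im (omega k)| < pi) ->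
  exists h : m.-tuple (measurableTypeR R) -> R,
  [/\ (lebesgue_tuple R m).-integrable setT (EFin \o h), (forall t, 0 <= h t) &
    forall a t, 0 <= Re a -> normc (kern_product n omega a t) <= h t].
Proof.
elim: m n omega => [|m IHm] n omega opi.
  exists (fun=> 1); split=> //.
    apply/integrableP; split; first exact: measurable_cst.
    by rewrite /= integral_dirac//= diracE mem_set// mul1e normr1 ltry.
  by move=> a t _; rewrite /kern_product big_ord0 normc1.
have [h [ih h0 hh]] := IHm (fun k => n (lift ord0 k)) _ (fun k => opi (lift ord0 k)).
have [b ib hb] := kern_dominated e01 (opi ord0).
have b0 x : 0 <= b x by apply: le_trans (hb x); exact: normc_ge0.
pose c := eps^-1 ^+ n ord0.
have c0 : 0 <= c by rewrite exprn_ge0// invr_ge0 ltW.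
exists (fun t => (c * b (thead t)) * h [tuple of behead t]); split.
- apply: (@integrable_tuple_product m (fun x => c * b x)) => //.
    exact: (integrableZl measurableT c ib).
  by move=> x; rewrite mulr_ge0.
- by move=> t; rewrite !mulr_ge0.
move=> a t a0.
have -> : t = tcons (thead t, [tuple of behead t]) by rewrite /tcons /= [LHS]tuple_eta.
rewrite kern_product_tcons normcM.
have htt x u : [tuple of behead (tcons (x, u))] = u :> m.-tuple (measurableTypeR R).
  by apply: val_inj.
rewrite htt (_ : thead (tcons _) = thead t)//.
apply: ler_pM; rewrite ?normc_ge0//; last by apply: hh; rewrite cReD /= addr_ge0// ltW.
rewrite normcM mulrC; apply: ler_pM; rewrite ?normc_ge0//.
exact: zline_pow_inv_le.
Qed.

Lemma cintegrable_kern_product m (n : 'I_m -> nat) (omega : 'I_m -> R[i]) a :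
  (forall k, `|Im (omega k)| < pi) -> 0 <= Re a ->
  cintegrable (lebesgue_tuple R m) setT (kern_product n omega a).
Proof.
move=> opi a0; have [h [ih h0 hh]] := kern_product_dominated n opi.
apply: (cintegrable_le measurableT (cmeasurable_kern_product n omega a) ih) => t _.
exact: hh.
Qed.

(** Integrating the first variable last leaves, for the others, the same integral with
offset a + z_1. *)
Lemma kern_product_integral_tcons m (n : 'I_m.+1 -> nat) (omega : 'I_m.+1 -> R[i]) a :
  (forall k, `|Im (omega k)| < pi) -> 0 <= Re a ->
  let F x := cintegral (lebesgue_tuple R m) setT
      (kern_product (fun k => n (lift ord0 k)) (fun k => omega (lift ord0 k))
        (a + zline eps x)) in
  cmeasurable setT (fun x : measurableTypeR R =>
     kern eps (omega ord0) x / (a + zline eps x) ^+ n ord0 * F x) /\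
  cintegral (lebesgue_tuple R m.+1) setT (kern_product n omega a) =
  cintegral mu setT (fun x => kern eps (omega ord0) x / (a + zline eps x) ^+ n ord0 * F x).
Proof.
move=> opi a0 F.
have [h [ih h0 hh]] := kern_product_dominated (fun k => n (lift ord0 k)) (fun k => opi (lift ord0 k)).
have [b ib hb] := kern_dominated e01 (opi ord0).
pose c := eps^-1 ^+ n ord0.
have c0 : 0 <= c by rewrite exprn_ge0// invr_ge0 ltW.
have ax x : 0 <= Re (a + zline eps x) by rewrite cReD /= addr_ge0// ltW.
have mf := cmeasurable_kern_product n omega a.
have icb := integrableZl measurableT c ib.
have iH := integrableZl measurableT (Rintegral mu setT (fun x => c * b x)) ih.
have bound t : (\int[mu]_x (normc (kern_product n omega a (tcons (x, t))))%:E <=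
   (Rintegral mu setT (fun x => c * b x))%:E * (EFin \o h) t)%E.
  rewrite {1}/Rintegral fineK; last exact: integrable_fin_num.
  rewrite -integralZr//; apply: ge0_le_integral => //.
  - by move=> x _; rewrite lee_fin normc_ge0.
  - apply/measurable_EFinP/measurable_normc.
    apply: (@cmeasurable_comp R _ _ _ (measurableTypeR R) (fun x => tcons (x, t)) _ _ mf).
    apply: (measurableT_comp (@measurable_tcons _ (measurableTypeR R) m)).
    exact: measurable_pair2.
  - by apply: emeasurable_funM; [exact: measurable_int icb|exact: measurable_cst].
  move=> x _; rewrite /= -EFinM lee_fin kern_product_tcons normcM.
  apply: ler_pM; rewrite ?normc_ge0//; last exact: hh.
  rewrite normcM mulrC; apply: ler_pM; rewrite ?normc_ge0//.
  exact: zline_pow_inv_le.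
have e := cintegral_tuple12 mf iH bound.
have m12 := cmeasurable_tuple_fubini mf iH bound.
have inner x : cintegral (lebesgue_tuple R m) setT (fun t => kern_product n omega a (tcons (x, t))) =
   kern eps (omega ord0) x / (a + zline eps x) ^+ n ord0 * F x.
  rewrite /F -cintegralZ//; last by apply: cintegrable_kern_product => // k; exact: opi.
  by apply: eq_cintegral => t _; rewrite kern_product_tcons.
split.
  by move: m12; congr cmeasurable; apply/funext => x; exact: inner.
by rewrite e; apply: eq_cintegral => x _; exact: inner.
Qed.

(** By induction on the number of variables: up to a geometric error the inner
integral is a truncated sum in a + z_1, a function to which the one-variable
formula applies. The error is uniform in the offset, as the induction requires. *)
Lemma kern_product_integral_trunc m (n : 'I_m -> nat) (omega : 'I_m -> R[i]) (rho : R) :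
  (forall k, `|Im (omega k)| < pi) -> 0 <= rho < 1 ->
  (forall k, normc (- cexp (omega k)) <= rho) ->
  exists2 C, 0 <= C & forall a K, 0 <= Re a ->
  normc (cintegral (lebesgue_tuple R m) setT (kern_product n omega a) -
         trunc_sum K n (fun k => - cexp (omega k)) a) <= C * rho ^+ K.
Proof.
move=> opi r01; have /andP[r0 r1] := r01.
elim: m n omega opi => [|m IHm] n omega opi wr.
  exists 0 => // a K _; rewrite mul0r /= /kern_product.
  under eq_cintegral do rewrite big_ord0.
  rewrite /cintegral /Rintegral /= !integral_dirac//= indicE in_setT mul1r mulr0.
  by rewrite subrr normc0.
have [C C0 HC] := IHm (fun k => n (lift ord0 k)) _ (fun k => opi (lift ord0 k))
  (fun k => wr (lift ord0 k)).
have [b ib hb] := kern_dominated e01 (opi ord0).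
pose c := eps^-1 ^+ n ord0.
have c0 : 0 <= c by rewrite exprn_ge0// invr_ge0 ltW.
have b0 x : 0 <= b x by apply: le_trans (hb x); exact: normc_ge0.
pose Ib := Rintegral mu setT b.
have Ib0 : 0 <= Ib by exact: Rintegral_ge0.
pose B := (1 - rho)^-1 ^+ m.
have B0 : 0 <= B by rewrite exprn_ge0// invr_ge0; lra.
exists (2 * (c * C * Ib) + 2 * (c * B * Ib)).
  by rewrite addr_ge0// !mulr_ge0.
move=> a K a0.
have ax x : 0 <= Re (a + zline eps x) by rewrite cReD /= addr_ge0// ltW.
have := kern_product_integral_tcons n opi a0.
set F := (F in let F := F in _); move=> [mF ->].
pose n' k := n (lift ord0 k); pose w' k := - cexp (omega (lift ord0 k)).
pose H z := trunc_sum K n' w' (a + z) / (a + z) ^+ n ord0.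
have rH : ratl H by apply: ratl_divX => //; exact: ratl_trunc_sum.
have -> : trunc_sum K n (fun k => - cexp (omega k)) a =
  \sum_(1 <= l < K.+1) (- cexp (omega ord0)) ^+ l * H l%:R.
  by apply: eq_bigr => l _; rewrite /H mulrA mulrAC.
have ke := kernel_iter e01 K (opi ord0) rH.
have i1 := cintegrable_kern_ratl e01 (opi ord0) rH.
(* the error made by replacing the inner integral by its truncated sum *)
pose D x := kern eps (omega ord0) x / (a + zline eps x) ^+ n ord0 * F x
   - kern eps (omega ord0) x * H (zline eps x).
have mD : cmeasurable setT (D : measurableTypeR R -> R[i]).
  apply: cmeasurableD => //; apply: cmeasurableN; apply: cmeasurableM.
    exact: cmeasurable_kern.
  exact: cmeasurable_ratl.
have Dle x : normc (D x) <= c * C * rho ^+ K * b x.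
  have -> : D x = kern eps (omega ord0) x * (((a + zline eps x) ^+ n ord0)^-1 *
     (F x - trunc_sum K n' w' (a + zline eps x))).
    by rewrite /D /H; ring.
  rewrite normcM mulrC; apply: ler_pM; rewrite ?normc_ge0//.
  rewrite normcM -mulrA; apply: ler_pM; rewrite ?normc_ge0//; last exact: HC.
  exact: zline_pow_inv_le.
have ibc := integrableZl measurableT (c * C * rho ^+ K) ib.
have iD : cintegrable mu setT D by apply: (cintegrable_le measurableT mD ibc) => y _; exact: Dle.
have e : cintegral mu setT (fun x => kern eps (omega ord0) x / (a + zline eps x) ^+ n ord0 * F x) =
  cintegral mu setT D + cintegral mu setT (fun x => kern eps (omega ord0) x * H (zline eps x)).
  by rewrite -cintegralD//; apply: eq_cintegral => x _; rewrite /D subrK.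
rewrite e ke (_ : _ + _ - _ = cintegral mu setT D + (- cexp (omega ord0)) ^+ K *
  cintegral mu setT (fun x => kern eps (omega ord0) x * H (K%:R + zline eps x))); last by ring.
rewrite (le_trans (normcD _ _))// mulrDl lerD//.
  rewrite (_ : 2 * (c * C * Ib) * rho ^+ K = 2 * (c * C * rho ^+ K * Ib)); last by ring.
  rewrite /Ib -(RintegralZl (c * C * rho ^+ K) measurableT ib).
  by apply: (normc_cintegral_le measurableT mD ibc) => y _; exact: Dle.
rewrite normcM normcX mulrC; apply: ler_pM; rewrite ?exprn_ge0 ?normc_ge0//; last first.
  by rewrite lerXn2r ?nnegrE ?normc_ge0.
rewrite /Ib -(RintegralZl (c * B) measurableT ib).
have rH' : ratl (fun z => H (K%:R + z)) by apply: ratl_translate => //; rewrite cRe_nat.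
apply: (normc_cintegral_le measurableT _ (integrableZl measurableT (c * B) ib)).
  apply: cmeasurableM; first exact: cmeasurable_kern.
  exact: (cmeasurable_ratl eps rH').
move=> x _; rewrite normcM mulrC; apply: ler_pM; rewrite ?normc_ge0// /H mulrC.
have aK : 0 <= Re (a + K%:R) by rewrite cReD cRe_nat addr_ge0.
rewrite addrA normcM; apply: ler_pM; rewrite ?normc_ge0//.
  exact: zline_pow_inv_le.
apply: trunc_sum_le => //; first by move=> k; exact: wr.
by rewrite cReD addr_ge0//= ltW.
Qed.

End FourierSide.

(** * The iterated integral *)

Section Moments.
Context (R : realType).
Local Notation mu := (@lebesgue_measure R).
Implicit Types (h x : R) (n : nat).

Definition moment n h x : R := if 0 <= x <= h then x ^+ n else 0.

(** What the form dt/t makes of the weight x^(n + 1). It differs from the monomial of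
degree n at x = 0 only, where the inverse of 0 is 0. *)
Definition momentV n h x : R := if 0 <= x <= h then x ^+ n.+1 / x else 0.

Lemma moment_ge0 n h x : 0 <= moment n h x.
Proof. by rewrite /moment; case: ifP => // /andP[x0 _]; exact: exprn_ge0. Qed.

Lemma momentV_ge0 n h x : 0 <= momentV n h x.
Proof.
by rewrite /momentV; case: ifP => // /andP[x0 _]; rewrite divr_ge0// exprn_ge0.
Qed.

Lemma integral_monomial n h : 0 <= h ->
  (\int[mu]_(x in `[0%R, h]) (x ^+ n)%:E = (h ^+ n.+1 / n.+1%:R)%:E)%E.
Proof.
rewrite le_eqVlt => /predU1P[<-|h0].
  by rewrite set_itv1 integral_set1 expr0n/= mul0r.
have d (x : R) : is_derive x 1 (fun t : R => t ^+ n.+1 / n.+1%:R) (x ^+ n).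
  have -> : (fun t : R => t ^+ n.+1 / n.+1%:R) =
      n.+1%:R^-1 *: ((id : R -> R) ^+ n.+1 : R -> R^o).
    by apply/funext => t; rewrite mulrC exprfctE.
  have d1 := @is_deriveX R R^o id n.+1 x 1 1 (is_derive_id x 1).
  have d2 := is_deriveZ n.+1%:R^-1 d1.
  suff <- : n.+1%:R^-1 *: ((n.+1%:R * id x ^+ n.+1.-1) *: (1 : R^o)) = x ^+ n by exact: d2.
  by rewrite /GRing.scale/= mulr1 mulrA mulVf ?mul1r// pnatr_eq0.
have c : continuous (fun t : R => t ^+ n.+1 / n.+1%:R).
  by move=> x; apply/differentiable_continuous/derivable1_diffP; exact: ex_derive.
rewrite (continuous_FTC2 h0 (F := fun t : R => t ^+ n.+1 / n.+1%:R)).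
- by rewrite expr0n/= mul0r sube0.
- by apply: continuous_subspaceT; exact: exprn_continuous.
- split; first by move=> x _; exact: ex_derive.
    by apply: cvg_at_right_filter; exact: c.
  by apply: cvg_at_left_filter; exact: c.
- by move=> x _; rewrite derive1E; exact: derive_val.
Qed.

Lemma integral_moment n h : 0 <= h ->
  (\int[mu]_x (moment n h x)%:E = (h ^+ n.+1 / n.+1%:R)%:E)%E.
Proof.
move=> h0; rewrite -integral_monomial// [RHS]integral_mkcond.
apply: eq_integral => x _; rewrite /moment patchE.
have -> : (x \in `[0, h]%classic) = (0 <= x <= h).
  by apply/idP/idP; rewrite inE/= in_itv/=.
by case: ifP.
Qed.

Lemma integral_momentV n h : 0 <= h ->
  (\int[mu]_x (momentV n h x)%:E = (h ^+ n.+1 / n.+1%:R)%:E)%E.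
Proof.
move=> h0; rewrite -integral_monomial// -integral_itv_obnd_cbnd; last first.
  by apply/measurable_EFinP/measurable_funTS.
rewrite [RHS]integral_mkcond.
apply: eq_integral => x _; rewrite /momentV patchE.
have -> : (x \in `]0, h]%classic) = (0 < x <= h).
  by apply/idP/idP; rewrite inE/= in_itv/=.
rewrite le_eqVlt andb_orl; case: eqVneq => [<-|x0] /=.
  by rewrite ltxx /= expr0n/= mul0r; case: ifP.
by case: ifP => // _; rewrite exprSr mulfK// eq_sym.
Qed.

End Moments.

Section Layers.
Context (R : realType).
Local Notation mu := (@lebesgue_measure R).
Local Notation tup N := (N.-tuple (measurableTypeR R)).
Implicit Types (eta : seq (R[i] -> R[i])) (f : R[i] -> R[i]).

Definition simplexb N (t : tup N) : bool := path <=%R (0 : R) (rcons t (1 : R)).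

(** The default value 1 is the upper end point of the simplex, which is the bound on
the last variable when no variable is left. *)
Definition first_coord N (t : tup N) : R := head 1 t.

Definition neg_path : R -> R[i] := straight_path 0 (-1).

(** The weight t_1^a is what the integration of the preceding variables leaves
behind. *)
Definition weighted_integrand eta (a : nat) (t : tup (size eta)) : R[i] :=
  if simplexb t then (first_coord t ^+ a)%:C * iterated_integrand neg_path t else 0.

Definition weighted_integral eta a : R[i] :=
  cintegral (lebesgue_tuple R (size eta)) setT (weighted_integrand (eta := eta) a).

Definition pullback f (s : R) : R[i] := f (neg_path s) * path_deriv neg_path s.

Lemma neg_pathE s : neg_path s = - s%:C.
Proof. by rewrite /neg_path /straight_path subr0 add0r mulrN1. Qed.

Lemma path_deriv_neg_path s : path_deriv neg_path s = -1.
Proof.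
rewrite /path_deriv.
rewrite (_ : (fun u => Re (neg_path u)) = -%R); last first.
  by apply/funext => u; rewrite neg_pathE cReN.
rewrite (_ : (fun u => Im (neg_path u)) = cst 0); last first.
  by apply/funext => u; rewrite neg_pathE cImN /= oppr0.
rewrite !derive1E derive_cst; apply: eqc; last by rewrite cImN /= oppr0.
by rewrite cReN /=; exact: derive_val.
Qed.

Lemma pullbackE f s : pullback f s = - f (- s%:C).
Proof. by rewrite /pullback path_deriv_neg_path neg_pathE mulrN1. Qed.

(** The first variable ranges over [0, t_2] once the others are fixed. *)
Lemma simplexb_cons N (t : tup N.+1) :
  simplexb t = (0 <= thead t <= first_coord [tuple of behead t]) && simplexb [tuple of behead t].
Proof.
case: t => -[//|x s] st; rewrite /simplexb /first_coord /thead /= (tnth_nth 0)/=.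
case: s {st} => [|y s] /=; first by rewrite ler01 !andbT.
case: (leP 0 x) => //= x0; case: (leP x y) => //= xy.
by rewrite (le_trans x0 xy).
Qed.

Lemma simplexb_first N (t : tup N) : simplexb t -> 0 <= first_coord t <= 1.
Proof.
rewrite /simplexb /first_coord; case: t => s _ /=.
elim: s => [|x s IHs] /=; first by rewrite ler01 lexx.
move=> /andP[-> h]; move: IHs.
case: s h => [|y s] /=; first by rewrite andbT => ->.
move=> /andP[xy h]; move=> IHs /=.
have [y0|y0] := leP 0 y; last first.
  have := order_path_min le_trans h; rewrite all_rcons => /andP[y1 _].
  by rewrite (le_trans xy).
by move: IHs; rewrite y0 h => /(_ isT)/andP[_]; exact: le_trans.
Qed.

Lemma weighted_integrand_cons f eta a (t : tup (size eta).+1) :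
  weighted_integrand (eta := f :: eta) a t =
  if 0 <= thead t <= first_coord [tuple of behead t] then
    (thead t ^+ a)%:C * pullback f (thead t) *
      weighted_integrand (eta := eta) 0 [tuple of behead t]
  else 0.
Proof.
rewrite /weighted_integrand simplexb_cons /=; case: (0 <= _ <= _) => //=.
case: (simplexb _); last by rewrite mulr0.
rewrite expr0 mul1r -mulrA /iterated_integrand big_ord_recl; congr (_%:C * (_ * _)).
  by congr (_ ^+ _); case: t => -[].
have e (i : 'I_(size eta)) : tnth t (lift ord0 i) = tnth [tuple of behead t] i.
  by rewrite [t in LHS]tuple_eta tnthS.
by apply: eq_bigr => i _; rewrite e.
Qed.

Lemma weighted_integrandE eta a (t : tup (size eta)) :
  weighted_integrand a t = (first_coord t ^+ a)%:C * weighted_integrand 0 t.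
Proof. by rewrite /weighted_integrand; case: ifP; rewrite ?mulr0// expr0 mul1r. Qed.

Lemma measurable_first_coord N : measurable_fun setT (@first_coord N).
Proof.
case: N => [|N].
  rewrite (_ : @first_coord 0 = cst 1); first exact: measurable_cst.
  by apply/funext => t; rewrite (tuple0 t).
rewrite (_ : @first_coord N.+1 = fun t => tnth t ord0); first exact: measurable_tnth.
by apply/funext => t; rewrite /first_coord (tnth_nth 1) /= nth0.
Qed.

Lemma measurable_between N : measurable_fun setT
  (fun t : tup N.+1 => 0 <= thead t <= first_coord [tuple of behead t]).
Proof.
apply: measurable_and.
  by apply: measurable_fun_ler; [exact: measurable_cst|exact: measurable_tnth].
apply: measurable_fun_ler; first exact: measurable_tnth.
by apply: (measurableT_comp (@measurable_first_coord N)); exact: measurable_behead.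
Qed.

Lemma measurable_simplexb N : measurable_fun setT (@simplexb N).
Proof.
elim: N => [|N IHN].
  rewrite (_ : @simplexb 0 = cst true); first exact: measurable_cst.
  by apply/funext => t; rewrite (tuple0 t) /simplexb /= ler01.
rewrite (_ : @simplexb N.+1 = fun t =>
    (0 <= thead t <= first_coord [tuple of behead t]) && simplexb [tuple of behead t]);
  last by apply/funext => t; exact: simplexb_cons.
apply: measurable_and; first exact: measurable_between.
by apply: (measurableT_comp IHN); exact: measurable_behead.
Qed.

Lemma measurable_simplex N : measurable (@simplex R N).
Proof.
have := @measurable_simplexb N measurableT [set true] I.
by rewrite setTI; congr measurable; apply/seteqP; split=> t.
Qed.

Lemma cmeasurable_weighted_cons f eta a :
  cmeasurable setT (pullback f : measurableTypeR R -> R[i]) ->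
  cmeasurable setT (weighted_integrand (eta := eta) 0) ->
  cmeasurable setT (weighted_integrand (eta := f :: eta) a).
Proof.
move=> mf me.
rewrite (_ : weighted_integrand (eta := f :: eta) a = fun t : tup (size eta).+1 =>
  if 0 <= thead t <= first_coord [tuple of behead t] then
    (thead t ^+ a)%:C * pullback f (thead t) *
      weighted_integrand (eta := eta) 0 [tuple of behead t]
  else 0); last by apply/funext => t; exact: (@weighted_integrand_cons f eta a t).
apply: cmeasurable_if; first exact: measurable_between.
apply: cmeasurableM; last first.
  by apply: cmeasurable_comp me; exact: measurable_behead.
apply: cmeasurableM.
  split=> /=; last exact: measurable_cst.
  by apply: measurable_funX; exact: measurable_tnth.
exact: (@cmeasurable_comp R _ _ (measurableTypeR R) _ (fun t : tup (size eta).+1 => thead t)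
  (pullback f) (measurable_tnth ord0) mf).
Qed.

(** The weight has exponent at least 1: with exponent 0 and dt/t as first form the
integral diverges. *)
Definition well_behaved eta := cmeasurable setT (weighted_integrand (eta := eta) 0) /\
  forall a, cintegrable (lebesgue_tuple R (size eta)) setT (weighted_integrand (eta := eta) a.+1).

(** A variable that enters through q h x, with total mass h^(n+1) / (n+1) on [0, h], can
be integrated out: it leaves the weight t_1^(n+1) on the next variable. *)
Lemma layer_integral eta n (q : R -> R -> R) : well_behaved eta ->
  (forall h x, 0 <= q h x) ->
  (forall h, 0 <= h -> (\int[mu]_x (q h x)%:E = (h ^+ n.+1 / n.+1%:R)%:E)%E) ->
  (forall h, measurable_fun setT (q h : measurableTypeR R -> R)) ->
  measurable_fun setT (fun t : tup (size eta).+1 =>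
    q (first_coord [tuple of behead t]) (thead t)) ->
  let layer (t : tup (size eta).+1) :=
    (q (first_coord [tuple of behead t]) (thead t))%:C *
      weighted_integrand (eta := eta) 0 [tuple of behead t] in
  cintegrable (lebesgue_tuple R (size eta).+1) setT layer /\
  cintegral (lebesgue_tuple R (size eta).+1) setT layer = weighted_integral eta n.+1 / n.+1%:R.
Proof.
move=> [me ie] q0 qint mq mqt layer.
have mlayer : cmeasurable setT layer.
  apply: cmeasurableM; first by split=> //=; exact: measurable_cst.
  by apply: cmeasurable_comp me; exact: measurable_behead.
have layerE x u : layer (tcons (x, u)) = (q (first_coord u) x)%:C * weighted_integrand 0 u.
  rewrite /layer (_ : [tuple of behead (tcons (x, u))] = u)//; exact: val_inj.
(* the moment formula needs h >= 0, which holds on the simplex *)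
have outside u : ~~ (0 <= first_coord u) -> weighted_integrand (eta := eta) 0 u = 0.
  rewrite /weighted_integrand; case: ifP => // /simplexb_first/andP[-> _] //.
have iH := cintegrable_normc measurableT (ie n).
have bound u : (\int[mu]_x (normc (layer (tcons (x, u))))%:E <=
    (normc (weighted_integrand (eta := eta) n.+1 u))%:E)%E.
  under eq_integral => x _ do rewrite layerE.
  have [h0|h0] := boolP (0 <= first_coord u); last first.
    rewrite outside//; under eq_integral do rewrite mulr0 normc0.
    by rewrite integral0 lee_fin normc_ge0.
  under eq_integral => x _.
    rewrite normcM normc_real ger0_norm// mulrC EFinM; over.
  rewrite ge0_integralZl ?lee_fin ?normc_ge0//; last 2 first.
    exact/measurable_EFinP.
    by move=> x _; rewrite lee_fin.
  rewrite qint// -EFinM lee_fin (weighted_integrandE n.+1) normcM normc_real mulrC.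
  rewrite ger0_norm ?exprn_ge0//; apply: ler_wpM2r; first exact: normc_ge0.
  by rewrite ler_pdivrMr// ler_peMr ?exprn_ge0// ler1n.
split; first exact: (cintegrable_tuple_measureS mlayer iH bound).
rewrite (cintegral_tuple21 mlayer iH bound) /weighted_integral mulrC -cintegralZ//.
apply: eq_cintegral => u _.
under eq_cintegral do rewrite layerE.
rewrite (weighted_integrandE n.+1).
have [h0|h0] := boolP (0 <= first_coord u); last first.
  rewrite outside// !mulr0; under eq_cintegral do rewrite mulr0.
  exact: cintegral0.
under eq_cintegral do rewrite mulrC.
have iq : mu.-integrable setT (EFin \o q (first_coord u)).
  apply/integrableP; split; first exact/measurable_EFinP.
  under eq_integral do rewrite /= ger0_norm//.
  by rewrite qint// ltry.
rewrite cintegral_real// /Rintegral qint//= rmorphM fmorphV rmorph_nat; ring.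
Qed.

End Layers.

Section IteratedSide.
Context (R : realType).
Local Notation mu := (@lebesgue_measure R).
Local Notation tup N := (N.-tuple (measurableTypeR R)).
Implicit Types (eta : seq (R[i] -> R[i])).

Definition inv_form (t : R[i]) : R[i] := t^-1.
Definition pole_form (z t : R[i]) : R[i] := (z - t)^-1.

Lemma cmeasurable_realc : cmeasurable setT (fun s : measurableTypeR R => s%:C : R[i]).
Proof. by split=> /=; [exact: measurable_id|exact: measurable_cst]. Qed.

Lemma cmeasurable_pullback_inv : cmeasurable setT (pullback inv_form : measurableTypeR R -> R[i]).
Proof.
rewrite (_ : pullback _ = fun s => - (- s%:C)^-1); last by apply/funext => s; rewrite pullbackE.
by apply/cmeasurableN/cmeasurableV/cmeasurableN; exact: cmeasurable_realc.
Qed.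

Lemma cmeasurable_pullback_pole z :
  cmeasurable setT (pullback (pole_form z) : measurableTypeR R -> R[i]).
Proof.
rewrite (_ : pullback _ = fun s => - (z - - s%:C)^-1); last by apply/funext => s; rewrite pullbackE.
apply/cmeasurableN/cmeasurableV/cmeasurableD; first exact: cmeasurable_cst.
by apply/cmeasurableN/cmeasurableN; exact: cmeasurable_realc.
Qed.

Lemma measurable_moment n h : measurable_fun setT (moment n h : measurableTypeR R -> R).
Proof.
apply: measurable_fun_ifT => //.
by apply: measurable_and; apply: measurable_fun_ler => //; exact: measurable_cst.
Qed.

Lemma measurable_momentV n h : measurable_fun setT (momentV n h : measurableTypeR R -> R).
Proof.
apply: measurable_fun_ifT => //.
  by apply: measurable_and; apply: measurable_fun_ler => //; exact: measurable_cst.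
by apply: measurable_funM => //; exact: measurable_inv.
Qed.

Lemma measurable_thead N : measurable_fun setT (fun t : tup N.+1 => thead t : R).
Proof. exact: measurable_tnth. Qed.

Lemma measurable_moment_tuple n N : measurable_fun setT
  (fun t : tup N.+1 => moment n (first_coord [tuple of behead t]) (thead t)).
Proof.
apply: measurable_fun_ifT => //; first exact: measurable_between.
by apply: measurable_funX; exact: measurable_thead.
Qed.

Lemma measurable_momentV_tuple n N : measurable_fun setT
  (fun t : tup N.+1 => momentV n (first_coord [tuple of behead t]) (thead t)).
Proof.
apply: measurable_fun_ifT => //; first exact: measurable_between.
apply: measurable_funM; first by apply: measurable_funX; exact: measurable_thead.
exact: (measurableT_comp (@measurable_inv R) (@measurable_thead N)).
Qed.

Lemma weighted_integrand_nil a (t : tup 0) : weighted_integrand (eta := [::]) a t = 1.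
Proof.
rewrite /weighted_integrand /simplexb /first_coord (tuple0 t) /= ler01 expr1n mul1r.
by rewrite /iterated_integrand big_ord0.
Qed.

Lemma weighted_integral_nil a : weighted_integral (R := R) [::] a = 1.
Proof.
rewrite /weighted_integral; under eq_cintegral do rewrite weighted_integrand_nil.
rewrite /cintegral /Rintegral /= !integral_dirac//= indicE in_setT mul1r mulr0.
by [].
Qed.

Lemma well_behaved_nil : well_behaved (R := R) [::].
Proof.
split.
  rewrite (_ : weighted_integrand _ = fun=> 1); first exact: cmeasurable_cst.
  by apply/funext => t; exact: weighted_integrand_nil.
move=> a; rewrite (_ : weighted_integrand _ = fun=> 1); last first.
  by apply/funext => t; exact: weighted_integrand_nil.
have h (c : R) : (lebesgue_tuple R 0).-integrable setT (fun=> c%:E).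
  apply/integrableP; split; first exact: measurable_cst.
  by rewrite /= integral_dirac//= diracE mem_set// mul1e ltry.
by split; exact: h.
Qed.

(** Integrating t^(a+1) dt/t over [0, h] gives h^(a+1) / (a+1). *)
Lemma weighted_inv eta : well_behaved eta -> well_behaved (inv_form :: eta) /\
  forall a, weighted_integral (inv_form :: eta) a.+1 = weighted_integral eta a.+1 / a.+1%:R.
Proof.
move=> wb.
have key a := layer_integral (n := a) wb (momentV_ge0 a) (fun h => integral_momentV a (h := h))
  (measurable_momentV a) (@measurable_momentV_tuple a _).
have e a : weighted_integrand (eta := inv_form :: eta) a.+1 =
   (fun t : tup (size eta).+1 => (momentV a (first_coord [tuple of behead t]) (thead t))%:C *
      weighted_integrand (eta := eta) 0 [tuple of behead t]).
  apply/funext => t; rewrite (@weighted_integrand_cons R inv_form eta) /momentV.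
  case: ifP => _; last by rewrite mul0r.
  by rewrite pullbackE /inv_form invrN opprK rmorphM fmorphV.
split; [split|].
- apply: cmeasurable_weighted_cons; first exact: cmeasurable_pullback_inv.
  by case: wb.
- by move=> a; rewrite e; case: (key a).
- by move=> a; rewrite /weighted_integral e; case: (key a).
Qed.

Lemma weighted_nseq_inv eta k : well_behaved eta ->
  well_behaved (nseq k inv_form ++ eta) /\
  forall a, weighted_integral (nseq k inv_form ++ eta) a.+1 =
            weighted_integral eta a.+1 / a.+1%:R ^+ k.
Proof.
move=> wb; elim: k => [|k [wbk IHk]]; first by split=> // a; rewrite expr0 divr1.
have [wbk' ek] := weighted_inv wbk.
split=> // a; rewrite [LHS]ek IHk exprSr invfM mulrA.
by [].
Qed.

(** With w = - 1/z, the pulled-back form - ds / (z + s) is w ds / (1 - w s), the sum of the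
geometric series w^l s^(l-1) ds. *)
Lemma pullback_pole (w : R[i]) (x rho : R) : w != 0 -> normc w <= rho -> rho < 1 ->
  0 <= x <= 1 ->
  [/\ pullback (pole_form (- w^-1)) x = w / (1 - w * x%:C), 1 - w * x%:C != 0 &
      normc (pullback (pole_form (- w^-1)) x) <= (1 - rho)^-1].
Proof.
move=> w0 wr r1 /andP[x0 x1].
have h : 1 - rho <= normc (1 - w * x%:C).
  have : normc (1 : R[i]) <= normc (1 - w * x%:C) + normc (w * x%:C).
    by rewrite -{1}(subrK (w * x%:C) 1) normcD.
  rewrite normc1 normcM normc_real ger0_norm//.
  have : normc w * x <= rho by rewrite (le_trans _ wr)// ler_piMr// normc_ge0.
  lra.
have n0 : 1 - w * x%:C != 0 by rewrite -normc_gt0 (lt_le_trans _ h)// subr_gt0.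
have e : pullback (pole_form (- w^-1)) x = w / (1 - w * x%:C).
  rewrite pullbackE /pole_form (_ : - w^-1 - - x%:C = - ((1 - w * x%:C) / w)).
    by rewrite invrN opprK invf_div.
  by field.
split=> //; rewrite e normcM normcV -[leRHS]mul1r; apply: ler_pM; rewrite ?invr_ge0 ?normc_ge0//.
  lra.
by rewrite lef_pV2// posrE ?subr_gt0// (lt_le_trans _ h)// subr_gt0.
Qed.

(** One step of the geometric series, w / (1 - w s) = w + w s w / (1 - w s), trades the
exponent a for a + 1; K steps give the sum. The integrals that remain are bounded
uniformly in a since t_1^a <= 1. *)
Lemma weighted_pole eta (w : R[i]) (rho : R) : w != 0 -> normc w <= rho -> rho < 1 ->
  well_behaved eta ->
  [/\ well_behaved (pole_form (- w^-1) :: eta),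
      cintegrable (lebesgue_tuple R (size eta).+1) setT
        (weighted_integrand (eta := pole_form (- w^-1) :: eta) 0),
      (exists2 B, 0 <= B & forall a, normc (weighted_integral (pole_form (- w^-1) :: eta) a) <= B) &
      forall a K, weighted_integral (pole_form (- w^-1) :: eta) a =
        \sum_(1 <= l < K.+1) w ^+ l * (weighted_integral eta (a + l) / (a + l)%:R)
        + w ^+ K * weighted_integral (pole_form (- w^-1) :: eta) (a + K)].
Proof.
move=> w0 wr r1 wb.
set f := pole_form (- w^-1).
have key a := layer_integral (n := a) wb (moment_ge0 a) (fun h => integral_moment a (h := h))
  (measurable_moment a) (@measurable_moment_tuple a _).
pose layer a (t : tup (size eta).+1) := (moment a (first_coord [tuple of behead t]) (thead t))%:C *
      weighted_integrand (eta := eta) 0 [tuple of behead t].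
have mW a : cmeasurable setT (weighted_integrand (eta := f :: eta) a).
  apply: cmeasurable_weighted_cons; first exact: cmeasurable_pullback_pole.
  by case: wb.
have dom a (t : tup (size eta).+1) : normc (weighted_integrand (eta := f :: eta) a t) <=
    (1 - rho)^-1 * normc (layer a t).
  rewrite (@weighted_integrand_cons R f eta) /layer /moment; case: ifP => [/andP[x0 xh]|_]; last first.
    by rewrite mul0r normc0 mulr0.
  rewrite [in leLHS]mulrAC [in leLHS]mulrC normcM.
  have [s|s] := boolP (simplexb [tuple of behead t]); last first.
    by rewrite /weighted_integrand (negbTE s) mulr0 normc0 !mulr0.
  have /andP[_ h1] := simplexb_first s.
  apply: ler_wpM2r; first exact: normc_ge0.
  have x01 : 0 <= thead t <= 1 by rewrite x0 (le_trans xh).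
  by have [] := pullback_pole w0 wr r1 x01.
have iW a : cintegrable (lebesgue_tuple R (size eta).+1) setT
    (weighted_integrand (eta := f :: eta) a).
  have [il _] := key a.
  have := integrableZl measurableT (1 - rho)^-1 (cintegrable_normc measurableT il).
  by move/(cintegrable_le measurableT (mW a)); apply=> t _; exact: dom.
have step a : weighted_integral (f :: eta) a =
    w * (weighted_integral eta a.+1 / a.+1%:R) + w * weighted_integral (f :: eta) a.+1.
  have [il <-] := key a; rewrite /weighted_integral -!cintegralZ//.
  rewrite -cintegralD//; [|exact: cintegrableZ..].
  apply: eq_cintegral => t _; rewrite !(@weighted_integrand_cons R f eta) /moment.
  case: ifP => [/andP[x0 xh]|_]; last by rewrite mul0r !mulr0 addr0.
  have [s|s] := boolP (simplexb [tuple of behead t]); last first.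
    by rewrite {1 2 3}/weighted_integrand (negbTE s) !mulr0 addr0.
  have /andP[_ h1] := simplexb_first s.
  have x01 : 0 <= thead t <= 1 by rewrite x0 (le_trans xh).
  have [-> n0 _] := pullback_pole w0 wr r1 x01.
  by rewrite exprSr rmorphM /=; field.
split.
- by split=> // a; exact: iW.
- exact: iW.
- pose g t := normc (weighted_integrand (eta := f :: eta) 0 t).
  have ig : (lebesgue_tuple R (size eta).+1).-integrable setT (EFin \o g).
    exact: (cintegrable_normc measurableT (iW 0)).
  exists (2 * Rintegral (lebesgue_tuple R (size eta).+1) setT g).
    by rewrite mulr_ge0// Rintegral_ge0// => t _; exact: normc_ge0.
  move=> a; apply: (normc_cintegral_le measurableT (mW a) ig) => t _.
  have [s|s] := boolP (simplexb t); last by rewrite /g /weighted_integrand (negbTE s).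
  have /andP[c0 c1] := simplexb_first s.
  rewrite /g weighted_integrandE normcM normc_real; apply: ler_piMl; first exact: normc_ge0.
  by rewrite ger0_norm ?exprn_ge0// exprn_ile1.
- move=> a; elim=> [|K IHK]; first by rewrite big_geq// add0r expr0 mul1r addn0.
  rewrite IHK [in RHS]big_nat_recr//= -addrA; congr (_ + _).
  by rewrite [in LHS]step exprSr addnS mulrDr !mulrA.
Qed.

Lemma I_forms_recl m (n : 'I_m.+1 -> nat) (z : 'I_m.+1 -> R[i]) :
  I_forms n z = pole_form (z ord0) :: (nseq (n ord0).-1 inv_form ++
    I_forms (fun k => n (lift ord0 k)) (fun k => z (lift ord0 k))).
Proof. by rewrite /I_forms enum_ordSl /= -map_comp. Qed.

(** A block multiplies the term of gap l by w^l / (a + l) for its first form and by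
1 / (a + l) for each of the n - 1 forms dt/t, as in the truncated sum. *)
Lemma weighted_I_forms m (n : 'I_m -> nat) (w : 'I_m -> R[i]) (rho : R) :
  (forall k, 0 < n k)%N -> (forall k, w k != 0) -> (forall k, normc (w k) <= rho) ->
  0 <= rho < 1 ->
  well_behaved (I_forms n (fun k => - (w k)^-1)) /\
  exists2 C, 0 <= C & forall a K,
    normc (weighted_integral (I_forms n (fun k => - (w k)^-1)) a
           - trunc_sum K n w a%:R) <= C * rho ^+ K.
Proof.
move=> n0 w0 wr r01; have /andP[r0 r1] := r01.
elim: m n w n0 w0 wr => [|m IHm] n w n0 w0 wr.
  rewrite /I_forms (size0nil (size_enum_ord 0)) /=; split; first exact: well_behaved_nil.
  by exists 0 => // a K; rewrite weighted_integral_nil subrr normc0 mul0r.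
have [wb [C C0 HC]] := IHm (fun k => n (lift ord0 k)) (fun k => w (lift ord0 k))
  (fun k => n0 (lift ord0 k)) (fun k => w0 (lift ord0 k)) (fun k => wr (lift ord0 k)).
rewrite I_forms_recl; set rest := I_forms _ _ in wb HC *.
have [wbk ek] := weighted_nseq_inv (n ord0).-1 wb.
have [wb' _ [B B0 HB] e] := weighted_pole (w0 ord0) (wr ord0) r1 wbk.
split=> //; exists ((1 - rho)^-1 * C + B).
  by rewrite addr_ge0// mulr_ge0// invr_ge0; lra.
move=> a K; rewrite (e a K) /= addrAC mulrDl (le_trans (normcD _ _))// lerD//; last first.
  rewrite normcM normcX mulrC; apply: ler_pM; rewrite ?normc_ge0 ?exprn_ge0 ?normc_ge0//.
  by rewrite lerXn2r ?nnegrE ?normc_ge0.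
rewrite -sumrB (le_trans (normc_sum _ _ _))//.
apply: (@le_trans _ _ (\sum_(1 <= l < K.+1) rho ^+ l * (C * rho ^+ K))); last first.
  rewrite -mulr_suml -mulrA; apply: ler_wpM2r; first by rewrite mulr_ge0// exprn_ge0.
  exact: geometric_sum_le.
rewrite !big_nat; apply: ler_sum => l /andP[l1 _].
have -> : w ord0 ^+ l * (weighted_integral (nseq (n ord0).-1 inv_form ++ rest) (a + l) / (a + l)%:R) -
   w ord0 ^+ l / (a%:R + l%:R) ^+ n ord0 *
      trunc_sum K (fun k => n (lift ord0 k)) (fun k => w (lift ord0 k)) (a%:R + l%:R) =
   w ord0 ^+ l * (((a%:R + l%:R) ^+ n ord0)^-1 * (weighted_integral rest (a + l)%N -
      trunc_sum K (fun k => n (lift ord0 k)) (fun k => w (lift ord0 k)) (a + l)%:R)).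
  case: l l1 => // l _; rewrite addnS ek -addnS -natrD.
  have nE : n ord0 = (n ord0).-1.+1 by rewrite prednK.
  set k := (n ord0).-1 in nE *; rewrite nE (exprSr (a + l.+1)%:R) invfM; ring.
rewrite normcM normcX; apply: ler_pM; rewrite ?exprn_ge0 ?normc_ge0//.
  by rewrite lerXn2r ?nnegrE ?normc_ge0.
rewrite normcM -[leRHS]mul1r; apply: ler_pM; rewrite ?normc_ge0//.
by apply: normc_pow_inv_le1 => //; rewrite cRe_nat.
Qed.

Lemma weighted_integral0 eta :
  weighted_integral eta 0 = iterated_integral (@neg_path R) eta.
Proof.
rewrite /iterated_integral cintegral_mkcond; apply: eq_cintegral => t _.
rewrite /weighted_integrand expr0 mul1r.
by have -> : (t \in @simplex R (size eta)) = simplexb t by apply/idP/idP; rewrite inE.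
Qed.

Lemma iterated_integral_converges_weighted eta :
  cintegrable (lebesgue_tuple R (size eta)) setT (weighted_integrand (eta := eta) 0) ->
  iterated_integral_converges (@neg_path R) eta.
Proof.
move=> h; apply/cintegrable_mkcond; first exact: measurable_simplex.
apply: eq_cintegrable h => // t _; rewrite /weighted_integrand expr0 mul1r.
by have -> : (t \in @simplex R (size eta)) = simplexb t by apply/idP/idP; rewrite inE.
Qed.

Lemma I_converges_pos m (n : 'I_m -> nat) (w : 'I_m -> R[i]) (rho : R) : (0 < m)%N ->
  (forall k, 0 < n k)%N -> (forall k, w k != 0) -> (forall k, normc (w k) <= rho) ->
  0 <= rho < 1 -> I_converges n (fun k => - (w k)^-1) (-1).
Proof.
case: m n w => // m n w _ n0 w0 wr r01; have /andP[r0 r1] := r01.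
have [wb _] := @weighted_I_forms m (fun k => n (lift ord0 k)) (fun k => w (lift ord0 k)) rho
  (fun k => n0 (lift ord0 k)) (fun k => w0 (lift ord0 k)) (fun k => wr (lift ord0 k)) r01.
have [wbk _] := weighted_nseq_inv (n ord0).-1 wb.
have [_ ci _ _] := weighted_pole (w0 ord0) (wr ord0) r1 wbk.
apply: iterated_integral_converges_weighted; rewrite I_forms_recl; exact: ci.
Qed.

End IteratedSide.

(** * The polylogarithm series *)

Section LiSide.
Context (R : realType).

(** A term of the series written with the gaps between the indices of s; a is the
index that precedes s. *)
Fixpoint gap_term (m : nat) : ('I_m -> nat) -> ('I_m -> R[i]) -> nat -> seq nat -> R[i] :=
  match m with
  | 0 => fun _ _ _ _ => 1
  | m'.+1 => fun n w a s =>
      w ord0 ^+ (head 0%N s - a) / (head 0%N s)%:R ^+ n ord0 *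
        @gap_term m' (fun k => n (lift ord0 k)) (fun k => w (lift ord0 k)) (head 0%N s) (behead s)
  end.

(** With w = - exp(omega) these are the arguments of the polylogarithm. *)
Definition ratio_args m (w : 'I_m -> R[i]) (j : 'I_m) : R[i] :=
  if insub j.+1 is Some j' then w j / w j' else w j.

Lemma ratio_args_lift m (w : 'I_m.+1 -> R[i]) (j : 'I_m) :
  ratio_args w (lift ord0 j) = ratio_args (fun k => w (lift ord0 k)) j.
Proof.
rewrite /ratio_args; have [h|h] := ltnP j.+1 m.
  by rewrite !insubT//=; congr (_ / w _); apply: val_inj.
by rewrite !insubN//= -leqNgt.
Qed.

Lemma ratio_args0 m (w : 'I_m.+2 -> R[i]) : ratio_args w ord0 = w ord0 / w (lift ord0 ord0).
Proof. by rewrite /ratio_args insubT; congr (_ / w _); apply: val_inj. Qed.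

Lemma ratio_args_last (w : 'I_1 -> R[i]) : ratio_args w ord0 = w ord0.
Proof. by rewrite /ratio_args insubN. Qed.

Lemma Li_term_gap m (n : 'I_m.+1 -> nat) (w : 'I_m.+1 -> R[i]) (a : nat) (k : m.+1.-tuple nat) :
  (forall j, w j != 0) -> path ltn a k ->
  Li_term n (ratio_args w) k = w ord0 ^+ a * gap_term n w a k.
Proof.
elim: m n w a k => [|m IHm] n w a k w0; case/tupleP: k => x k /= /andP[ax pk].
  by rewrite /Li_term big_ord_recl big_ord0 /= ratio_args_last mulr1 mulr1 mulrA -exprD subnKC ?(ltnW ax).
rewrite /Li_term big_ord_recl /= ratio_args0.
have := IHm (fun j => n (lift ord0 j)) (fun j => w (lift ord0 j)) x k (fun j => w0 (lift ord0 j)) pk.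
rewrite /Li_term => e.
under eq_bigr => j _ do rewrite ratio_args_lift tnthS.
have fld (A D U I G : R[i]) : U != 0 -> A * D / U * I * (U * G) = A * (D * I * G).
  by move=> U0; field.
rewrite e /= expr_div_n -[in w ord0 ^+ x](subnKC (ltnW ax)) exprD fld//.
by rewrite expf_neq0.
Qed.

Lemma sum_tuple_cons (V : nmodType) (T : finType) m (P : pred (m.+1.-tuple T)) (F : m.+1.-tuple T -> V) :
  \sum_(k | P k) F k = \sum_x \sum_(k' : m.-tuple T | P [tuple of x :: k']) F [tuple of x :: k'].
Proof.
rewrite pair_big_dep /=.
rewrite (reindex (fun p : T * m.-tuple T => [tuple of p.1 :: p.2])) //=.
exists (fun k : m.+1.-tuple T => (thead k, [tuple of behead k])) => [[x k] _|k _] /=.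
  by congr pair; apply: val_inj.
by rewrite [RHS]tuple_eta.
Qed.

Lemma sum_gap (V : nmodType) (N a K : nat) (f : nat -> V) : (N <= a + K.+1)%N ->
  \sum_(x < N | (a < x)%N) f x = \sum_(1 <= l < K.+1) (if (a + l < N)%N then f (a + l)%N else 0).
Proof.
move=> NK; rewrite -(big_mkord (fun x => a < x)%N f) (big_nat_widen _ _ _ _ _ NK).
rewrite (@big_cat_nat _ _ _ a.+1) ?addnS ?ltnS ?leq_addr//= big1_seq ?add0r; last first.
  by move=> x; rewrite mem_index_iota => /andP[/andP[ax _]]; rewrite ltnS (leqNgt x a) ax.
rewrite -add1n big_addn -?addnS addKn big_mkcond; apply: eq_big_nat => l /andP[l1 _].
by rewrite leq_add2r l1 (addnC a).
Qed.

Definition gap_sum m (n : 'I_m -> nat) (w : 'I_m -> R[i]) (a N : nat) : R[i] :=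
  \sum_(k : m.-tuple 'I_N | path ltn a (map val k)) gap_term n w a (map val k).

Lemma gap_sum_recl m (n : 'I_m.+1 -> nat) (w : 'I_m.+1 -> R[i]) a N K : (N <= a + K.+1)%N ->
  gap_sum n w a N = \sum_(1 <= l < K.+1) (if (a + l < N)%N then
    w ord0 ^+ l / (a + l)%:R ^+ n ord0 *
      gap_sum (fun k => n (lift ord0 k)) (fun k => w (lift ord0 k)) (a + l) N else 0).
Proof.
move=> NK; rewrite /gap_sum sum_tuple_cons.
transitivity (\sum_(x < N | (a < x)%N) (w ord0 ^+ (x - a) / x%:R ^+ n ord0 *
    gap_sum (fun k => n (lift ord0 k)) (fun k => w (lift ord0 k)) x N)).
  rewrite [RHS]big_mkcond; apply: eq_bigr => x _ /=.
  case: ifP => ax; last by rewrite big_pred0.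
  by rewrite /gap_sum mulr_sumr.
rewrite (sum_gap (fun x => w ord0 ^+ (x - a) / x%:R ^+ n ord0 *
    gap_sum (fun k => n (lift ord0 k)) (fun k => w (lift ord0 k)) x N) NK).
by apply: eq_bigr => l _; rewrite addKn.
Qed.

(** The gap sum keeps the last index below N, the truncated sum keeps each gap below
K + 1. With |w| <= theta^2, one factor theta^l makes the sum over the gap converge
and the other pays for the loss of l in the exponent N - a. *)
Lemma gap_sum_trunc m (n : 'I_m -> nat) (w : 'I_m -> R[i]) (theta : R) : 0 <= theta < 1 ->
  (forall k, normc (w k) <= theta ^+ 2) ->
  exists2 C, 0 <= C & forall a N K, (N <= K.+1)%N ->
    normc (trunc_sum K n w a%:R - gap_sum n w a N) <= C * theta ^+ (N - a).
Proof.
move=> t01; have /andP[t0 t1] := t01.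
have r01 : 0 <= theta ^+ 2 < 1 by rewrite exprn_ge0//= exprn_ilt1.
elim: m n w => [|m IHm] n w wr.
  exists 0 => // a N K _; rewrite mul0r /gap_sum /= (big_pred1 [tuple]).
    by rewrite subrr normc0.
  by move=> k; rewrite (tuple0 k) /=; apply/esym/eqP.
have [C C0 HC] := IHm (fun k => n (lift ord0 k)) _ (fun k => wr (lift ord0 k)).
pose B := (1 - theta ^+ 2)^-1 ^+ m.
have B0 : 0 <= B by rewrite exprn_ge0// invr_ge0 subr_ge0 ltW//; case/andP : r01.
exists ((1 - theta)^-1 * (C + B)).
  by rewrite mulr_ge0 ?addr_ge0// invr_ge0; lra.
move=> a N K NK; rewrite (gap_sum_recl _ _ (K := K)); last by rewrite (leq_trans NK)// leq_addl.
rewrite /= -sumrB (le_trans (normc_sum _ _ _))//.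
apply: (@le_trans _ _ (\sum_(1 <= l < K.+1) theta ^+ l * ((C + B) * theta ^+ (N - a)))); last first.
  rewrite -mulr_suml -mulrA; apply: ler_wpM2r; first by rewrite mulr_ge0 ?addr_ge0// exprn_ge0.
  exact: geometric_sum_le.
rewrite !big_nat; apply: ler_sum => l /andP[l1 _].
have wl : normc (w ord0 ^+ l) <= theta ^+ l * theta ^+ l.
  by rewrite normcX -exprMn -expr2 lerXn2r ?nnegrE ?normc_ge0 ?exprn_ge0.
have iv : normc ((a%:R + l%:R : R[i]) ^+ n ord0)^-1 <= 1.
  by apply: normc_pow_inv_le1 => //; rewrite cRe_nat.
have tN := exprn_ge0 (N - a) t0; have tl := exprn_ge0 l t0.
have -> : theta ^+ l * ((C + B) * theta ^+ (N - a)) =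
  theta ^+ l * (C * theta ^+ (N - a)) + theta ^+ l * (B * theta ^+ (N - a)) by ring.
(* the gap sum has no term with a + l >= N: there l >= N - a pays for the error *)
case: ifPn => [aN|]; last first.
  rewrite -leqNgt subr0 => Na.
  rewrite -[leLHS]add0r lerD ?mulr_ge0//.
  rewrite normcM normcM (@le_trans _ _ (theta ^+ l * theta ^+ l * 1 * B))//.
    apply: ler_pM; rewrite ?mulr_ge0 ?normc_ge0//.
      by apply: ler_pM; rewrite ?normc_ge0.
    apply: trunc_sum_le => //.
    by rewrite cReD !cRe_nat addr_ge0.
  rewrite mulr1 -mulrA ler_wpM2l// mulrC ler_wpM2l//.
  by apply: ler_wiXn2l => //; [exact: ltW|rewrite leq_subLR].
rewrite natrD -mulrBr normcM normcM -[leLHS]addr0 lerD ?mulr_ge0//.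
rewrite (@le_trans _ _ (theta ^+ l * theta ^+ l * 1 * (C * theta ^+ (N - (a + l)))))//.
  apply: ler_pM; rewrite ?mulr_ge0 ?normc_ge0//.
    by apply: ler_pM; rewrite ?normc_ge0.
  by have := HC (a + l)%N N K NK; rewrite natrD.
rewrite mulr1 -!mulrA ler_wpM2l// mulrCA ler_wpM2l// -exprD.
by rewrite subnDA subnKC// leq_subRL ?(ltnW aN)// (leq_trans _ (ltnW aN))// leq_addr.
Qed.

(** Bounding every denominator by 1 leaves a product of geometric series. *)
Lemma gap_sum_norm_le m (n : 'I_m -> nat) (w : 'I_m -> R[i]) (rho : R) a N : 0 <= rho < 1 ->
  (forall k, normc (w k) <= rho) ->
  \sum_(k : m.-tuple 'I_N | path ltn a (map val k)) normc (gap_term n w a (map val k))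
    <= (1 - rho)^-1 ^+ m.
Proof.
move=> r01; have /andP[r0 r1] := r01.
elim: m n w a => [|m IHm] n w a wr.
  rewrite (big_pred1 [tuple]) /= ?normc1//.
  by move=> k; rewrite (tuple0 k) /=; apply/esym/eqP.
have i0 : 0 <= (1 - rho)^-1 ^+ m by rewrite exprn_ge0// invr_ge0; lra.
rewrite sum_tuple_cons exprS.
apply: (@le_trans _ _ (\sum_(x < N | (a < x)%N) rho ^+ (x - a) * (1 - rho)^-1 ^+ m)).
  rewrite [leRHS]big_mkcond; apply: ler_sum => x _ /=.
  case: ifP => ax; last by rewrite big_pred0.
  have := IHm (fun k => n (lift ord0 k)) _ x (fun k => wr (lift ord0 k)).
  move=> IH; under eq_bigr do rewrite normcM.
  rewrite -mulr_sumr; apply: ler_pM; rewrite ?normc_ge0 ?sumr_ge0//.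
    by move=> k _; exact: normc_ge0.
  rewrite normcM normcX -[leRHS]mulr1; apply: ler_pM; rewrite ?exprn_ge0 ?normc_ge0//.
    by rewrite lerXn2r ?nnegrE ?normc_ge0.
  have := @normc_pow_inv_le1 R 0 x (n ord0); rewrite add0r; apply=> //.
  exact: leq_ltn_trans ax.
rewrite (@sum_gap _ N a N (fun x => rho ^+ (x - a) * (1 - rho)^-1 ^+ m)) ?leq_addl//; last first.
  by rewrite (leq_trans (leqnSn N))// leq_addl.
apply: (@le_trans _ _ (\sum_(1 <= l < N.+1) rho ^+ l * (1 - rho)^-1 ^+ m)); last first.
  by rewrite -mulr_suml ler_wpM2r// geometric_sum_le.
apply: ler_sum => l _; rewrite addKn; case: ifP => // _.
by rewrite mulr_ge0// exprn_ge0.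
Qed.

(** A finite set of tuples has bounded entries, so it lies in one of the finite sums. *)
Lemma summable_tuples m (g : m.-tuple nat -> R) (C : R) :
  (forall N, \sum_(k : m.-tuple 'I_N | path ltn 0%N (map val k)) `|g (map_tuple val k)| <= C) ->
  summable [set k : m.-tuple nat | path ltn 0%N k] (fun k => (g k)%:E).
Proof.
move=> gC; rewrite /summable /esum; apply: (@le_lt_trans _ _ C%:E); last exact: ltry.
apply: ge_ereal_sup => _ [A [fA AS] <-].
rewrite fsbig_finite//=; set s := finmap.enum_fset (fset_set A).
pose N := (\max_(k <- s) \max_(x <- (k : m.-tuple nat)) x).
have sN (k : m.-tuple nat) x : k \in s -> x \in (k : seq nat) -> (x < N.+1)%N.
  move=> ks xk; rewrite ltnS.
  apply: (@leq_trans (\max_(y <- (k : seq nat)) y)).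
    exact: (@leq_bigmax_seq nat k xpredT (fun y => y) x xk isT).
  exact: (@leq_bigmax_seq _ s xpredT (fun k : m.-tuple nat => \max_(y <- (k : seq nat)) y)%N k ks isT).
have := gC N.+1; rewrite -lee_fin; apply: le_trans.
pose t := [seq map_tuple val k | k <- enum [pred k : m.-tuple 'I_N.+1 | path ltn 0%N (map val k)]].
have ut : uniq t.
  rewrite map_inj_uniq ?enum_uniq// => k1 k2 /(congr1 val)/= e.
  by apply: val_inj; apply: (inj_map val_inj).
have st : {subset s <= t}.
  move=> k ks; apply/mapP.
  have e : map val (map_tuple (@inord N) k) = k :> seq nat.
    rewrite /= -map_comp map_id_in// => x xk /=; rewrite inordK//.
    exact: sN ks xk.
  exists (map_tuple (@inord N) k); last by apply: val_inj; rewrite /= -[LHS]e.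
  rewrite mem_enum inE e; apply: AS; move: ks; rewrite /s in_fset_set// inE.
  by [].
have pe : perm_eq s [seq k <- t | k \in s].
  apply: uniq_perm; rewrite ?filter_uniq//; first exact: finmap.fset_uniq.
  move=> k; rewrite mem_filter; apply/idP/idP; last by case/andP.
  by move=> ks; rewrite ks st.
rewrite (perm_big _ pe)/= big_filter sumEFin lee_fin.
rewrite big_map big_enum_cond /= [leLHS]big_mkcondr.
by apply: ler_sum => k _; case: ifP.
Qed.

End LiSide.

(** * Comparison of the three sides *)

Section Assembly.
Context (R : realType).

(** The form in which two sides with the same truncated sums are identified. *)
Lemma le_geometric_eq0 (d C rho : R) : 0 <= d -> 0 <= rho < 1 ->
  (forall K : nat, d <= C * rho ^+ K) -> d = 0.
Proof.
move=> d0 /andP[r0 r1] h; apply/eqP; rewrite eq_le d0 andbT.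
have lim0 : geometric C rho @ \oo --> 0 by apply: cvg_geometric; rewrite ger0_norm.
have <- := cvg_lim (@Rhausdorff R) lim0.
apply: limr_ge; first by apply/cvg_ex; exists 0.
by near=> K; exact: h.
Unshelve. all: by end_near. Qed.

Lemma Li_args_ratio m (omega : 'I_m -> R[i]) :
  Li_args omega = ratio_args (fun k => - cexp (omega k)).
Proof.
apply/funext => j; rewrite /Li_args /ratio_args; case: insub => // j'.
by rewrite cexpD cexpN invrN mulrNN.
Qed.

Lemma Li_partial_gap m (n : 'I_m.+1 -> nat) (w : 'I_m.+1 -> R[i]) N :
  (forall j, w j != 0) -> Li_partial n (ratio_args w) N = gap_sum n w 0 N.
Proof.
move=> w0; apply: eq_bigr => k pk.
by rewrite (Li_term_gap (a := 0%N) n w0)//= expr0 mul1r.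
Qed.

Lemma Li_converges_ratio m (n : 'I_m.+1 -> nat) (w : 'I_m.+1 -> R[i]) (rho : R) :
  (forall j, w j != 0) -> 0 <= rho < 1 -> (forall j, normc (w j) <= rho) ->
  Li_converges n (ratio_args w).
Proof.
move=> w0 r01 wr.
have bound N : \sum_(k : m.+1.-tuple 'I_N | path ltn 0%N (map val k))
    normc (Li_term n (ratio_args w) (map_tuple val k)) <= (1 - rho)^-1 ^+ m.+1.
  apply: le_trans (gap_sum_norm_le n 0 N r01 wr).
  by apply: ler_sum => k pk; rewrite (Li_term_gap (a := 0%N) n w0)//= expr0 mul1r.
split; apply: (@summable_tuples R m.+1 _ ((1 - rho)^-1 ^+ m.+1)) => N;
  apply: le_trans (bound N); apply: ler_sum => k _; [exact: normRe_le|exact: normIm_le].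
Qed.

Lemma Li_eq_limit m (n : 'I_m -> nat) (z : 'I_m -> R[i]) (l : R[i]) (C theta : R) :
  0 <= theta < 1 -> (forall N, normc (Li_partial n z N - l) <= C * theta ^+ N) ->
  Li n z = l.
Proof.
move=> /andP[t0 t1] h.
have lim0 : geometric C theta @ \oo --> 0 by apply: cvg_geometric; rewrite ger0_norm.
have conv (u : nat -> R) (v : R) : (forall N, `|u N - v| <= C * theta ^+ N) -> lim (u @ \oo) = v.
  move=> uv; apply/cvg_lim => //.
  apply: (@squeeze_cvgr _ _ _ _ (fun N => v - geometric C theta N) (fun N => v + geometric C theta N)).
  - by near=> N; have := uv N; rewrite ler_distl.
  - by rewrite -[X in _ --> X]subr0; apply: cvgB => //; exact: cvg_cst.
  - by rewrite -[X in _ --> X]addr0; apply: cvgD => //; exact: cvg_cst.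
rewrite /Li (conv _ (Re l)) ?(conv _ (Im l)); first by case: l {h}.
- by move=> N; apply: le_trans (h N); rewrite -cImN -cImD; exact: normIm_le.
- by move=> N; apply: le_trans (h N); rewrite -cReN -cReD; exact: normRe_le.
Unshelve. all: by end_near. Qed.

(** Each variable contributes (- i) (- i)^(- n_k) = i^(n_k - 1), since n_k >= 1. *)
Lemma kern_product_shifted (eps : R) m (n : 'I_m -> nat) (omega : 'I_m -> R[i]) x :
  (forall k, 0 < n k)%N ->
  kern_product eps n omega 0 x =
  'i ^+ (\sum_(k < m) n k - m) * shifted_integrand n omega eps x.
Proof.
move=> n0; have ii : 'i * 'i = -1 :> R[i] by rewrite -expr2 sqr_i.
have -> : (\sum_(k < m) n k - m = \sum_(k < m) (n k - 1))%N.
  by rewrite sumnB ?sum1_card ?card_ord// => k _; exact: n0.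
rewrite /kern_product /shifted_integrand /fourier_integrand expr_sum -big_split /=.
apply: eq_bigr => k _; rewrite add0r /kern.
under eq_bigr do rewrite zlineE.
rewrite -mulr_sumr exprMn invfM.
have i0 : 'i != 0 :> R[i] by rewrite -normc_gt0 normc_i.
have -> : ((- 'i) ^+ n k)^-1 = 'i ^+ n k :> R[i].
  by rewrite -exprVn; congr (_ ^+ _); apply: (mulfI (x := - 'i)); rewrite ?oppr_eq0// divff ?oppr_eq0// mulNr ii opprK.
rewrite -{1}(prednK (n0 k)) exprS subn1.
set A := 'i ^+ _; set B := cexp _ / _; set D := ((\sum_(j < m | _) _) ^+ _)^-1.
transitivity (- ('i * 'i) * (A * (B * D))); first by ring.
by rewrite ii opprK mul1r.
Qed.

End Assembly.

Theorem corollary2p2 (R : realType) (m : nat) (hm : (1 <= m)%N)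
    (n : 'I_m -> nat) (hn : forall k, (0 < n k)%N)
    (omega : 'I_m -> R[i])
    (him : forall k, `|complex.Im (omega k)| < pi)
    (hre : forall j k : 'I_m, (j < k)%N -> complex.Re (omega j) < complex.Re (omega k))
    (hre0 : forall k, complex.Re (omega k) < 0) :
  [/\ I_converges n (fun k => cexp (- omega k)) (-1),
      Li_converges n (Li_args omega),
      I_integral n (fun k => cexp (- omega k)) (-1) = Li n (Li_args omega)
    & \forall eps \near 0^'+,
        fourier_converges n omega eps /\
        Li n (Li_args omega) =
        'i%C ^+ ((\sum_(k < m) n k) - m)%N * fourier_integral n omega eps].
Proof.
case: m hm n hn omega him hre hre0 => // m _ n hn omega him hre hre0.
pose w k : R[i] := - cexp (omega k).
(* the real parts increase, so the last |w k| is the largest *)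
pose theta := expR (Re (omega ord_max) / 2); pose rho := theta ^+ 2.
have rhoE : rho = expR (Re (omega ord_max)).
  by rewrite /rho -expRM_natl; congr expR; rewrite mulrC divfK.
have t01 : 0 <= theta < 1.
  by rewrite expR_ge0/= -expR0 ltr_expR pmulr_llt0.
have r01 : 0 <= rho < 1 by rewrite /rho exprn_ge0 ?expR_ge0//= exprn_ilt1//; case/andP: t01.
have w0 k : w k != 0 by rewrite oppr_eq0 cexp_neq0.
have wr k : normc (w k) <= rho.
  rewrite normcN normc_cexp rhoE ler_expR.
  have [->//|kmax] := eqVneq k ord_max.
  apply/ltW/hre; rewrite ltn_neqAle -ltnS ltn_ord andbT.
  by apply: contra kmax => /eqP e; apply/eqP/val_inj.
have zE : (fun k => cexp (- omega k)) = (fun k => - (w k)^-1).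
  by apply/funext => k; rewrite cexpN /w invrN opprK.
rewrite Li_args_ratio -/w zE.
have [wb [C1 C10 HI]] := weighted_I_forms hn w0 wr r01.
have IE : I_integral n (fun k => - (w k)^-1) (-1) = weighted_integral (I_forms n (fun k => - (w k)^-1)) 0.
  by rewrite weighted_integral0.
have [C2 C20 HL] := gap_sum_trunc n t01 wr.
set I0 := I_integral _ _ _ in IE *.
have LiE : Li n (ratio_args w) = I0.
  apply: (@Li_eq_limit R m.+1 n _ I0 (C1 + C2) theta t01) => N.
  rewrite Li_partial_gap// IE.
  have h1 := HI 0%N N; have h2 := HL 0%N N N (leqnSn N); rewrite subn0 in h2.
  set A := weighted_integral _ _ in h1 *; set G := gap_sum _ _ _ _ in h2 *.
  set T := trunc_sum _ _ _ _ in h1 h2.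
  rewrite (_ : G - A = - ((A - T) + (T - G))) ?normcN; last by ring.
  rewrite (le_trans (normcD _ _))// mulrDl lerD// (le_trans h1)// ler_wpM2l//.
  have /andP[t0 t1] := t01.
  rewrite /rho -exprM mulnC; apply: ler_wiXn2l => //; [exact: ltW|].
  by rewrite leq_pmulr.
split.
- exact: (I_converges_pos _ hn w0 wr r01).
- exact: Li_converges_ratio w0 r01 wr.
- by [].
rewrite LiE; near=> eps.
have e01 : 0 < eps < 2^-1.
  by apply/andP; split; [near: eps; exact: nbhs_right_gt|near: eps; exact: nbhs_right_lt].
have [C3 C30 HF] := kern_product_integral_trunc e01 n him r01 wr.
have ck := cintegrable_kern_product e01 n him (lexx (Re (0 : R[i]))).
pose J : R[i] := 'i ^+ ((\sum_(k < m.+1) n k) - m.+1).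
have J0 : J != 0 by rewrite expf_neq0// -normc_gt0 normc_i.
have kE x : kern_product eps n omega 0 x = J * shifted_integrand n omega eps x.
  exact: kern_product_shifted.
have cs : fourier_converges n omega eps.
  rewrite /fourier_converges.
  have := cintegrableZ measurableT J^-1 ck; apply: eq_cintegrable => // x _.
  by rewrite kE mulrA mulVf// mul1r.
split=> //; rewrite -[RHS](cintegralZ measurableT J cs).
under eq_cintegral do rewrite -kE.
apply/eqP; rewrite -subr_eq0 -normc_eq0; apply/eqP.
apply: (@le_geometric_eq0 _ _ (C1 + C3) rho (normc_ge0 _) r01) => K.
have h1 := HI 0%N K; have h2 := HF 0 K (lexx _).
rewrite IE; set A := weighted_integral _ _ in h1 *; set G := cintegral _ _ _ in h2 *.
set T := trunc_sum _ _ _ _ in h1 h2.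
rewrite (_ : A - G = (A - T) - (G - T)); last by ring.
by rewrite (le_trans (normcB _ _))// mulrDl lerD.
Unshelve. all: by end_near. Qed.
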